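(* Among all simplices (tetrahedra) contained in the closed unit ball $B_2^3\subset\mathbb{R}^3$, the regular tetrahedron inscribed in the unit sphere has the maximum mean width, and it is the unique maximizer up to isometry.
   Context: For a convex body $K\subset\mathbb{R}^3$, $h_K(u)=\max_{x\in K}u\cdot x$ and the mean width is $w(K)=2\int_{\mathbb{S}^2}h_K(u)\,d\mu(u)$, where $\mu$ is the uniform probability measure on the unit sphere $\mathbb{S}^2$. *)

(* Defs.v *)
From Stdlib Require Import Reals.
From Coquelicot Require Import Coquelicot.
Open Scope R_scope.

Definition R3 : Type := (R * R * R)%type.

Definition vadd (x y : R3) : R3 :=
  let '(x1, x2, x3) := x in let '(y1, y2, y3) := y in (x1 + y1, x2 + y2, x3 + y3).
Definition vscale (a : R) (x : R3) : R3 :=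
  let '(x1, x2, x3) := x in (a * x1, a * x2, a * x3).
Definition vzero : R3 := (0, 0, 0).
Definition dot (x y : R3) : R :=
  let '(x1, x2, x3) := x in let '(y1, y2, y3) := y in x1 * y1 + x2 * y2 + x3 * y3.
Definition vsub (x y : R3) : R3 := vadd x (vscale (-1) y).
Definition dist3 (x y : R3) : R := sqrt (dot (vsub x y) (vsub x y)).

Definition unit_ball (x : R3) : Prop := dot x x <= 1.

Definition aff_indep4 (p0 p1 p2 p3 : R3) : Prop :=
  forall a0 a1 a2 a3 : R,
    a0 + a1 + a2 + a3 = 0 ->
    vadd (vadd (vscale a0 p0) (vscale a1 p1)) (vadd (vscale a2 p2) (vscale a3 p3)) = vzero ->
    a0 = 0 /\ a1 = 0 /\ a2 = 0 /\ a3 = 0.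

Definition conv4 (p0 p1 p2 p3 : R3) (x : R3) : Prop :=
  exists a0 a1 a2 a3 : R,
    0 <= a0 /\ 0 <= a1 /\ 0 <= a2 /\ 0 <= a3 /\ a0 + a1 + a2 + a3 = 1 /\
    x = vadd (vadd (vscale a0 p0) (vscale a1 p1)) (vadd (vscale a2 p2) (vscale a3 p3)).

Definition is_simplex (K : R3 -> Prop) : Prop :=
  exists p0 p1 p2 p3 : R3, aff_indep4 p0 p1 p2 p3 /\ (forall x, K x <-> conv4 p0 p1 p2 p3 x).

Definition support (K : R3 -> Prop) (u : R3) : R :=
  real (Lub_Rbar (fun r => exists x, K x /\ r = dot u x)).

Definition sph (theta phi : R) : R3 :=
  (sin theta * cos phi, sin theta * sin phi, cos theta).

(* Integral against the uniform probability measure on S^2, in spherical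
   coordinates: d mu = (1/(4 pi)) sin(theta) d theta d phi. *)
Definition sphere_avg (f : R3 -> R) : R :=
  / (4 * PI) *
  RInt (fun phi => RInt (fun theta => f (sph theta phi) * sin theta) 0 PI) 0 (2 * PI).

Definition mean_width (K : R3 -> Prop) : R := 2 * sphere_avg (support K).

Definition reg_tet : R3 -> Prop :=
  conv4 (/ sqrt 3, / sqrt 3, / sqrt 3) (/ sqrt 3, - / sqrt 3, - / sqrt 3)
        (- / sqrt 3, / sqrt 3, - / sqrt 3) (- / sqrt 3, - / sqrt 3, / sqrt 3).

Definition isometry3 (f : R3 -> R3) : Prop := forall x y, dist3 (f x) (f y) = dist3 x y.

Definition image3 (f : R3 -> R3) (K : R3 -> Prop) (y : R3) : Prop := exists x, K x /\ y = f x.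

(* Main.v *)
(** By monotonicity of the mean width one may push the vertices to the sphere.  For unit
    vertices x_i the sphere is cut into the cells C_i = {u : u.x_i >= u.x_j for all j}, and for any
    constant lam the integral of (h_K - lam) is the sum over i of the integrals of (u.x_i - lam)
    over C_i.  In polar coordinates around x_i the cell is {cot theta >= max_j m_j(phi)}, where m_j
    is a linear function of (cos phi, sin phi) of norm cot(alpha_ij / 2), alpha_ij being the
    angle between x_i and x_j.  For the right lam, the excess of the radial integral over its
    value for the cap of cosine 1/3 is at most the sum over j of the positive parts of the
    excesses determined by the single m_j; this bound is an equality for the regular tetrahedron.
    Each term depends only on alpha_ij, and a one-variable study shows that it is maximal exactly
    when cos alpha_ij = -1/3. *)
Require Import Defs.
From Stdlib Require Import Reals Lra Lia Arith.
From Coquelicot Require Import Coquelicot.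
Open Scope R_scope.

(** * Integration over the sphere *)

(** The baseline cosine 1/3 is the one at the corners of a regular cell. There two neighbours tie,
    so the positive bumps of the three neighbours meet without overlapping and splitting them loses
    nothing. The radial excess is a downward parabola in the cosine; with one root at 1/3, choosing
    [lam] amounts to choosing the other root [q0], and [q0] is tuned so that the contribution of a
    single neighbour is critical at the regular angle.

    The integral is an iterated Riemann integral in spherical coordinates. This form hides the
    rotation invariance and suits continuous integrands, not indicators of cells. Both obstacles are
    met inside one algebra of continuous functions, [nice]: invariance is read off the moments of
    monomials and transported by uniform approximation, and the cells are replaced by continuous
    weights whose total defect is O(1/n).

    Pushing vertices to the sphere yields the inequality, but uniqueness only among inscribed
    tetrahedra. That a maximizer is inscribed is obtained by pushing the same vertex in two
    different directions. *)

Lemma cont_plus (f g : R -> R) x :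
  continuous f x -> continuous g x -> continuous (fun t => f t + g t) x.
Proof. intros; now apply (continuous_plus f g). Qed.

Lemma cont_minus (f g : R -> R) x :
  continuous f x -> continuous g x -> continuous (fun t => f t - g t) x.
Proof. intros; now apply (continuous_minus f g). Qed.

Lemma cont_mult (f g : R -> R) x :
  continuous f x -> continuous g x -> continuous (fun t => f t * g t) x.
Proof. intros; now apply (continuous_mult f g). Qed.

Lemma cont_comp (f g : R -> R) x :
  continuous f x -> continuous g (f x) -> continuous (fun t => g (f t)) x.
Proof. intros; now apply (continuous_comp f g). Qed.

Lemma cont_abs (f : R -> R) x :
  continuous f x -> continuous (fun t => Rabs (f t)) x.
Proof. intros; apply cont_comp; [assumption | apply continuous_Rabs]. Qed.

Lemma cont_const (c x : R) : continuous (fun _ : R => c) x.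
Proof. apply continuous_const. Qed.

Lemma cont_id (x : R) : continuous (fun t : R => t) x.
Proof. apply continuous_id. Qed.

Lemma cont_sin x : continuous sin x.
Proof. apply continuity_pt_filterlim, continuity_sin. Qed.

Lemma cont_cos x : continuous cos x.
Proof. apply continuity_pt_filterlim, continuity_cos. Qed.

Lemma cont_opp (f : R -> R) x : continuous f x -> continuous (fun t => - f t) x.
Proof. intros; now apply (continuous_opp f). Qed.

Lemma Rmax_abs a b : Rmax a b = / 2 * (a + b + Rabs (a - b)).
Proof. unfold Rmax, Rabs; destruct (Rle_dec a b), (Rcase_abs (a - b)); lra. Qed.

Lemma Rmin_abs a b : Rmin a b = / 2 * (a + b - Rabs (a - b)).
Proof. unfold Rmin, Rabs; destruct (Rle_dec a b), (Rcase_abs (a - b)); lra. Qed.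

Lemma cont_max (f g : R -> R) x :
  continuous f x -> continuous g x -> continuous (fun t => Rmax (f t) (g t)) x.
Proof.
  intros Hf Hg.
  apply continuous_ext with (fun t => / 2 * (f t + g t + Rabs (f t - g t))).
  { intros; now rewrite Rmax_abs. }
  apply cont_mult; [apply cont_const |].
  apply cont_plus; [now apply cont_plus | apply cont_abs; now apply cont_minus].
Qed.

Ltac cont :=
  lazymatch goal with
  | |- continuous (fun _ => ?c) _ => apply (cont_const c)
  | |- continuous (fun t => t) _ => apply cont_id
  | |- continuous (fun t => Rplus (@?f t) (@?g t)) _ => apply (cont_plus f g); cont
  | |- continuous (fun t => Rminus (@?f t) (@?g t)) _ => apply (cont_minus f g); cont
  | |- continuous (fun t => Rmult (@?f t) (@?g t)) _ => apply (cont_mult f g); cont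
  | |- continuous (fun t => Ropp (@?f t)) _ => apply (cont_opp f); cont
  | |- continuous (fun t => Rabs (@?f t)) _ => apply (cont_abs f); cont
  | |- continuous (fun t => Rmax (@?f t) (@?g t)) _ => apply (cont_max f g); cont
  | |- continuous (fun t => sin (@?f t)) _ => apply (cont_comp f sin); [cont | apply cont_sin]
  | |- continuous (fun t => cos (@?f t)) _ => apply (cont_comp f cos); [cont | apply cont_cos]
  | |- continuous sin _ => apply cont_sin
  | |- continuous cos _ => apply cont_cos
  | |- _ => auto
  end.

Ltac ringR := lazymatch goal with |- ?a = ?b => change (@eq R a b); ring end.

Lemma cont_ex_RInt (f : R -> R) a b : (forall x, continuous f x) -> ex_RInt f a b.
Proof. intros H; apply (@ex_RInt_continuous R_CompleteNormedModule); auto. Qed.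

Lemma RInt_plusR (f g : R -> R) a b :
  ex_RInt f a b -> ex_RInt g a b ->
  RInt (fun x => f x + g x) a b = RInt f a b + RInt g a b.
Proof. intros; now apply (RInt_plus f g). Qed.

Lemma RInt_minusR (f g : R -> R) a b :
  ex_RInt f a b -> ex_RInt g a b ->
  RInt (fun x => f x - g x) a b = RInt f a b - RInt g a b.
Proof. intros; now apply (RInt_minus f g). Qed.

Lemma RInt_scalR (f : R -> R) k a b :
  ex_RInt f a b -> RInt (fun x => k * f x) a b = k * RInt f a b.
Proof. intros; now apply (RInt_scal f). Qed.

Lemma RInt_constR (c a b : R) : RInt (fun _ : R => c) a b = (b - a) * c.
Proof. rewrite RInt_const; reflexivity. Qed.

Lemma RInt_ChaslesR (f : R -> R) a b c :
  ex_RInt f a b -> ex_RInt f b c -> RInt f a b + RInt f b c = RInt f a c.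
Proof. intros; now apply (RInt_Chasles f). Qed.

Lemma RInt_derivR (F f : R -> R) a b :
  (forall x, Rmin a b <= x <= Rmax a b -> is_derive F x (f x)) ->
  (forall x, Rmin a b <= x <= Rmax a b -> continuous f x) ->
  RInt f a b = F b - F a.
Proof.
  intros H1 H2; apply is_RInt_unique.
  exact (is_RInt_derive (V:=R_CompleteNormedModule) F f a b H1 H2).
Qed.

Lemma Lipschitz_continuous (f : R -> R) C x :
  (forall y, Rabs (f y - f x) <= C * Rabs (y - x)) -> continuous f x.
Proof.
  intros H. apply continuity_pt_filterlim.
  intros e He.
  assert (HC : 0 <= C).
  { specialize (H (x + 1)). replace (x + 1 - x) with 1 in H by lra.
    rewrite Rabs_R1 in H. generalize (Rabs_pos (f (x + 1) - f x)); lra. }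
  exists (e / (C + 1)); split.
  { apply Rdiv_lt_0_compat; lra. }
  intros y [_ Hy]. simpl in *; unfold Rdist in *.
  apply Rle_lt_trans with (1 := H y).
  apply Rle_lt_trans with (C * (e / (C + 1))).
  { apply Rmult_le_compat_l; lra. }
  apply Rmult_lt_reg_r with (C + 1); [lra |].
  field_simplify; [nra | lra].
Qed.

Lemma RInt_shift (f : R -> R) a b t :
  (forall x, continuous f x) ->
  RInt (fun x => f (x + t)) a b = RInt f (a + t) (b + t).
Proof.
  intros Hf.
  generalize (RInt_comp_lin (V:=R_CompleteNormedModule) f 1 t a b (cont_ex_RInt _ _ _ Hf)).
  rewrite !Rmult_1_l. intros <-. apply RInt_ext; intros x _.
  unfold scal; simpl; unfold mult; simpl. now rewrite !Rmult_1_l.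
Qed.

Lemma RInt_periodic (f : R -> R) T t :
  (forall x, continuous f x) -> (forall x, f (x + T) = f x) ->
  RInt (fun x => f (x + t)) 0 T = RInt f 0 T.
Proof.
  intros Hf Hp. rewrite RInt_shift by exact Hf.
  replace (0 + t) with t by lra.
  assert (E : RInt f T (T + t) = RInt f 0 t).
  { replace (T + t) with (t + T) by lra. replace T with (0 + T) at 1 by lra.
    rewrite <- RInt_shift by exact Hf. apply RInt_ext; auto. }
  assert (H1 := RInt_ChaslesR f t 0 T (cont_ex_RInt _ _ _ Hf) (cont_ex_RInt _ _ _ Hf)).
  assert (H2 := RInt_ChaslesR f t T (T + t) (cont_ex_RInt _ _ _ Hf) (cont_ex_RInt _ _ _ Hf)).
  assert (H3 := RInt_ChaslesR f t 0 t (cont_ex_RInt _ _ _ Hf) (cont_ex_RInt _ _ _ Hf)).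
  rewrite RInt_point in H3. unfold zero in H3; simpl in H3. lra.
Qed.

Lemma vec_ext (a b c a' b' c' : R) : a = a' -> b = b' -> c = c' -> (a, b, c) = (a', b', c').
Proof. now intros -> -> ->. Qed.

(* The lattice-ordered algebra generated by the linear forms; it contains the support
   functions, and its members are uniform limits of polynomials on the sphere. *)
Inductive nice : (R3 -> R) -> Prop :=
| nice_const c : nice (fun _ => c)
| nice_dot w : nice (fun u => dot w u)
| nice_plus f g : nice f -> nice g -> nice (fun u => f u + g u)
| nice_mult f g : nice f -> nice g -> nice (fun u => f u * g u)
| nice_abs f : nice f -> nice (fun u => Rabs (f u))
| nice_ext f g : (forall u, f u = g u) -> nice f -> nice g.

Lemma nice_scal k f : nice f -> nice (fun u => k * f u).
Proof. intros; apply (nice_mult (fun _ => k)); [constructor | assumption]. Qed.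

Lemma nice_minus f g : nice f -> nice g -> nice (fun u => f u - g u).
Proof.
  intros Hf Hg. apply nice_ext with (fun u => f u + -1 * g u); [intros; lra |].
  apply nice_plus; [assumption | now apply nice_scal].
Qed.

Lemma nice_max f g : nice f -> nice g -> nice (fun u => Rmax (f u) (g u)).
Proof.
  intros Hf Hg. apply nice_ext with (fun u => / 2 * (f u + g u + Rabs (f u - g u))).
  { intros; now rewrite Rmax_abs. }
  apply nice_scal, nice_plus; [now apply nice_plus | now apply nice_abs, nice_minus].
Qed.

Lemma nice_min f g : nice f -> nice g -> nice (fun u => Rmin (f u) (g u)).
Proof.
  intros Hf Hg. apply nice_ext with (fun u => / 2 * (f u + g u - Rabs (f u - g u))).
  { intros; now rewrite Rmin_abs. }
  apply nice_scal, nice_minus; [now apply nice_plus | now apply nice_abs, nice_minus].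
Qed.

Lemma cont_sph_dot w phi theta : continuous (fun t => dot w (sph t phi)) theta.
Proof. destruct w as [[a b] c]; unfold dot, sph; cont. Qed.

Lemma nice_cont f : nice f -> forall phi theta, continuous (fun t => f (sph t phi)) theta.
Proof.
  induction 1 as [c|w|f g _ IHf _ IHg|f g _ IHf _ IHg|f _ IHf|f g E _ IHf]; intros phi theta.
  - apply cont_const.
  - apply cont_sph_dot.
  - apply (cont_plus (fun t => f (sph t phi)) (fun t => g (sph t phi))); auto.
  - apply (cont_mult (fun t => f (sph t phi)) (fun t => g (sph t phi))); auto.
  - apply (cont_abs (fun t => f (sph t phi))); auto.
  - apply continuous_ext with (fun t => f (sph t phi)); auto.
Qed.

Lemma Lipschitz_of_derive (f f' : R -> R) C :
  (forall x, is_derive f x (f' x)) -> (forall x, Rabs (f' x) <= C) ->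
  forall x y, Rabs (f y - f x) <= C * Rabs (y - x).
Proof.
  intros Hd HC x y.
  destruct (MVT_gen f x y f') as [c [_ Hc]].
  - intros; apply Hd.
  - intros z _; apply continuity_pt_filterlim, (ex_derive_continuous f z); exists (f' z); apply Hd.
  - rewrite Hc, Rabs_mult. apply Rmult_le_compat_r; [apply Rabs_pos | apply HC].
Qed.

Lemma sin_Lipschitz x y : Rabs (sin y - sin x) <= 1 * Rabs (y - x).
Proof.
  apply (Lipschitz_of_derive sin cos 1).
  - intros; apply is_derive_Reals, derivable_pt_lim_sin.
  - intros z; apply Rabs_le; generalize (COS_bound z); lra.
Qed.

Lemma cos_Lipschitz x y : Rabs (cos y - cos x) <= 1 * Rabs (y - x).
Proof.
  apply (Lipschitz_of_derive cos (fun x => - sin x) 1).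
  - intros; apply is_derive_Reals, derivable_pt_lim_cos.
  - intros z; apply Rabs_le; generalize (SIN_bound z); lra.
Qed.

Lemma Rabs_sin_le x : Rabs (sin x) <= 1.
Proof. apply Rabs_le; generalize (SIN_bound x); lra. Qed.

Lemma Rabs_cos_le x : Rabs (cos x) <= 1.
Proof. apply Rabs_le; generalize (COS_bound x); lra. Qed.

(** The Lipschitz constant in the longitude is uniform in the colatitude; this makes [meridian f]
    continuous, so that the outer integral exists. The bound [B] is carried along for the product
    case. *)
Lemma nice_bounded_Lipschitz f : nice f -> exists B C, 0 <= B /\ 0 <= C /\
  forall theta phi psi, Rabs (f (sph theta phi)) <= B /\
    Rabs (f (sph theta psi) - f (sph theta phi)) <= C * Rabs (psi - phi).
Proof.
  induction 1 as [c|w|f g _ [B1 [C1 [HB1 [HC1 H1]]]] _ [B2 [C2 [HB2 [HC2 H2]]]]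
    |f g _ [B1 [C1 [HB1 [HC1 H1]]]] _ [B2 [C2 [HB2 [HC2 H2]]]]
    |f _ [B1 [C1 [HB1 [HC1 H1]]]]|f g E _ [B1 [C1 [HB1 [HC1 H1]]]]].
  - exists (Rabs c), 0. repeat split; try apply Rabs_pos; try lra.
    rewrite Rminus_diag, Rabs_R0; lra.
  - destruct w as [[a b] c].
    exists (Rabs a + Rabs b + Rabs c), (Rabs a + Rabs b).
    generalize (Rabs_pos a) (Rabs_pos b) (Rabs_pos c); intros Ha Hb Hc.
    split; [lra|]. split; [lra|]. intros th phi psi; unfold dot, sph. split.
    + eapply Rle_trans; [apply Rabs_triang|]. apply Rplus_le_compat.
      * eapply Rle_trans; [apply Rabs_triang|]. rewrite !Rabs_mult.
        apply Rplus_le_compat; (rewrite <- Rmult_1_r; apply Rmult_le_compat_l; [assumption|]);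
          rewrite <- (Rmult_1_r 1); apply Rmult_le_compat; try apply Rabs_pos;
          first [apply Rabs_sin_le | apply Rabs_cos_le].
      * rewrite Rabs_mult, <- Rmult_1_r. apply Rmult_le_compat_l; [assumption | apply Rabs_cos_le].
    + replace (_ - _) with (a * (sin th * (cos psi - cos phi)) + b * (sin th * (sin psi - sin phi))) by ring.
      eapply Rle_trans; [apply Rabs_triang|]. rewrite !Rabs_mult, Rmult_plus_distr_r.
      apply Rplus_le_compat; (apply Rmult_le_compat_l; [assumption|]);
        rewrite <- (Rmult_1_l (Rabs (psi - phi))), <- (Rmult_1_l (1 * _));
        apply Rmult_le_compat; try apply Rabs_pos; try apply Rabs_sin_le;
        first [apply cos_Lipschitz | apply sin_Lipschitz].
  - exists (B1 + B2), (C1 + C2). split; [lra|]. split; [lra|]. intros th phi psi.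
    destruct (H1 th phi psi) as [h1 h2]. destruct (H2 th phi psi) as [h3 h4]. split.
    + eapply Rle_trans; [apply Rabs_triang|]. lra.
    + replace (_ - _) with ((f (sph th psi) - f (sph th phi)) + (g (sph th psi) - g (sph th phi))) by ring.
      eapply Rle_trans; [apply Rabs_triang|]. lra.
  - exists (B1 * B2), (B1 * C2 + B2 * C1). split; [now apply Rmult_le_pos|].
    split; [apply Rplus_le_le_0_compat; now apply Rmult_le_pos|]. intros th phi psi.
    destruct (H1 th phi psi) as [h1 h2]. destruct (H2 th phi psi) as [h3 h4].
    destruct (H1 th psi phi) as [h5 _]. split.
    + rewrite Rabs_mult. apply Rmult_le_compat; try apply Rabs_pos; assumption.
    + replace (_ - _) with (f (sph th psi) * (g (sph th psi) - g (sph th phi)) + g (sph th phi) * (f (sph th psi) - f (sph th phi))) by ring.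
      eapply Rle_trans; [apply Rabs_triang|]. rewrite !Rabs_mult, Rmult_plus_distr_r.
      apply Rplus_le_compat; rewrite Rmult_assoc; apply Rmult_le_compat; try apply Rabs_pos; assumption.
  - exists B1, C1. split; [lra|]. split; [lra|]. intros th phi psi.
    destruct (H1 th phi psi) as [h1 h2]. split.
    + now rewrite Rabs_Rabsolu.
    + eapply Rle_trans; [apply Rabs_triang_inv2|assumption].
  - exists B1, C1. split; [lra|]. split; [lra|]. intros th phi psi. rewrite <- !E. apply H1.
Qed.

Definition meridian (f : R3 -> R) (phi : R) : R :=
  RInt (fun theta => f (sph theta phi) * sin theta) 0 PI.

Definition sint (f : R3 -> R) : R := RInt (meridian f) 0 (2 * PI).

Lemma sphere_avg_sint f : sphere_avg f = / (4 * PI) * sint f.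
Proof. reflexivity. Qed.

Lemma nice_ex_meridian f phi a b : nice f -> ex_RInt (fun theta => f (sph theta phi) * sin theta) a b.
Proof. intros H. apply cont_ex_RInt; intros.
  apply (cont_mult (fun t => f (sph t phi)) sin); [now apply nice_cont | apply cont_sin]. Qed.

Lemma nice_meridian_cont f : nice f -> forall phi, continuous (meridian f) phi.
Proof.
  intros H phi. destruct (nice_bounded_Lipschitz f H) as [B [C [HB [HC HL]]]].
  apply Lipschitz_continuous with (PI * C). intros psi. unfold meridian.
  rewrite <- RInt_minusR by now apply nice_ex_meridian.
  replace (PI * C * Rabs (psi - phi)) with ((PI - 0) * (C * Rabs (psi - phi))) by ring.
  apply abs_RInt_le_const.
  - generalize PI_RGT_0; lra.
  - apply (ex_RInt_minus (V:=R_NormedModule)); now apply nice_ex_meridian.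
  - intros t _. rewrite <- Rmult_minus_distr_r, Rabs_mult.
    destruct (HL t phi psi) as [_ h].
    rewrite <- (Rmult_1_r (C * _)).
    apply Rmult_le_compat; try apply Rabs_pos; [assumption | apply Rabs_sin_le].
Qed.

Lemma nice_ex_sint f a b : nice f -> ex_RInt (meridian f) a b.
Proof. intros; apply cont_ex_RInt; now apply nice_meridian_cont. Qed.

Lemma sint_plus f g : nice f -> nice g -> sint (fun u => f u + g u) = sint f + sint g.
Proof.
  intros Hf Hg. unfold sint. rewrite <- RInt_plusR by now apply nice_ex_sint.
  apply RInt_ext; intros phi _. unfold meridian.
  rewrite <- RInt_plusR by now apply nice_ex_meridian.
  apply RInt_ext; intros; ringR.
Qed.

Lemma sint_scal k f : nice f -> sint (fun u => k * f u) = k * sint f.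
Proof.
  intros Hf. unfold sint. rewrite <- RInt_scalR by now apply nice_ex_sint.
  apply RInt_ext; intros phi _. unfold meridian.
  rewrite <- RInt_scalR by now apply nice_ex_meridian.
  apply RInt_ext; intros; ringR.
Qed.

Lemma sint_minus f g : nice f -> nice g -> sint (fun u => f u - g u) = sint f - sint g.
Proof.
  intros Hf Hg. unfold sint. rewrite <- RInt_minusR by now apply nice_ex_sint.
  apply RInt_ext; intros phi _. unfold meridian.
  rewrite <- RInt_minusR by now apply nice_ex_meridian.
  apply RInt_ext; intros; ringR.
Qed.

Lemma dot_sph theta phi : dot (sph theta phi) (sph theta phi) = 1.
Proof.
  unfold dot, sph. generalize (sin2_cos2 theta) (sin2_cos2 phi); unfold Rsqr; intros H1 H2.
  transitivity (sin theta * sin theta * (sin phi * sin phi + cos phi * cos phi) + cos theta * cos theta);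
    [ring | rewrite H2; lra].
Qed.

Lemma sint_ext f g : (forall u, dot u u = 1 -> f u = g u) -> sint f = sint g.
Proof.
  intros H. unfold sint, meridian. apply RInt_ext; intros phi _.
  apply RInt_ext; intros theta _. rewrite H; [reflexivity | apply dot_sph].
Qed.

Lemma sint_le f g : nice f -> nice g -> (forall u, dot u u = 1 -> f u <= g u) -> sint f <= sint g.
Proof.
  intros Hf Hg H. generalize PI_RGT_0; intros.
  apply RInt_le; try lra; try now apply nice_ex_sint.
  intros phi _. apply RInt_le; try lra; try now apply nice_ex_meridian.
  intros theta Ht. apply Rmult_le_compat_r.
  - apply sin_ge_0; lra.
  - apply H, dot_sph.
Qed.

Lemma sint_const c : sint (fun _ => c) = 4 * PI * c.
Proof.
  assert (E : RInt (fun theta => c * sin theta) 0 PI = 2 * c).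
  { rewrite (RInt_derivR (fun t => - c * cos t)).
    - rewrite cos_PI, cos_0; ringR.
    - intros; auto_derive; [trivial | ring].
    - intros; cont. }
  unfold sint, meridian. rewrite (RInt_ext _ (fun _ => 2 * c)) by (intros; apply E).
  rewrite RInt_constR. ring.
Qed.

Lemma sint_dist f g e : nice f -> nice g -> (forall u, dot u u = 1 -> Rabs (f u - g u) <= e) ->
  Rabs (sint f - sint g) <= 4 * PI * e.
Proof.
  intros Hf Hg H. apply Rabs_le. rewrite <- sint_minus by assumption.
  rewrite <- (sint_const e).
  split.
  - apply Rle_trans with (sint (fun _ => - e)).
    + rewrite !sint_const; lra.
    + apply sint_le; [constructor | now apply nice_minus |].
      intros u Hu. generalize (proj1 (Rabs_le_between _ _) (H u Hu)); lra.
  - apply sint_le; [now apply nice_minus | constructor |].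
    intros u Hu. generalize (proj1 (Rabs_le_between _ _) (H u Hu)); lra.
Qed.

(** * Rotation invariance *)

(** The hypothesis says that [L] has an adjoint, which is linearity in a matrix-free form. *)
Lemma nice_comp (L : R3 -> R3) :
  (forall w, exists w', forall u, dot w (L u) = dot w' u) ->
  forall f, nice f -> nice (fun u => f (L u)).
Proof.
  intros HL f Hf.
  induction Hf as [c|w|f g _ IHf _ IHg|f g _ IHf _ IHg|f _ IHf|f g E _ IHf].
  - constructor.
  - destruct (HL w) as [w' Hw]. apply nice_ext with (dot w'); [intros; now rewrite Hw | constructor].
  - now apply (nice_plus (fun u => f (L u)) (fun u => g (L u))).
  - now apply (nice_mult (fun u => f (L u)) (fun u => g (L u))).
  - now apply (nice_abs (fun u => f (L u))).
  - apply nice_ext with (fun u => f (L u)); auto.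
Qed.

Definition zrot (t : R) (u : R3) : R3 :=
  let '(x, y, z) := u in (cos t * x - sin t * y, sin t * x + cos t * y, z).

Definition xzswap (u : R3) : R3 := let '(x, y, z) := u in (z, y, x).

Lemma zrot_sph t theta phi : zrot t (sph theta phi) = sph theta (phi + t).
Proof.
  unfold zrot, sph. rewrite cos_plus, sin_plus. apply vec_ext; ring.
Qed.

(** A rotation about the z-axis only shifts the longitude, and [meridian f] is periodic of period 2
    pi. *)
Lemma sint_zrot t f : nice f -> sint (fun u => f (zrot t u)) = sint f.
Proof.
  intros Hf. unfold sint.
  rewrite (RInt_ext _ (fun phi => meridian f (phi + t))).
  - apply (RInt_periodic (meridian f)); [now apply nice_meridian_cont |].
    intros x. unfold meridian. apply RInt_ext; intros th _.
    unfold sph. now rewrite cos_plus, sin_plus, cos_2PI, sin_2PI, !Rmult_0_r, !Rmult_1_r,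
      Rminus_0_r, Rplus_0_r.
  - intros phi _. unfold meridian. apply RInt_ext; intros th _. now rewrite zrot_sph.
Qed.

(** * Polynomials on the sphere and uniform approximation *)

Definition mono (i j k : nat) (u : R3) : R := let '(x, y, z) := u in x ^ i * y ^ j * z ^ k.

Inductive poly : (R3 -> R) -> Prop :=
| poly_mono c i j k : poly (fun u => c * mono i j k u)
| poly_plus f g : poly f -> poly g -> poly (fun u => f u + g u)
| poly_ext f g : (forall u, f u = g u) -> poly f -> poly g.

Lemma nice_pow f n : nice f -> nice (fun u => f u ^ n).
Proof.
  intros Hf. induction n as [|n IH]; simpl; [constructor |].
  now apply (nice_mult f (fun u => f u ^ n)).
Qed.

Lemma mono_nice i j k : nice (mono i j k).
Proof.
  apply nice_ext with (fun u => dot (1, 0, 0) u ^ i * dot (0, 1, 0) u ^ j * dot (0, 0, 1) u ^ k).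
  - intros [[x y] z]; unfold dot, mono.
    now rewrite !Rmult_0_l, !Rmult_1_l, !Rplus_0_r, !Rplus_0_l.
  - apply (nice_mult (fun u => _ ^ _ * _ ^ _)); [apply nice_mult |]; apply nice_pow; constructor.
Qed.

Lemma poly_nice f : poly f -> nice f.
Proof.
  induction 1 as [c i j k|f g _ IHf _ IHg|f g E _ IHf].
  - apply nice_scal, mono_nice.
  - now apply nice_plus.
  - now apply nice_ext with f.
Qed.

Lemma poly_mult f g : poly f -> poly g -> poly (fun u => f u * g u).
Proof.
  intros Hf Hg. induction Hf as [c i j k|f f' _ IHf _ IHf'|f f' E _ IHf].
  - induction Hg as [d i' j' k'|g g' _ IHg _ IHg'|g g' E _ IHg].
    + apply poly_ext with (fun u => (c * d) * mono (i + i') (j + j') (k + k') u); [|constructor].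
      intros [[x y] z]; unfold mono; rewrite !pow_add; ring.
    + apply poly_ext with (fun u => c * mono i j k u * g u + c * mono i j k u * g' u);
        [intros; ring | now apply poly_plus].
    + eapply poly_ext; [|exact IHg]. intros u; simpl; now rewrite E.
  - apply poly_ext with (fun u => f u * g u + f' u * g u); [intros; ring | now apply poly_plus].
  - eapply poly_ext; [|exact IHf]. intros u; simpl; now rewrite E.
Qed.

Lemma poly_const c : poly (fun _ => c).
Proof.
  apply poly_ext with (fun u => c * mono 0 0 0 u); [|constructor].
  intros [[x y] z]; unfold mono; simpl; ring.
Qed.

Lemma poly_dot w : poly (fun u => dot w u).
Proof.
  destruct w as [[a b] c].
  apply poly_ext with (fun u => (a * mono 1 0 0 u + b * mono 0 1 0 u) + c * mono 0 0 1 u).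
  - intros [[x y] z]; unfold mono, dot; simpl; ring.
  - apply poly_plus; [apply poly_plus|]; constructor.
Qed.

Lemma poly_scal k f : poly f -> poly (fun u => k * f u).
Proof. intros; apply (poly_mult (fun _ => k)); [apply poly_const | assumption]. Qed.

Lemma poly_minus f g : poly f -> poly g -> poly (fun u => f u - g u).
Proof.
  intros Hf Hg. apply poly_ext with (fun u => f u + -1 * g u); [intros; ring |].
  apply poly_plus; [assumption | now apply poly_scal].
Qed.

(** The classical iteration behind the Stone-Weierstrass theorem: polynomials in t, starting at 0,
    that increase to |t| on [-1, 1]. *)
Fixpoint abs_iter (n : nat) (t : R) : R :=
  match n with
  | O => 0
  | S n => abs_iter n t + / 2 * (t * t - abs_iter n t * abs_iter n t)
  end.

Lemma abs_iter_poly n f : poly f -> poly (fun u => abs_iter n (f u)).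
Proof.
  intros Hf. induction n as [|n IH]; simpl; [apply poly_const |].
  apply (poly_plus (fun u => abs_iter n (f u))); [assumption |].
  apply poly_scal, poly_minus; now apply poly_mult.
Qed.

(* The error [|t| - q] is multiplied by [1 - (|t| + q) / 2] at each step. *)
Lemma abs_iter_bound n t : Rabs t <= 1 ->
  0 <= abs_iter n t <= Rabs t /\ (Rabs t - abs_iter n t) * (1 + INR n * (Rabs t / 2)) <= Rabs t.
Proof.
  intros Ht. assert (H0 := Rabs_pos t).
  assert (Hs : t * t = Rabs t * Rabs t) by (rewrite <- Rabs_mult; symmetry; apply Rabs_pos_eq; nra).
  induction n as [|n [IH1 IH2]].
  - simpl. lra.
  - rewrite S_INR. simpl. rewrite Hs. set (q := abs_iter n t) in *. set (a := Rabs t) in *.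
    assert (E : a - (q + / 2 * (a * a - q * q)) = (a - q) * (1 - (a + q) / 2)) by field.
    split.
    + split; [nra|]. enough (0 <= (a - q) * (1 - (a + q) / 2)) by lra.
      apply Rmult_le_pos; lra.
    + rewrite E. set (N := INR n) in *. assert (HN : 0 <= N) by apply pos_INR.
      apply Rle_trans with ((a - q) * (1 + N * (a / 2))); [|assumption].
      rewrite Rmult_assoc. apply Rmult_le_compat_l; [lra|].
      assert (0 <= q * (1 + (N + 1) * (a / 2))) by (apply Rmult_le_pos; [lra | nra]).
      assert (0 <= N * (a * a)) by (apply Rmult_le_pos; nra).
      nra.
Qed.

(** The factor |t| cancels from both sides of [abs_iter_bound], which leaves an error uniform in
    t. *)
Lemma abs_iter_error n t : Rabs t <= 1 -> (0 < n)%nat ->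
  Rabs (Rabs t - abs_iter n t) <= 2 / INR n.
Proof.
  intros Ht Hn. destruct (abs_iter_bound n t Ht) as [H1 H2].
  assert (HN : 0 < INR n) by now apply lt_0_INR.
  assert (H0 := Rabs_pos t).
  rewrite Rabs_pos_eq by lra.
  apply Rmult_le_reg_r with (INR n); [assumption|].
  unfold Rdiv. rewrite Rmult_assoc, Rinv_l by lra.
  destruct (Req_dec (Rabs t) 0) as [E|E]; [rewrite E in *; nra|].
  assert (0 < Rabs t) by lra.
  apply Rmult_le_reg_r with (Rabs t / 2); [lra|]. nra.
Qed.

Lemma nice_bounded f : nice f -> exists B, 0 < B /\ forall u, dot u u = 1 -> Rabs (f u) <= B.
Proof.
  induction 1 as [c|w|f g _ [B1 [HB1 H1]] _ [B2 [HB2 H2]]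
    |f g _ [B1 [HB1 H1]] _ [B2 [HB2 H2]]|f _ [B1 [HB1 H1]]|f g E _ [B1 [HB1 H1]]].
  - exists (Rabs c + 1). split; [|intros; lra]. generalize (Rabs_pos c); lra.
  - exists (1 + dot w w). destruct w as [[a b] c]. unfold dot. split; [nra|].
    intros [[x y] z] Hu. apply Rabs_le.
    generalize (Rle_0_sqr (a - x)) (Rle_0_sqr (b - y)) (Rle_0_sqr (c - z))
      (Rle_0_sqr (a + x)) (Rle_0_sqr (b + y)) (Rle_0_sqr (c + z)); unfold Rsqr; nra.
  - exists (B1 + B2). split; [lra|]. intros u Hu.
    eapply Rle_trans; [apply Rabs_triang|]. apply Rplus_le_compat; auto.
  - exists (B1 * B2). split; [nra|]. intros u Hu.
    rewrite Rabs_mult. apply Rmult_le_compat; try apply Rabs_pos; auto.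
  - exists B1. split; [lra|]. intros u Hu. rewrite Rabs_Rabsolu; auto.
  - exists B1. split; [lra|]. intros u Hu. rewrite <- E; auto.
Qed.

(** A Stone-Weierstrass argument by induction on the construction of [f]; only products and absolute
    values need more than halving the tolerance. *)
Lemma nice_poly_approx f : nice f -> forall e, 0 < e ->
  exists p, poly p /\ forall u, dot u u = 1 -> Rabs (f u - p u) <= e.
Proof.
  induction 1 as [c|w|f g Hf IHf Hg IHg|f g Hf IHf Hg IHg|f Hf IHf|f g E _ IHf]; intros e He.
  - exists (fun _ => c); split; [apply poly_const|]. intros.
    rewrite Rminus_diag, Rabs_R0; lra.
  - exists (fun u => dot w u); split; [apply poly_dot|]. intros.
    rewrite Rminus_diag, Rabs_R0; lra.
  - destruct (IHf (e / 2)) as [p [Hp H1]]; [lra|]. destruct (IHg (e / 2)) as [q [Hq H2]]; [lra|].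
    exists (fun u => p u + q u); split; [now apply poly_plus|]. intros u Hu.
    replace (_ - _) with ((f u - p u) + (g u - q u)) by ring.
    eapply Rle_trans; [apply Rabs_triang|]. generalize (H1 u Hu) (H2 u Hu); lra.
  - destruct (nice_bounded g Hg) as [B [HB HgB]].
    destruct (IHf (e / (2 * B))) as [p [Hp H1]]; [apply Rdiv_lt_0_compat; lra|].
    (* The product error is split as (f - p) g + p (g - q), so the tolerance for [q] depends on a
       bound for the [p] already chosen. *)
    destruct (nice_bounded p (poly_nice p Hp)) as [B' [HB' HpB]].
    destruct (IHg (e / (2 * B'))) as [q [Hq H2]]; [apply Rdiv_lt_0_compat; lra|].
    exists (fun u => p u * q u); split; [now apply poly_mult|]. intros u Hu.
    replace (_ - _) with ((f u - p u) * g u + p u * (g u - q u)) by ring.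
    eapply Rle_trans; [apply Rabs_triang|]. rewrite !Rabs_mult.
    apply Rle_trans with (e / (2 * B) * B + B' * (e / (2 * B'))).
    + apply Rplus_le_compat; apply Rmult_le_compat; try apply Rabs_pos; auto.
    + right; field; split; lra.
  - destruct (IHf (e / 2)) as [p [Hp H1]]; [lra|].
    destruct (nice_bounded p (poly_nice p Hp)) as [B [HB HpB]].
    (* The iteration lives on [-1, 1], so [p] is divided by its bound [B]. More than 4 B / e steps
       bring the rescaled error 2 B / N below e / 2. *)
    destruct (nfloor_ex (B * (2 / (e / 2)))) as [n [_ Hn]].
    { apply Rmult_le_pos; [lra|]. apply Rlt_le, Rdiv_lt_0_compat; lra. }
    assert (HN : 0 < INR (S n)) by (apply lt_0_INR; lia).
    rewrite <- S_INR in Hn.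
    exists (fun u => B * abs_iter (S n) (/ B * p u)).
    split; [apply poly_scal, abs_iter_poly, poly_scal, Hp|]. intros u Hu.
    set (N := S n) in *.
    assert (HpB' : Rabs (/ B * p u) <= 1).
    { rewrite Rabs_mult, (Rabs_pos_eq (/ B)) by (left; now apply Rinv_0_lt_compat).
      apply Rmult_le_reg_l with B; [assumption|].
      rewrite <- Rmult_assoc, Rinv_r, Rmult_1_l, Rmult_1_r by lra. auto. }
    assert (E := abs_iter_error N _ HpB' ltac:(unfold N; lia)).
    replace (Rabs (f u) - _) with ((Rabs (f u) - Rabs (p u)) +
      B * (Rabs (/ B * p u) - abs_iter N (/ B * p u))).
    2:{ rewrite (Rabs_mult (/ B)), (Rabs_pos_eq (/ B)) by (left; now apply Rinv_0_lt_compat).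
        field; lra. }
    eapply Rle_trans; [apply Rabs_triang|].
    replace e with (e / 2 + e / 2) by lra. apply Rplus_le_compat.
    + eapply Rle_trans; [apply Rabs_triang_inv2 | auto].
    + rewrite Rabs_mult, (Rabs_pos_eq B) by lra.
      apply Rle_trans with (B * (2 / INR N)).
      { apply Rmult_le_compat_l; lra. }
      apply Rmult_le_reg_r with (INR N); [assumption|].
      unfold Rdiv. rewrite !Rmult_assoc, Rinv_l by lra.
      apply Rmult_le_reg_r with (2 / (e / 2)); [apply Rdiv_lt_0_compat; lra|].
      apply Rle_trans with (2 * (B * (2 / (e / 2)))); [right; field; lra|].
      apply Rle_trans with (2 * INR N); [lra|]. right; field; lra.
  - destruct (IHf e He) as [p [Hp H1]]. exists p; split; [assumption|].
    intros; rewrite <- E; auto.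
Qed.

(** * Moments of the monomials and their symmetry *)

Definition cs_int (a b : nat) : R := RInt (fun t => cos t ^ a * sin t ^ b) 0 (2 * PI).
Definition sc_int (a b : nat) : R := RInt (fun t => sin t ^ a * cos t ^ b) 0 PI.

Lemma cont_pow (f : R -> R) n x : continuous f x -> continuous (fun t => f t ^ n) x.
Proof.
  intros Hf; induction n as [|n IH]; simpl; [apply cont_const |].
  now apply (cont_mult f (fun t => f t ^ n)).
Qed.

Lemma cont_cs a b x : continuous (fun t => cos t ^ a * sin t ^ b) x.
Proof. apply (cont_mult (fun t => _ ^ _)); apply cont_pow; [apply cont_cos | apply cont_sin]. Qed.

Lemma cont_sc a b x : continuous (fun t => sin t ^ a * cos t ^ b) x.
Proof. apply (cont_mult (fun t => _ ^ _)); apply cont_pow; [apply cont_sin | apply cont_cos]. Qed.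

Lemma cs_int_sum a b : cs_int (S (S a)) b + cs_int a (S (S b)) = cs_int a b.
Proof.
  unfold cs_int. rewrite <- RInt_plusR by (apply cont_ex_RInt; intros; apply cont_cs).
  apply RInt_ext; intros t _. generalize (sin2_cos2 t); unfold Rsqr; intros H. simpl.
  transitivity ((cos t ^ a * sin t ^ b) * (sin t * sin t + cos t * cos t)); [ringR | rewrite H; ringR].
Qed.

Lemma sc_int_sum a b : sc_int (S (S a)) b + sc_int a (S (S b)) = sc_int a b.
Proof.
  unfold sc_int. rewrite <- RInt_plusR by (apply cont_ex_RInt; intros; apply cont_sc).
  apply RInt_ext; intros t _. generalize (sin2_cos2 t); unfold Rsqr; intros H. simpl.
  transitivity ((sin t ^ a * cos t ^ b) * (sin t * sin t + cos t * cos t)); [ringR | rewrite H; ringR].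
Qed.

Lemma is_derive_cs a b x : is_derive (fun t => cos t ^ S a * sin t ^ S b) x
  (INR (S b) * (cos x ^ S (S a) * sin x ^ b) - INR (S a) * (cos x ^ a * sin x ^ S (S b))).
Proof.
  auto_derive; [trivial|]. destruct a, b; simpl; ring.
Qed.

(** The product cos^(a+1) sin^(b+1) vanishes at both ends of the interval because of its sine
    factor, so its derivative integrates to zero. The same argument works on [0, pi]. *)
Lemma cs_int_parts a b : INR (S b) * cs_int (S (S a)) b = INR (S a) * cs_int a (S (S b)).
Proof.
  apply Rminus_diag_uniq. unfold cs_int.
  rewrite <- !RInt_scalR by (apply cont_ex_RInt; intros; apply cont_cs).
  rewrite <- RInt_minusR by (apply cont_ex_RInt; intros;
    apply (cont_mult (fun _ => _)); [apply cont_const | apply cont_cs]).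
  rewrite (RInt_derivR (fun t => cos t ^ S a * sin t ^ S b)).
  - rewrite sin_2PI, sin_0. simpl. ring.
  - intros; apply is_derive_cs.
  - intros. apply (cont_minus (fun _ => _)); apply (cont_mult (fun _ => _));
      solve [apply cont_const | apply cont_cs].
Qed.

Lemma sc_int_parts a b : INR (S b) * sc_int (S (S a)) b = INR (S a) * sc_int a (S (S b)).
Proof.
  apply Rminus_diag_uniq_sym. unfold sc_int.
  rewrite <- !RInt_scalR by (apply cont_ex_RInt; intros; apply cont_sc).
  rewrite <- RInt_minusR by (apply cont_ex_RInt; intros;
    apply (cont_mult (fun _ => _)); [apply cont_const | apply cont_sc]).
  rewrite (RInt_derivR (fun t => cos t ^ S b * sin t ^ S a)).
  - rewrite sin_PI, sin_0. simpl. ring.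
  - intros x _. replace (_ - _) with
     (INR (S a) * (cos x ^ S (S b) * sin x ^ a) - INR (S b) * (cos x ^ b * sin x ^ S (S a))) by ring.
    apply is_derive_cs.
  - intros. apply (cont_minus (fun _ => _)); apply (cont_mult (fun _ => _));
      solve [apply cont_const | apply cont_sc].
Qed.

Lemma is_derive_sin_pow n x :
  is_derive (fun t => / INR (S n) * sin t ^ S n) x (cos x * sin x ^ n).
Proof.
  auto_derive; [trivial|]. change (match n with 0%nat => 1 | S _ => INR n + 1 end) with (INR (S n)).
  field. apply not_0_INR; lia.
Qed.

Lemma cs_int_1 b : cs_int 1 b = 0.
Proof.
  unfold cs_int. rewrite (RInt_derivR (fun t => / INR (S b) * sin t ^ S b)).
  - rewrite sin_2PI, sin_0. simpl; ringR.
  - intros t _. rewrite pow_1. apply is_derive_sin_pow.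
  - intros; apply cont_cs.
Qed.

Lemma sc_int_1 a : sc_int a 1 = 0.
Proof.
  unfold sc_int. rewrite (RInt_derivR (fun t => / INR (S a) * sin t ^ S a)).
  - rewrite sin_PI, sin_0. simpl; ringR.
  - intros t _. rewrite pow_1. rewrite Rmult_comm; apply is_derive_sin_pow.
  - intros; apply cont_sc.
Qed.

(** A monomial separates in spherical coordinates; the extra 1 in the exponent is the area factor
    sin theta. *)
Lemma sint_mono i j k : sint (mono i j k) = cs_int i j * sc_int (i + j + 1) k.
Proof.
  unfold sint, cs_int. rewrite (Rmult_comm (RInt _ _ _)).
  rewrite <- RInt_scalR by (apply cont_ex_RInt; intros; apply cont_cs).
  apply RInt_ext; intros phi _. unfold meridian, sc_int. rewrite (Rmult_comm (RInt _ _ _)).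
  rewrite <- RInt_scalR by (apply cont_ex_RInt; intros; apply cont_sc).
  apply RInt_ext; intros th _. unfold mono, sph. rewrite !Rpow_mult_distr, !pow_add, pow_1. ringR.
Qed.

(** With p = i + j + 1, the longitude factor contributes the ratio (i + 1) / (p + 1) and the
    colatitude factor (p + 1) / (p + k + 2). The asymmetric p + 1 cancels. *)
Lemma sint_mono_x i j k : INR (i + j + k + 3) * sint (mono (S (S i)) j k) = INR (S i) * sint (mono i j k).
Proof.
  rewrite !sint_mono. replace (S (S i) + j + 1)%nat with (S (S (i + j + 1))) by lia.
  generalize (cs_int_sum i j) (cs_int_parts i j) (sc_int_sum (i + j + 1) k) (sc_int_parts (i + j + 1) k).
  set (p := (i + j + 1)%nat). intros H1 H2 H3 H4.
  replace (INR (i + j + k + 3)) with (INR (S p) + INR (S k))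
    by (unfold p; rewrite <- plus_INR; f_equal; lia).
  assert (E1 : INR (S p) * cs_int (S (S i)) j = INR (S i) * cs_int i j).
  { replace (INR (S p)) with (INR (S i) + INR (S j)) by (unfold p; rewrite <- plus_INR; f_equal; lia).
    rewrite Rmult_plus_distr_r, H2, <- H1. ring. }
  assert (E2 : (INR (S p) + INR (S k)) * sc_int (S (S p)) k = INR (S p) * sc_int p k).
  { rewrite Rmult_plus_distr_r, H4, <- H3. ring. }
  transitivity (cs_int (S (S i)) j * ((INR (S p) + INR (S k)) * sc_int (S (S p)) k)); [ring|].
  rewrite E2. transitivity (INR (S p) * cs_int (S (S i)) j * sc_int p k); [ring|].
  rewrite E1; ring.
Qed.

Lemma sint_mono_z i j k : INR (i + j + k + 3) * sint (mono i j (S (S k))) = INR (S k) * sint (mono i j k).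
Proof.
  rewrite !sint_mono.
  generalize (sc_int_sum (i + j + 1) k) (sc_int_parts (i + j + 1) k).
  set (p := (i + j + 1)%nat). intros H3 H4.
  replace (INR (i + j + k + 3)) with (INR (S p) + INR (S k))
    by (unfold p; rewrite <- plus_INR; f_equal; lia).
  assert (E2 : (INR (S p) + INR (S k)) * sc_int p (S (S k)) = INR (S k) * sc_int p k).
  { rewrite Rmult_plus_distr_r, <- H4, <- H3. ring. }
  transitivity (cs_int i j * ((INR (S p) + INR (S k)) * sc_int p (S (S k)))); [ring|].
  rewrite E2; ring.
Qed.

(* The moments obey recurrences symmetric in the exponents.  Together with the rotations about
   the z-axis, the exchange of x and z generates all the rotations needed. *)
Lemma sint_mono_swap n : forall i j k, (i + k <= n)%nat -> sint (mono i j k) = sint (mono k j i).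
Proof.
  induction n as [n IH] using (well_founded_induction Wf_nat.lt_wf). intros i j k Hn.
  (* The recurrences lower an exponent by two. When both exponents are 0 or 1, equal ones are
     trivial, and unequal ones give two vanishing moments. *)
  destruct i as [|[|i]].
  1,2: destruct k as [|[|k]].
  - reflexivity.
  - rewrite !sint_mono. rewrite cs_int_1, sc_int_1. ring.
  - apply Rmult_eq_reg_l with (INR (0 + j + k + 3)); [|apply not_0_INR; lia].
    rewrite sint_mono_z. replace (0 + j + k + 3)%nat with (k + j + 0 + 3)%nat by lia.
    rewrite sint_mono_x. f_equal. apply (IH k); lia.
  - rewrite !sint_mono. rewrite cs_int_1, sc_int_1. ring.
  - reflexivity.
  - apply Rmult_eq_reg_l with (INR (1 + j + k + 3)); [|apply not_0_INR; lia].
    rewrite sint_mono_z. replace (1 + j + k + 3)%nat with (k + j + 1 + 3)%nat by lia.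
    rewrite sint_mono_x. f_equal. apply (IH (1 + k)%nat); lia.
  - apply Rmult_eq_reg_l with (INR (i + j + k + 3)); [|apply not_0_INR; lia].
    rewrite sint_mono_x. replace (i + j + k + 3)%nat with (k + j + i + 3)%nat by lia.
    rewrite sint_mono_z. f_equal. apply (IH (i + k)%nat); lia.
Qed.

Lemma nice_xzswap f : nice f -> nice (fun u => f (xzswap u)).
Proof.
  apply nice_comp. intros [[a b] c]. exists (c, b, a).
  intros [[x y] z]; unfold dot, xzswap; ring.
Qed.

Lemma dot_xzswap u v : dot (xzswap u) (xzswap v) = dot u v.
Proof. destruct u as [[? ?] ?], v as [[? ?] ?]; unfold dot, xzswap; ring. Qed.

(** On monomials this is the symmetry of the moments. Since [sint] is continuous for the uniform
    norm on the sphere, it passes to the limit. *)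
Lemma sint_xzswap f : nice f -> sint (fun u => f (xzswap u)) = sint f.
Proof.
  assert (Hp : forall p, poly p -> sint (fun u => p (xzswap u)) = sint p).
  { induction 1 as [c i j k|f1 g1 Hf IHf Hg IHg|f1 g1 E Hf IHf].
    - rewrite (sint_ext _ (fun u => c * mono k j i u)).
      + rewrite !sint_scal by apply mono_nice. f_equal. now apply (sint_mono_swap (k + i)).
      + intros [[x y] z] _; unfold mono, xzswap; ring.
    - rewrite (sint_plus (fun u => f1 (xzswap u)) (fun u => g1 (xzswap u)))
        by now apply nice_xzswap, poly_nice.
      rewrite sint_plus by now apply poly_nice. now rewrite IHf, IHg.
    - rewrite <- (sint_ext f1 g1) by auto. rewrite <- IHf. apply sint_ext; intros; now rewrite E. }
  intros Hf. apply cond_eq. intros e He. generalize PI_RGT_0; intros HPI.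
  destruct (nice_poly_approx f Hf (e / (16 * PI))) as [p [Pp Hfp]]; [apply Rdiv_lt_0_compat; lra|].
  replace (_ - _) with ((sint (fun u => f (xzswap u)) - sint (fun u => p (xzswap u)))
     - (sint f - sint p)) by (rewrite (Hp p Pp); ring).
  eapply Rle_lt_trans; [apply Rabs_triang|]. rewrite Rabs_Ropp.
  apply Rle_lt_trans with (4 * PI * (e / (16 * PI)) + 4 * PI * (e / (16 * PI))).
  - apply Rplus_le_compat; apply sint_dist; auto using nice_xzswap, poly_nice.
    intros u Hu. apply Hfp. now rewrite dot_xzswap.
  - apply Rle_lt_trans with (e / 2); [right; field; lra | lra].
Qed.

(** * Orthogonal maps that preserve the integral *)

Lemma dot_zrot t u v : dot (zrot t u) (zrot t v) = dot u v.
Proof.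
  destruct u as [[x y] z], v as [[x' y'] z']; unfold dot, zrot.
  generalize (sin2_cos2 t); unfold Rsqr; intros H.
  transitivity ((sin t * sin t + cos t * cos t) * (x * x' + y * y') + z * z'); [ring|].
  rewrite H; ring.
Qed.

(** Orthogonality together with the invariance actually used; reflections such as [xzswap] are
    included. *)
Definition rotation (L : R3 -> R3) : Prop :=
  (forall u v, dot (L u) (L v) = dot u v) /\
  (forall f, nice f -> nice (fun u => f (L u)) /\ sint (fun u => f (L u)) = sint f).

Lemma rotation_zrot t : rotation (zrot t).
Proof.
  split; [apply dot_zrot|]. intros f Hf. split; [|now apply sint_zrot].
  revert f Hf. apply nice_comp. intros [[a b] c].
  exists (cos t * a + sin t * b, - sin t * a + cos t * b, c).
  intros [[x y] z]; unfold dot, zrot; ring.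
Qed.

Lemma rotation_xzswap : rotation xzswap.
Proof.
  split; [apply dot_xzswap|]. intros f Hf. split; [now apply nice_xzswap | now apply sint_xzswap].
Qed.

Lemma rotation_comp L M : rotation L -> rotation M -> rotation (fun u => L (M u)).
Proof.
  intros [H1 H2] [H3 H4]. split.
  - intros; now rewrite H1, H3.
  - intros f Hf. destruct (H2 f Hf) as [h1 h2]. destruct (H4 _ h1) as [h3 h4].
    split; [assumption | now rewrite h4].
Qed.

Lemma polar_coords x y : exists r t, 0 <= r /\ x = r * cos t /\ y = r * sin t /\ r * r = x * x + y * y.
Proof.
  assert (Hnn : 0 <= x * x + y * y) by nra.
  set (r := sqrt (x * x + y * y)).
  assert (Hr : r * r = x * x + y * y) by now apply sqrt_sqrt.
  assert (H0 : 0 <= r) by apply sqrt_pos.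
  destruct (Req_dec r 0) as [E|E].
  - exists 0, 0. rewrite E in Hr. rewrite cos_0, sin_0. split; [lra|]. split; [nra|]. split; [nra|]. lra.
  - assert (Hpos : 0 < r) by lra.
    set (c := x / r).
    assert (Hc : c * c + (y / r) * (y / r) = 1).
    { unfold c. replace (_ + _) with ((x * x + y * y) / (r * r)) by (field; lra).
      rewrite <- Hr; field; lra. }
    assert (Hc1 : -1 <= c <= 1) by (split; nra).
    assert (Hs : sin (acos c) * sin (acos c) = (y / r) * (y / r)).
    { generalize (sin2_cos2 (acos c)); unfold Rsqr; rewrite cos_acos by assumption; lra. }
    destruct (Rmult_integral (sin (acos c) - y / r) (sin (acos c) + y / r)) as [H|H]; [lra| |].
    + exists r, (acos c). rewrite cos_acos by assumption.
      split; [assumption|]. split; [unfold c; field; lra|]. split; [|assumption].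
      replace (sin (acos c)) with (y / r) by lra. field; lra.
    + exists r, (- acos c). rewrite cos_neg, sin_neg, cos_acos by assumption.
      split; [assumption|]. split; [unfold c; field; lra|]. split; [|assumption].
      replace (sin (acos c)) with (- (y / r)) by lra. field; lra.
Qed.

Lemma rotation_to_pole e : dot e e = 1 -> exists L, rotation L /\ L e = (0, 0, 1).
Proof.
  destruct e as [[x y] z]; intros He.
  destruct (polar_coords x y) as [r [t [Hr [Hx [Hy Hrr]]]]].
  destruct (polar_coords z r) as [r2 [t2 [Hr2 [Hz [Hr' Hrr2]]]]].
  assert (E2 : r2 = 1) by (unfold dot in He; nra).
  (* With longitude t and colatitude t2, the inner [zrot] brings e to (0, r, z). Conjugation by
     [xzswap] turns the outer one into a rotation about the x-axis, which carries this point to the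
     pole. *)
  exists (fun u => xzswap (zrot (- t2) (xzswap (zrot (PI / 2 - t) u)))). split.
  - apply (rotation_comp xzswap (fun u => zrot (- t2) (xzswap (zrot (PI / 2 - t) u))));
      [apply rotation_xzswap|].
    apply (rotation_comp (zrot (- t2)) (fun u => xzswap (zrot (PI / 2 - t) u)));
      [apply rotation_zrot|].
    apply (rotation_comp xzswap (zrot (PI / 2 - t))); [apply rotation_xzswap | apply rotation_zrot].
  - assert (H1 : zrot (PI / 2 - t) (x, y, z) = (0, r, z)).
    { unfold zrot. rewrite cos_shift, sin_shift, Hx, Hy.
      generalize (sin2_cos2 t); unfold Rsqr; intros H.
      apply vec_ext; [ring| |ring]. transitivity (r * (sin t * sin t + cos t * cos t)); [ring|].
      rewrite H; ring. }
    rewrite H1. unfold xzswap, zrot. rewrite cos_neg, sin_neg, Hz, Hr', E2.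
    generalize (sin2_cos2 t2); unfold Rsqr; intros H.
    apply vec_ext; [ring|ring|]. transitivity (sin t2 * sin t2 + cos t2 * cos t2); [ring | assumption].
Qed.

(** * Decomposition into cells *)

(** The support function of the tetrahedron with these vertices, as [support_conv4] confirms. *)
Definition hmax (x0 x1 x2 x3 u : R3) : R :=
  Rmax (Rmax (dot x0 u) (dot x1 u)) (Rmax (dot x2 u) (dot x3 u)).

Definition tent (t : R) : R := Rmax 0 (1 - Rabs t).
Definition clip (t : R) : R := Rmin 1 (Rmax 0 t).

(* A continuous approximation of the indicator function of the cell on which [a] is the largest
   of [a, b, c, d]; it is exact except where one of the [tents] is positive. *)
Definition weight (n a b c d : R) : R := clip (n * Rmin (a - b) (Rmin (a - c) (a - d))).
Definition tents (n a b c d : R) : R := tent (n * (a - b)) + tent (n * (a - c)) + tent (n * (a - d)).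

Lemma tent_pos t : 0 <= tent t.
Proof. apply Rmax_l. Qed.

Lemma tents_pos n a b c d : 0 <= tents n a b c d.
Proof.
  unfold tents. generalize (tent_pos (n * (a - b))) (tent_pos (n * (a - c))) (tent_pos (n * (a - d))).
  lra.
Qed.

Lemma clip_bound t : 0 <= clip t <= 1.
Proof. unfold clip, Rmin, Rmax. destruct (Rle_dec 0 t); destruct (Rle_dec 1 _); lra. Qed.

Lemma weight_zero n a b c d : 0 <= n -> a <= b \/ a <= c \/ a <= d -> weight n a b c d = 0.
Proof.
  intros Hn H. unfold weight.
  assert (Hm : Rmin (a - b) (Rmin (a - c) (a - d)) <= 0).
  { generalize (Rmin_l (a - b) (Rmin (a - c) (a - d))) (Rmin_r (a - b) (Rmin (a - c) (a - d)))
      (Rmin_l (a - c) (a - d)) (Rmin_r (a - c) (a - d)). lra. }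
  unfold clip. rewrite Rmax_left by nra. apply Rmin_right; lra.
Qed.

(** The minimum inside [weight] is one of the three differences, and for a nonnegative argument 1 -
    [clip] coincides with [tent]. *)
Lemma weight_one n a b c d : 0 <= n -> b <= a -> c <= a -> d <= a ->
  0 <= 1 - weight n a b c d <= tents n a b c d.
Proof.
  intros Hn Hb Hc Hd. unfold weight.
  set (m := Rmin (a - b) (Rmin (a - c) (a - d))).
  assert (Hm : m = a - b \/ m = a - c \/ m = a - d).
  { unfold m, Rmin. repeat destruct (Rle_dec _ _); tauto. }
  assert (H0 : 0 <= m) by lra.
  assert (Ht : 1 - clip (n * m) <= tent (n * m)).
  { assert (0 <= n * m) by nra. unfold clip, tent. rewrite Rabs_pos_eq, (Rmax_right 0 (n * m)) by assumption.
    unfold Rmin, Rmax. destruct (Rle_dec 1 (n * m)), (Rle_dec 0 (1 - n * m)); lra. }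
  split; [generalize (clip_bound (n * m)); lra|].
  eapply Rle_trans; [exact Ht|]. unfold tents.
  generalize (tent_pos (n * (a - b))) (tent_pos (n * (a - c))) (tent_pos (n * (a - d))).
  destruct Hm as [->|[->| ->]]; lra.
Qed.

(** Where a_i is the largest, the other three weights vanish, even at ties. The whole error is then
    (a_i - lam) times the defect of one weight, and 2 bounds |a_i - lam|. *)
Lemma partition_error n lam a0 a1 a2 a3 : 0 <= n ->
  -1 <= lam <= 1 -> -1 <= a0 <= 1 -> -1 <= a1 <= 1 -> -1 <= a2 <= 1 -> -1 <= a3 <= 1 ->
  Rabs (Rmax (Rmax a0 a1) (Rmax a2 a3) - lam -
    ((a0 - lam) * weight n a0 a1 a2 a3 + (a1 - lam) * weight n a1 a0 a2 a3 +
     (a2 - lam) * weight n a2 a0 a1 a3 + (a3 - lam) * weight n a3 a0 a1 a2)) <=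
  2 * (tents n a0 a1 a2 a3 + tents n a1 a0 a2 a3 + tents n a2 a0 a1 a3 + tents n a3 a0 a1 a2).
Proof.
  intros Hn Hl H0 H1 H2 H3.
  generalize (tents_pos n a0 a1 a2 a3) (tents_pos n a1 a0 a2 a3) (tents_pos n a2 a0 a1 a3)
    (tents_pos n a3 a0 a1 a2). intros T0 T1 T2 T3.
  assert (K : forall a w t, -1 <= a <= 1 -> 0 <= 1 - w <= t -> Rabs ((a - lam) * (1 - w)) <= 2 * t).
  { intros a w t Ha Hw. rewrite Rabs_mult. apply Rmult_le_compat; try apply Rabs_pos.
    - apply Rabs_le; lra.
    - rewrite Rabs_pos_eq; lra. }
  destruct (Rle_dec a0 a1), (Rle_dec a2 a3).
  - rewrite (Rmax_right a0 a1), (Rmax_right a2 a3) by lra.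
    destruct (Rle_dec a1 a3).
    + rewrite Rmax_right by lra.
      rewrite (weight_zero n a0), (weight_zero n a1), (weight_zero n a2) by lra.
      replace (_ - _) with ((a3 - lam) * (1 - weight n a3 a0 a1 a2)) by ring.
      eapply Rle_trans; [apply K; [assumption | apply weight_one; lra] | lra].
    + rewrite Rmax_left by lra.
      rewrite (weight_zero n a0), (weight_zero n a3), (weight_zero n a2) by lra.
      replace (_ - _) with ((a1 - lam) * (1 - weight n a1 a0 a2 a3)) by ring.
      eapply Rle_trans; [apply K; [assumption | apply weight_one; lra] | lra].
  - rewrite (Rmax_right a0 a1), (Rmax_left a2 a3) by lra.
    destruct (Rle_dec a1 a2).
    + rewrite Rmax_right by lra.
      rewrite (weight_zero n a0), (weight_zero n a1), (weight_zero n a3) by lra.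
      replace (_ - _) with ((a2 - lam) * (1 - weight n a2 a0 a1 a3)) by ring.
      eapply Rle_trans; [apply K; [assumption | apply weight_one; lra] | lra].
    + rewrite Rmax_left by lra.
      rewrite (weight_zero n a0), (weight_zero n a3), (weight_zero n a2) by lra.
      replace (_ - _) with ((a1 - lam) * (1 - weight n a1 a0 a2 a3)) by ring.
      eapply Rle_trans; [apply K; [assumption | apply weight_one; lra] | lra].
  - rewrite (Rmax_left a0 a1), (Rmax_right a2 a3) by lra.
    destruct (Rle_dec a0 a3).
    + rewrite Rmax_right by lra.
      rewrite (weight_zero n a0), (weight_zero n a1), (weight_zero n a2) by lra.
      replace (_ - _) with ((a3 - lam) * (1 - weight n a3 a0 a1 a2)) by ring.
      eapply Rle_trans; [apply K; [assumption | apply weight_one; lra] | lra].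
    + rewrite Rmax_left by lra.
      rewrite (weight_zero n a1), (weight_zero n a3), (weight_zero n a2) by lra.
      replace (_ - _) with ((a0 - lam) * (1 - weight n a0 a1 a2 a3)) by ring.
      eapply Rle_trans; [apply K; [assumption | apply weight_one; lra] | lra].
  - rewrite (Rmax_left a0 a1), (Rmax_left a2 a3) by lra.
    destruct (Rle_dec a0 a2).
    + rewrite Rmax_right by lra.
      rewrite (weight_zero n a0), (weight_zero n a1), (weight_zero n a3) by lra.
      replace (_ - _) with ((a2 - lam) * (1 - weight n a2 a0 a1 a3)) by ring.
      eapply Rle_trans; [apply K; [assumption | apply weight_one; lra] | lra].
    + rewrite Rmax_left by lra.
      rewrite (weight_zero n a1), (weight_zero n a3), (weight_zero n a2) by lra.
      replace (_ - _) with ((a0 - lam) * (1 - weight n a0 a1 a2 a3)) by ring.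
      eapply Rle_trans; [apply K; [assumption | apply weight_one; lra] | lra].
Qed.

Definition cellf (n lam : R) (e x y z u : R3) : R :=
  (dot e u - lam) * weight n (dot e u) (dot x u) (dot y u) (dot z u).
Definition tentf (n : R) (e x y z u : R3) : R := tents n (dot e u) (dot x u) (dot y u) (dot z u).

Lemma nice_tent1 n e x : nice (fun u => tent (n * (dot e u - dot x u))).
Proof.
  unfold tent. apply nice_max; [constructor|].
  apply nice_minus; [constructor|].
  apply (nice_abs (fun u => n * (dot e u - dot x u))), nice_scal, nice_minus; constructor.
Qed.

Lemma nice_tentf n e x y z : nice (tentf n e x y z).
Proof.
  unfold tentf, tents. apply nice_plus; [apply nice_plus|]; apply nice_tent1.
Qed.

Lemma nice_cellf n lam e x y z : nice (cellf n lam e x y z).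
Proof.
  unfold cellf, weight, clip. apply nice_mult.
  - apply nice_minus; constructor.
  - apply nice_min; [constructor|]. apply nice_max; [constructor|].
    apply nice_scal, nice_min; [apply nice_minus; constructor|].
    apply nice_min; apply nice_minus; constructor.
Qed.

Lemma nice_hmax x0 x1 x2 x3 : nice (hmax x0 x1 x2 x3).
Proof. unfold hmax. repeat apply nice_max; constructor. Qed.

(* In polar coordinates about the pole the condition [dot x u <= dot (0, 0, 1) u] reads
   [slope x phi <= cot theta]. *)
Definition slope (x : R3) (phi : R) : R :=
  let '(x1, x2, x3) := x in (x1 * cos phi + x2 * sin phi) / (1 - x3).

Definition height (x : R3) : R := let '(_, _, x3) := x in x3.

(* The cosine of the angle whose cotangent is [m]. *)
Definition ccot (m : R) : R := sin (atan m).

(* The integral of [(cos t - lam) * sin t] over [0 <= t <= r], where [c = cos r]. *)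
Definition capint (lam c : R) : R := / 2 * (1 - c * c) - lam * (1 - c).

Lemma cont_slope x phi : continuous (slope x) phi.
Proof. destruct x as [[x1 x2] x3]. unfold slope, Rdiv. cont. Qed.

Lemma cont_ccot m : continuous ccot m.
Proof.
  apply (cont_comp atan sin); [|apply cont_sin].
  apply (ex_derive_continuous atan). eexists; apply is_derive_atan.
Qed.

Lemma cont_capint lam c : continuous (capint lam) c.
Proof. unfold capint. cont. Qed.

Definition slope3 (x y z : R3) (phi : R) : R := Rmax (slope x phi) (Rmax (slope y phi) (slope z phi)).

Lemma cont_slope3 x y z phi : continuous (slope3 x y z) phi.
Proof.
  unfold slope3. apply (cont_max (slope x) (fun t => Rmax (slope y t) (slope z t)));
    [|apply (cont_max (slope y) (slope z))]; apply cont_slope.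
Qed.

Lemma cont_capint_slope lam x y z phi :
  continuous (fun phi => capint lam (ccot (slope3 x y z phi))) phi.
Proof.
  apply (cont_comp (fun phi => ccot (slope3 x y z phi)) (capint lam)); [|apply cont_capint].
  apply (cont_comp (slope3 x y z) ccot); [apply cont_slope3 | apply cont_ccot].
Qed.

Lemma dot_pole_sph theta phi : dot (0, 0, 1) (sph theta phi) = cos theta.
Proof. unfold dot, sph; ring. Qed.

Lemma dot_slope x theta phi : height x < 1 ->
  cos theta - dot x (sph theta phi) = (1 - height x) * (cos theta - slope x phi * sin theta).
Proof.
  destruct x as [[x1 x2] x3]; unfold dot, sph, slope, height; intros. field. lra.
Qed.

(** A meridian meets the cell of the pole in [0, r], where cot r is the largest of the three slopes.
    Up to r the weight is 1 minus a defect controlled by the tents; beyond r it is zero. *)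
Lemma meridian_cell n lam x y z phi : 0 <= n -> -1 <= lam <= 1 ->
  height x < 1 -> height y < 1 -> height z < 1 ->
  Rabs (meridian (cellf n lam (0, 0, 1) x y z) phi - capint lam (ccot (slope3 x y z phi)))
    <= 2 * meridian (tentf n (0, 0, 1) x y z) phi.
Proof.
  intros Hn Hl Hx Hy Hz. set (m := slope3 x y z phi). set (r := PI / 2 - atan m).
  assert (Hr : 0 < r < PI) by (unfold r; generalize (atan_bound m); lra).
  assert (Hcr : cos r = ccot m) by (unfold r, ccot; apply cos_shift).
  assert (Hsr : 0 < sin r) by (apply sin_gt_0; lra).
  assert (Hm : cos r = m * sin r).
  { assert (E : tan (atan m) = m) by apply tan_atan. unfold r. rewrite cos_shift, sin_shift.
    assert (0 < cos (atan m)) by (apply cos_gt_0; generalize (atan_bound m); lra).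
    rewrite <- E at 2. unfold tan. field. lra. }
  (* This turns the sign of cos t - m sin t into the position of t relative to r. *)
  assert (Hsign : forall t, sin r * (cos t - m * sin t) = sin (r - t)).
  { intros t. rewrite sin_minus, Hm. ring. }
  set (F := fun t => cellf n lam (0, 0, 1) x y z (sph t phi) * sin t).
  set (T := fun t => tentf n (0, 0, 1) x y z (sph t phi) * sin t).
  assert (exF : forall a b, ex_RInt F a b) by (intros; apply nice_ex_meridian, nice_cellf).
  assert (exT : forall a b, ex_RInt T a b) by (intros; apply nice_ex_meridian, nice_tentf).
  assert (HT : forall t, 0 < t < PI -> 0 <= T t).
  { intros t Ht. apply Rmult_le_pos; [apply tents_pos | left; apply sin_gt_0; lra]. }
  assert (Hmax : forall w, slope w phi <= m -> height w < 1 -> forall t, 0 < t < r ->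
     dot w (sph t phi) <= cos t).
  { intros w Hw Hw1 t Ht. generalize (dot_slope w t phi Hw1).
    assert (0 < sin (r - t)) by (apply sin_gt_0; lra). assert (0 < sin t) by (apply sin_gt_0; lra).
    assert (0 < cos t - m * sin t) by (generalize (Hsign t); nra).
    assert (slope w phi * sin t <= m * sin t) by nra.
    assert (0 <= (1 - height w) * (cos t - slope w phi * sin t)) by (apply Rmult_le_pos; lra). lra. }
  assert (Hmin : forall w, slope w phi = m -> height w < 1 -> forall t, r < t < PI ->
     cos t <= dot w (sph t phi)).
  { intros w Hw Hw1 t Ht. generalize (dot_slope w t phi Hw1). rewrite Hw.
    assert (sin (r - t) < 0) by (apply sin_lt_0_var; lra).
    assert (cos t - m * sin t < 0) by (generalize (Hsign t); nra). nra. }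
  assert (Hle : slope x phi <= m /\ slope y phi <= m /\ slope z phi <= m).
  { unfold m, slope3. generalize (Rmax_l (slope x phi) (Rmax (slope y phi) (slope z phi)))
      (Rmax_r (slope x phi) (Rmax (slope y phi) (slope z phi)))
      (Rmax_l (slope y phi) (slope z phi)) (Rmax_r (slope y phi) (slope z phi)). lra. }
  assert (Heq : slope x phi = m \/ slope y phi = m \/ slope z phi = m).
  { unfold m, slope3, Rmax. repeat destruct (Rle_dec _ _); tauto. }
  assert (Ec : RInt (fun t => (cos t - lam) * sin t) 0 r = capint lam (ccot m)).
  { rewrite (RInt_derivR (fun t => - / 2 * (cos t * cos t) + lam * cos t)).
    - rewrite <- Hcr, cos_0. unfold capint. ringR.
    - intros; auto_derive; [trivial|field].
    - intros; cont. }
  assert (exc : ex_RInt (fun t => (cos t - lam) * sin t) 0 r)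
    by (apply cont_ex_RInt; intros; cont).
  assert (H1 : Rabs (RInt F 0 r - capint lam (ccot m)) <= 2 * RInt T 0 r).
  { rewrite <- Ec, <- RInt_minusR, <- RInt_scalR by auto.
    eapply Rle_trans; [apply abs_RInt_le; [lra|] | apply RInt_le; [lra| | |]].
    - now apply (ex_RInt_minus (V:=R_NormedModule)).
    - apply cont_ex_RInt; intros t. apply (cont_abs (fun t => F t - (cos t - lam) * sin t)).
      apply (cont_minus F); [|cont].
      apply (cont_mult (fun t => _) sin); [apply nice_cont, nice_cellf | cont].
    - now apply (ex_RInt_scal (V:=R_NormedModule)).
    - intros t Ht. unfold F, T, cellf, tentf. rewrite dot_pole_sph.
      assert (Hs : 0 <= sin t) by (left; apply sin_gt_0; lra).
      destruct (weight_one n (cos t) (dot x (sph t phi)) (dot y (sph t phi)) (dot z (sph t phi)) Hn)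
        as [W1 W2]; try (apply Hmax; tauto).
      set (w := weight _ _ _ _ _) in *. set (s := tents _ _ _ _ _) in *.
      replace (_ - _) with (- ((cos t - lam) * (1 - w) * sin t)) by ring.
      rewrite Rabs_Ropp, !Rabs_mult, (Rabs_pos_eq (sin t)), <- Rmult_assoc by assumption.
      apply Rmult_le_compat_r; [assumption|].
      apply Rmult_le_compat; try apply Rabs_pos.
      + generalize (COS_bound t); intros; apply Rabs_le; lra.
      + rewrite Rabs_pos_eq; lra. }
  (* Beyond r the vertex that attains the maximal slope dominates the pole, which kills the
     weight. *)
  assert (H2 : RInt F r PI = 0).
  { rewrite (RInt_ext _ (fun _ => 0)); [rewrite RInt_constR; ringR|].
    intros t. rewrite Rmin_left, Rmax_right by lra. intros Ht. unfold F, cellf.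
    rewrite dot_pole_sph, weight_zero; [ringR | assumption |].
    destruct Heq as [E|[E|E]]; [left|right; left|right; right]; apply Hmin; tauto. }
  assert (H3 : 0 <= RInt T r PI).
  { apply RInt_ge_0; [lra | auto | intros; apply HT; lra]. }
  change (meridian _ phi) with (RInt F 0 PI) at 1. change (meridian _ phi) with (RInt T 0 PI).
  rewrite <- (RInt_ChaslesR F 0 r PI), <- (RInt_ChaslesR T 0 r PI), H2, Rplus_0_r by auto. lra.
Qed.

(** For heights below 1, the integral of u.e - lam over the cell of the pole e against the vertices
    x, y, z, with the radial integration already carried out. *)
Definition cell_int (lam : R) (x y z : R3) : R :=
  RInt (fun phi => capint lam (ccot (slope3 x y z phi))) 0 (2 * PI).

Lemma sint_cell n lam x y z : 0 <= n -> -1 <= lam <= 1 ->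
  height x < 1 -> height y < 1 -> height z < 1 ->
  Rabs (sint (cellf n lam (0, 0, 1) x y z) - cell_int lam x y z)
    <= 2 * sint (tentf n (0, 0, 1) x y z).
Proof.
  intros Hn Hl Hx Hy Hz. unfold sint, cell_int. generalize PI_RGT_0; intros HPI.
  assert (ex1 : ex_RInt (meridian (cellf n lam (0, 0, 1) x y z)) 0 (2 * PI))
    by apply nice_ex_sint, nice_cellf.
  assert (ex2 : ex_RInt (fun phi => capint lam (ccot (slope3 x y z phi))) 0 (2 * PI))
    by (apply cont_ex_RInt; intros; apply cont_capint_slope).
  rewrite <- RInt_minusR, <- RInt_scalR by (auto; apply nice_ex_sint, nice_tentf).
  eapply Rle_trans; [apply abs_RInt_le; [lra|] | apply RInt_le; [lra| | |]].
  - now apply (ex_RInt_minus (V:=R_NormedModule)).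
  - apply cont_ex_RInt; intros phi. apply (cont_abs (fun phi => meridian _ phi - _)).
    apply (cont_minus (meridian _)); [apply nice_meridian_cont, nice_cellf | apply cont_capint_slope].
  - apply (ex_RInt_scal (V:=R_NormedModule)), nice_ex_sint, nice_tentf.
  - intros phi _. now apply meridian_cell.
Qed.

(** This majorant has an explicit primitive after the substitution t = N cos theta: an arctangent,
    bounded by pi / 2, which gives the O(1 / N) decay below. *)
Lemma tent_le t : tent t <= / (1 + t * t).
Proof.
  assert (0 < / (1 + t * t)) by (apply Rinv_0_lt_compat; nra).
  unfold tent. apply Rmax_lub; [lra|].
  assert (H0 := Rabs_pos t).
  assert (Hs : t * t = Rabs t * Rabs t) by (rewrite <- Rabs_mult; symmetry; apply Rabs_pos_eq; nra).
  apply Rmult_le_reg_r with (1 + t * t); [nra|].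
  rewrite Rinv_l by nra. rewrite Hs.
  replace ((1 - Rabs t) * (1 + Rabs t * Rabs t)) with
    (1 - Rabs t * ((Rabs t - / 2) * (Rabs t - / 2) + 3 / 4)) by field.
  assert (0 <= Rabs t * ((Rabs t - / 2) * (Rabs t - / 2) + 3 / 4)) by (apply Rmult_le_pos; nra).
  lra.
Qed.

Lemma sint_tent_pole N : 0 < N -> sint (fun u => tent (N * dot (0, 0, 1) u)) <= 2 * PI * (PI / N).
Proof.
  intros HN. generalize PI_RGT_0; intros HPI.
  assert (Hnice : nice (fun u => tent (N * dot (0, 0, 1) u))).
  { unfold tent. apply nice_max; [constructor|]. apply nice_minus; [constructor|].
    apply (nice_abs (fun u => N * dot (0, 0, 1) u)), nice_scal; constructor. }
  assert (Hden : forall t, 0 < 1 + (N * cos t) * (N * cos t)).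
  { intros t. generalize (Rle_0_sqr (N * cos t)); unfold Rsqr; lra. }
  assert (Hc : forall t, continuous (fun t => / (1 + (N * cos t) * (N * cos t)) * sin t) t).
  { intros t. apply (ex_derive_continuous (fun t => / (1 + (N * cos t) * (N * cos t)) * sin t)).
    auto_derive. generalize (Hden t); lra. }
  assert (E : forall phi, meridian (fun u => tent (N * dot (0, 0, 1) u)) phi <= PI / N).
  { intros phi. apply Rle_trans with (RInt (fun t => / (1 + (N * cos t) * (N * cos t)) * sin t) 0 PI).
    - apply RInt_le; [lra | exact (nice_ex_meridian _ phi 0 PI Hnice) | now apply cont_ex_RInt |].
      intros t Ht. rewrite dot_pole_sph. apply Rmult_le_compat_r; [left; apply sin_gt_0; lra|].
      apply tent_le.
    - rewrite (RInt_derivR (fun t => - / N * atan (N * cos t))).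
      + rewrite cos_PI, cos_0. replace (N * -1) with (- N) by ring. rewrite atan_opp, Rmult_1_r.
        generalize (atan_bound N); intros.
        apply Rle_trans with (/ N * (2 * atan N)); [right; ring|].
        unfold Rdiv. rewrite Rmult_comm. apply Rmult_le_compat_r; [left; now apply Rinv_0_lt_compat | lra].
      + intros t _. replace (_ * sin t) with (- / N * (N * - sin t * / (1 + Rsqr (N * cos t))))
          by (unfold Rsqr; field; split; [generalize (Hden t)|]; lra).
        apply (is_derive_scal (fun t => atan (N * cos t))).
        apply (is_derive_comp atan (fun t => N * cos t)); [apply is_derive_atan|].
        auto_derive; [trivial | ring].
      + intros; apply Hc. }
  unfold sint. apply Rle_trans with (RInt (fun _ => PI / N) 0 (2 * PI)).
  - apply RInt_le; [lra | now apply nice_ex_sint | apply cont_ex_RInt; intros; apply cont_const |].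
    intros; apply E.
  - rewrite RInt_constR. right; ring.
Qed.

Lemma dot_vsub e x u : dot e u - dot x u = dot (vsub e x) u.
Proof.
  destruct e as [[? ?] ?], x as [[? ?] ?], u as [[? ?] ?].
  unfold vsub, vadd, vscale, dot. ring.
Qed.

Lemma dot_vscale a x u : dot (vscale a x) u = a * dot x u.
Proof. destruct x as [[? ?] ?], u as [[? ?] ?]. unfold vscale, dot. ring. Qed.

Lemma dot_comm x u : dot x u = dot u x.
Proof. destruct x as [[? ?] ?], u as [[? ?] ?]. unfold dot. ring. Qed.

(** The tent depends only on the component of u along e - x, which is nonzero. Rotating this
    direction to the pole reduces to the previous estimate with N = n |e - x|. *)
Lemma sint_tent e x : dot e e = 1 -> dot x x = 1 -> dot e x < 1 ->
  exists C, forall n, 0 < n -> sint (fun u => tent (n * (dot e u - dot x u))) <= C / n.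
Proof.
  intros He Hx Hd.
  assert (Hw : dot (vsub e x) (vsub e x) = 2 - 2 * dot e x).
  { rewrite <- dot_vsub, (dot_comm e), (dot_comm x), <- !dot_vsub, (dot_comm x e); lra. }
  set (w := vsub e x) in *. set (s := sqrt (dot w w)).
  assert (Hs : s * s = dot w w) by (apply sqrt_sqrt; lra).
  assert (Hs0 : 0 < s) by (apply sqrt_lt_R0; lra).
  destruct (rotation_to_pole (vscale (/ s) w)) as [L [[HL1 HL2] HL3]].
  { rewrite dot_vscale, dot_comm, dot_vscale, <- Hs. field. lra. }
  exists (2 * PI * PI / s). intros n Hn.
  set (g := fun u => tent (n * s * dot (0, 0, 1) u)).
  assert (Hg : nice g).
  { unfold g, tent. apply nice_max; [constructor|]. apply nice_minus; [constructor|].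
    apply (nice_abs (fun u => n * s * dot (0, 0, 1) u)), nice_scal; constructor. }
  rewrite (sint_ext _ (fun u => g (L u))).
  - rewrite (proj2 (HL2 g Hg)). eapply Rle_trans; [apply sint_tent_pole; now apply Rmult_lt_0_compat|].
    right; field; lra.
  - intros u _. unfold g. rewrite <- HL3, HL1, dot_vscale, dot_vsub. f_equal. unfold w. field. lra.
Qed.

Lemma sint_tentf e x y z : dot e e = 1 -> dot x x = 1 -> dot y y = 1 -> dot z z = 1 ->
  dot e x < 1 -> dot e y < 1 -> dot e z < 1 ->
  exists C, forall n, 0 < n -> sint (tentf n e x y z) <= C / n.
Proof.
  intros He Hx Hy Hz Hex Hey Hez.
  destruct (sint_tent e x) as [C1 H1], (sint_tent e y) as [C2 H2], (sint_tent e z) as [C3 H3]; auto.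
  exists (C1 + C2 + C3). intros n Hn. unfold tentf, tents.
  assert (N1 := nice_tent1 n e x). assert (N2 := nice_tent1 n e y). assert (N3 := nice_tent1 n e z).
  rewrite (sint_plus (fun u => tent (n * (dot e u - dot x u)) + tent (n * (dot e u - dot y u)))
     (fun u => tent (n * (dot e u - dot z u)))), (sint_plus (fun u => tent (n * (dot e u - dot x u))))
    by auto using nice_plus.
  generalize (H1 n Hn) (H2 n Hn) (H3 n Hn). unfold Rdiv. lra.
Qed.

Lemma height_rotation L e x : rotation L -> L e = (0, 0, 1) -> height (L x) = dot e x.
Proof.
  intros [HL _] He. rewrite <- HL, He. destruct (L x) as [[? ?] ?]. unfold height, dot. ring.
Qed.

Lemma sint_cell_general lam e x y z L : -1 <= lam <= 1 -> rotation L -> L e = (0, 0, 1) ->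
  dot e x < 1 -> dot e y < 1 -> dot e z < 1 ->
  forall n, 0 < n ->
  Rabs (sint (cellf n lam e x y z) - cell_int lam (L x) (L y) (L z)) <= 2 * sint (tentf n e x y z).
Proof.
  intros Hl HL He Hex Hey Hez n Hn.
  rewrite (sint_ext (cellf n lam e x y z) (fun u => cellf n lam (L e) (L x) (L y) (L z) (L u)))
    by (intros; unfold cellf; now rewrite !(proj1 HL)).
  rewrite (sint_ext (tentf n e x y z) (fun u => tentf n (L e) (L x) (L y) (L z) (L u)))
    by (intros; unfold tentf; now rewrite !(proj1 HL)).
  rewrite (proj2 (proj2 HL _ (nice_cellf _ _ _ _ _ _))), (proj2 (proj2 HL _ (nice_tentf _ _ _ _ _))).
  rewrite He. apply sint_cell; try rewrite (height_rotation L e); auto; lra.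
Qed.

Lemma dot_unit_bound x u : dot x x = 1 -> dot u u = 1 -> -1 <= dot x u <= 1.
Proof.
  destruct x as [[a b] c], u as [[a' b'] c']; unfold dot; intros H1 H2.
  generalize (Rle_0_sqr (a - a')) (Rle_0_sqr (b - b')) (Rle_0_sqr (c - c'))
    (Rle_0_sqr (a + a')) (Rle_0_sqr (b + b')) (Rle_0_sqr (c + c')); unfold Rsqr; lra.
Qed.

Lemma nice_sum4 f g h k : nice f -> nice g -> nice h -> nice k ->
  nice (fun u => f u + g u + h u + k u).
Proof.
  intros. apply (nice_plus (fun u => f u + g u + h u)); [|assumption].
  apply (nice_plus (fun u => f u + g u)); [now apply nice_plus | assumption].
Qed.

Lemma sint_sum4 f g h k : nice f -> nice g -> nice h -> nice k ->
  sint (fun u => f u + g u + h u + k u) = sint f + sint g + sint h + sint k.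
Proof.
  intros Hf Hg Hh Hk.
  assert (H1 : nice (fun u => f u + g u)) by now apply nice_plus.
  assert (H2 : nice (fun u => f u + g u + h u)) by now apply (nice_plus (fun u => f u + g u)).
  now rewrite (sint_plus (fun u => f u + g u + h u)), (sint_plus (fun u => f u + g u)), (sint_plus f).
Qed.

(** Neither side involves n, while the error of the approximation by weights is O(1 / n); hence
    equality. *)
Lemma cell_formula lam x0 x1 x2 x3 : -1 <= lam <= 1 ->
  dot x0 x0 = 1 -> dot x1 x1 = 1 -> dot x2 x2 = 1 -> dot x3 x3 = 1 ->
  dot x0 x1 < 1 -> dot x0 x2 < 1 -> dot x0 x3 < 1 -> dot x1 x2 < 1 -> dot x1 x3 < 1 -> dot x2 x3 < 1 ->
  forall L0 L1 L2 L3, rotation L0 -> rotation L1 -> rotation L2 -> rotation L3 ->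
  L0 x0 = (0, 0, 1) -> L1 x1 = (0, 0, 1) -> L2 x2 = (0, 0, 1) -> L3 x3 = (0, 0, 1) ->
  sint (hmax x0 x1 x2 x3) = 4 * PI * lam +
    (cell_int lam (L0 x1) (L0 x2) (L0 x3) + cell_int lam (L1 x0) (L1 x2) (L1 x3) +
     cell_int lam (L2 x0) (L2 x1) (L2 x3) + cell_int lam (L3 x0) (L3 x1) (L3 x2)).
Proof.
  intros Hl U0 U1 U2 U3 D01 D02 D03 D12 D13 D23 L0 L1 L2 L3 R0 R1 R2 R3 P0 P1 P2 P3.
  assert (D10 : dot x1 x0 < 1) by (now rewrite dot_comm).
  assert (D20 : dot x2 x0 < 1) by (now rewrite dot_comm).
  assert (D30 : dot x3 x0 < 1) by (now rewrite dot_comm).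
  assert (D21 : dot x2 x1 < 1) by (now rewrite dot_comm).
  assert (D31 : dot x3 x1 < 1) by (now rewrite dot_comm).
  assert (D32 : dot x3 x2 < 1) by (now rewrite dot_comm).
  destruct (sint_tentf x0 x1 x2 x3) as [C0 T0]; auto.
  destruct (sint_tentf x1 x0 x2 x3) as [C1 T1]; auto.
  destruct (sint_tentf x2 x0 x1 x3) as [C2 T2]; auto.
  destruct (sint_tentf x3 x0 x1 x2) as [C3 T3]; auto.
  set (C := Rabs (4 * (C0 + C1 + C2 + C3))).
  apply cond_eq. intros e He.
  set (n := (C + 1) / e).
  assert (HC : 0 <= C) by apply Rabs_pos.
  assert (Hn : 0 < n) by (apply Rdiv_lt_0_compat; lra).
  assert (E0 := sint_cell_general lam x0 x1 x2 x3 L0 Hl R0 P0 D01 D02 D03 n Hn).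
  assert (E1 := sint_cell_general lam x1 x0 x2 x3 L1 Hl R1 P1 D10 D12 D13 n Hn).
  assert (E2 := sint_cell_general lam x2 x0 x1 x3 L2 Hl R2 P2 D20 D21 D23 n Hn).
  assert (E3 := sint_cell_general lam x3 x0 x1 x2 L3 Hl R3 P3 D30 D31 D32 n Hn).
  specialize (T0 n Hn). specialize (T1 n Hn). specialize (T2 n Hn). specialize (T3 n Hn).
  set (c0 := cellf n lam x0 x1 x2 x3) in *. set (c1 := cellf n lam x1 x0 x2 x3) in *.
  set (c2 := cellf n lam x2 x0 x1 x3) in *. set (c3 := cellf n lam x3 x0 x1 x2) in *.
  set (t0 := tentf n x0 x1 x2 x3) in *. set (t1 := tentf n x1 x0 x2 x3) in *.
  set (t2 := tentf n x2 x0 x1 x3) in *. set (t3 := tentf n x3 x0 x1 x2) in *.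
  assert (Nc0 : nice c0) by apply nice_cellf. assert (Nc1 : nice c1) by apply nice_cellf.
  assert (Nc2 : nice c2) by apply nice_cellf. assert (Nc3 : nice c3) by apply nice_cellf.
  assert (Nt0 : nice t0) by apply nice_tentf. assert (Nt1 : nice t1) by apply nice_tentf.
  assert (Nt2 : nice t2) by apply nice_tentf. assert (Nt3 : nice t3) by apply nice_tentf.
  assert (Nh := nice_hmax x0 x1 x2 x3).
  set (g := fun u => hmax x0 x1 x2 x3 u - lam - (c0 u + c1 u + c2 u + c3 u)).
  set (t := fun u => 2 * (t0 u + t1 u + t2 u + t3 u)).
  assert (Ng : nice g).
  { apply (nice_minus (fun u => hmax x0 x1 x2 x3 u - lam)); [|now apply nice_sum4].
    apply (nice_minus (hmax x0 x1 x2 x3)); [assumption | constructor]. }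
  assert (Nt : nice t) by now apply (nice_scal 2 (fun u => t0 u + t1 u + t2 u + t3 u)), nice_sum4.
  assert (Hp : forall u, dot u u = 1 -> Rabs (g u) <= t u).
  { intros u Hu. apply partition_error; try lra; now apply dot_unit_bound. }
  assert (Hg : Rabs (sint g) <= sint t).
  { apply Rabs_le. split.
    - rewrite <- (Rmult_1_l (sint t)), Ropp_mult_distr_l, <- sint_scal by assumption.
      apply sint_le; [now apply nice_scal | assumption |]. intros u Hu.
      generalize (proj1 (Rabs_le_between _ _) (Hp u Hu)); lra.
    - apply sint_le; [assumption | assumption |]. intros u Hu.
      generalize (proj1 (Rabs_le_between _ _) (Hp u Hu)); lra. }
  assert (Eg : sint g = sint (hmax x0 x1 x2 x3) - 4 * PI * lam - (sint c0 + sint c1 + sint c2 + sint c3)).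
  { unfold g. rewrite (sint_minus (fun u => hmax x0 x1 x2 x3 u - lam) (fun u => c0 u + c1 u + c2 u + c3 u)).
    - rewrite (sint_minus (hmax x0 x1 x2 x3) (fun _ => lam)) by (auto; constructor).
      now rewrite sint_const, sint_sum4.
    - apply (nice_minus (hmax x0 x1 x2 x3)); [assumption | constructor].
    - now apply nice_sum4. }
  assert (Et : sint t = 2 * (sint t0 + sint t1 + sint t2 + sint t3)).
  { unfold t. rewrite (sint_scal 2 (fun u => t0 u + t1 u + t2 u + t3 u)) by now apply nice_sum4.
    now rewrite sint_sum4. }
  apply Rabs_le_between in Hg, E0, E1, E2, E3.
  (* A factor 2 comes from the partition error and another 2 from replacing each weighted integral
     by its cell integral. *)
  apply Rle_lt_trans with (4 * (sint t0 + sint t1 + sint t2 + sint t3)).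
  { apply Rabs_le. lra. }
  apply Rle_lt_trans with (4 * (C0 + C1 + C2 + C3) / n).
  { apply Rle_trans with (4 * (C0 / n + C1 / n + C2 / n + C3 / n)); [lra | right; field; lra]. }
  apply Rle_lt_trans with (C / n).
  { apply Rmult_le_compat_r; [left; now apply Rinv_0_lt_compat | apply Rle_abs]. }
  unfold n. apply Rmult_lt_reg_r with ((C + 1) / e); [assumption|].
  replace (C / ((C + 1) / e) * ((C + 1) / e)) with C by (field; lra).
  replace (e * ((C + 1) / e)) with (C + 1) by (field; lra). lra.
Qed.

(** * The one-variable extremal problem *)

(* [lam0] makes the regular tetrahedron a critical point; then [capint lam0] takes the value
   [base0] at the cosines [1 / 3] and [q0]. *)
Definition q0 : R := atan (sqrt 2) / sqrt 2.
Definition lam0 : R := q0 / 2 + / 6.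
Definition base0 : R := / 2 - lam0 + q0 / 6.
Definition psi (c : R) : R := / 2 * (c - / 3) * (q0 - c).
Definition psip (c : R) : R := Rmax 0 (psi c).

(** [lam0] is half the sum of the roots 1/3 and [q0] of the parabola [psi]. *)
Lemma capint_psi c : capint lam0 c = base0 + psi c.
Proof. unfold capint, base0, psi, lam0. field. Qed.

Lemma is_derive_idR (x : R) : is_derive (fun t : R => t) x 1.
Proof. auto_derive; [trivial | reflexivity]. Qed.

Lemma strict_incr_of_derive (f f' : R -> R) a b : a < b ->
  (forall x, a <= x <= b -> is_derive f x (f' x)) ->
  (forall x, a < x < b -> 0 < f' x) -> f a < f b.
Proof.
  intros Hab Hd Hp.
  destruct (MVT_cor2 f f' a b Hab) as [c [Hc1 Hc2]].
  - intros; apply is_derive_Reals; auto.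
  - assert (0 < f' c) by auto. nra.
Qed.

Lemma ccot_eq m : ccot m = m / sqrt (1 + m * m).
Proof. apply sin_atan. Qed.

Lemma ccot_lt m m' : m < m' -> ccot m < ccot m'.
Proof.
  intros H. generalize (atan_increasing m m' H) (atan_bound m) (atan_bound m'); intros.
  apply sin_increasing_1; lra.
Qed.

Lemma ccot_le m m' : m <= m' -> ccot m <= ccot m'.
Proof. intros [H| ->]; [left; now apply ccot_lt | apply Rle_refl]. Qed.

Lemma is_derive_ccot m : is_derive ccot m (/ (1 + m * m) * cos (atan m)).
Proof.
  apply (is_derive_comp sin atan).
  - apply is_derive_Reals, derivable_pt_lim_sin.
  - apply is_derive_atan.
Qed.

Lemma ccot_Lipschitz m m' : Rabs (ccot m' - ccot m) <= 1 * Rabs (m' - m).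
Proof.
  apply (Lipschitz_of_derive ccot _ 1 is_derive_ccot). intros x.
  assert (0 < / (1 + x * x)) by (apply Rinv_0_lt_compat; nra).
  assert (/ (1 + x * x) <= 1) by (rewrite <- Rinv_1; apply Rinv_le_contravar; nra).
  rewrite Rabs_mult, Rabs_pos_eq by lra. apply Rle_trans with (1 * 1); [|lra].
  apply Rmult_le_compat; try apply Rabs_pos; try lra. apply Rabs_cos_le.
Qed.

Lemma ccot_bound m : -1 <= ccot m <= 1.
Proof. apply SIN_bound. Qed.

Lemma sqrt2_sq : sqrt 2 * sqrt 2 = 2.
Proof. apply sqrt_sqrt; lra. Qed.

Lemma sqrt2_pos : 0 < sqrt 2.
Proof. apply sqrt_lt_R0; lra. Qed.

Lemma q0_lt_1 : q0 < 1.
Proof.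
  assert (H := sqrt2_pos).
  assert (H1 : 0 - atan 0 < sqrt 2 - atan (sqrt 2)).
  { apply (strict_incr_of_derive (fun x => x - atan x) (fun x => 1 - / (1 + Rsqr x))); [assumption| |].
    - intros. apply (is_derive_minus (fun x => x) atan); [apply is_derive_idR | apply is_derive_atan].
    - intros x Hx. enough (/ (1 + Rsqr x) < / 1) by lra.
      apply Rinv_lt_contravar; unfold Rsqr; nra. }
  rewrite atan_0 in H1. unfold q0.
  apply Rmult_lt_reg_r with (sqrt 2); [assumption|].
  unfold Rdiv. rewrite Rmult_assoc, Rinv_l; lra.
Qed.

(** This is sin x < x at x = atan (sqrt 2). The left side is 1 / sqrt 3, the largest boundary cosine
    of a regular cell, so the whole boundary of that cell stays where [psi] is nonnegative. *)
Lemma ccot_inv_sqrt2_lt : ccot (/ sqrt 2) < q0.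
Proof.
  assert (H := sqrt2_pos). assert (Hs := sqrt2_sq).
  assert (H3 : 0 < sqrt 3) by (apply sqrt_lt_R0; lra).
  assert (H3s : sqrt 3 * sqrt 3 = 3) by (apply sqrt_sqrt; lra).
  assert (E1 : ccot (/ sqrt 2) = / sqrt 3).
  { rewrite ccot_eq. replace (1 + / sqrt 2 * / sqrt 2) with (3 / 2).
    - rewrite sqrt_div_alt by lra. field. split; lra.
    - rewrite <- Rinv_mult, Hs. lra. }
  assert (E2 : sin (atan (sqrt 2)) = sqrt 2 / sqrt 3).
  { rewrite sin_atan. unfold Rsqr. rewrite Hs. do 2 f_equal; lra. }
  assert (H1 : sin (atan (sqrt 2)) < atan (sqrt 2)).
  { apply sin_lt_x. rewrite <- atan_0. now apply atan_increasing. }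
  rewrite E1. unfold q0. apply Rmult_lt_reg_r with (sqrt 2); [assumption|].
  unfold Rdiv. rewrite (Rmult_assoc (atan _)), Rinv_l, Rmult_1_r by lra.
  unfold Rdiv in E2. lra.
Qed.

(** [m_lo] and [m_hi] are the slopes at which [psi] vanishes: the cotangents of the angles with
    cosines 1/3 and [q0]. *)
Definition m_lo : R := / (2 * sqrt 2).
Definition m_hi : R := tan (asin q0).

Lemma ccot_m_lo : ccot m_lo = / 3.
Proof.
  assert (H := sqrt2_pos). assert (Hs := sqrt2_sq).
  rewrite ccot_eq. unfold m_lo.
  replace (1 + _) with ((3 / (2 * sqrt 2)) * (3 / (2 * sqrt 2))).
  - rewrite sqrt_square by (apply Rlt_le, Rdiv_lt_0_compat; lra). field. lra.
  - transitivity (9 / (4 * (sqrt 2 * sqrt 2))); [field; lra|].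
    transitivity (1 + 1 / (4 * (sqrt 2 * sqrt 2))); [rewrite Hs; field | field; lra].
Qed.

Lemma m_lo_pos : 0 < m_lo.
Proof. apply Rinv_0_lt_compat. generalize sqrt2_pos; lra. Qed.

Lemma m_lo_lt : m_lo < / sqrt 2.
Proof.
  assert (H := sqrt2_pos). unfold m_lo. rewrite Rinv_mult.
  assert (0 < / sqrt 2) by now apply Rinv_0_lt_compat. lra.
Qed.

Lemma q0_gt : / 3 < q0.
Proof. rewrite <- ccot_m_lo. eapply Rlt_trans; [|apply ccot_inv_sqrt2_lt]. apply ccot_lt, m_lo_lt. Qed.

Lemma ccot_m_hi : ccot m_hi = q0.
Proof.
  generalize q0_lt_1 q0_gt; intros. unfold ccot, m_hi.
  assert (H1 : sin (asin q0) = q0) by (apply sin_asin; lra).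
  rewrite atan_tan; [assumption|].
  generalize PI_RGT_0 (asin_bound q0); intros HPI [[Ha|Ha] [Hb|Hb]]; try lra.
  - rewrite Hb, sin_PI2 in H1; lra.
  - rewrite <- Ha, sin_neg, sin_PI2 in H1; lra.
Qed.

Lemma m_hi_gt : / sqrt 2 < m_hi.
Proof.
  apply Rnot_le_lt. intros H. generalize (ccot_le _ _ H) ccot_inv_sqrt2_lt. rewrite ccot_m_hi. lra.
Qed.

Lemma psip_mid m : m_lo <= m <= m_hi -> psip (ccot m) = psi (ccot m).
Proof.
  intros [H1 H2]. apply ccot_le in H1, H2. rewrite ccot_m_lo in H1. rewrite ccot_m_hi in H2.
  unfold psip. apply Rmax_right. unfold psi. apply Rmult_le_pos; lra.
Qed.

Lemma psip_out m : m <= m_lo \/ m_hi <= m -> psip (ccot m) = 0.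
Proof.
  generalize q0_gt; intros Hq H. unfold psip. apply Rmax_left. unfold psi.
  destruct H as [H|H]; apply ccot_le in H; rewrite ?ccot_m_lo, ?ccot_m_hi in H; nra.
Qed.

Lemma psip_pos c : 0 <= psip c.
Proof. apply Rmax_l. Qed.

Lemma psip_Lipschitz m m' : Rabs (psip (ccot m') - psip (ccot m)) <= 2 * Rabs (m' - m).
Proof.
  generalize q0_gt q0_lt_1; intros Hq1 Hq2.
  assert (H1 : Rabs (psip (ccot m') - psip (ccot m)) <= Rabs (psi (ccot m') - psi (ccot m))).
  { unfold psip, Rmax, Rabs. repeat destruct (Rle_dec _ _); repeat destruct (Rcase_abs _); lra. }
  eapply Rle_trans; [exact H1|].
  replace (psi (ccot m') - psi (ccot m)) with
    ((/ 2 * (q0 + / 3 - ccot m - ccot m')) * (ccot m' - ccot m)) by (unfold psi; ring).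
  rewrite Rabs_mult. apply Rmult_le_compat; try apply Rabs_pos.
  - generalize (ccot_bound m) (ccot_bound m'); intros. apply Rabs_le. lra.
  - generalize (ccot_Lipschitz m m'); lra.
Qed.

(** The positive excess caused by one neighbour whose slope is a sinusoid of amplitude k, integrated
    over half a turn; by symmetry the full circle gives twice as much. *)
Definition cap_loss (k : R) : R := RInt (fun t => psip (ccot (k * cos t))) 0 PI.

Lemma cont_psip k t : continuous (fun t => psip (ccot (k * cos t))) t.
Proof.
  apply Lipschitz_continuous with (2 * Rabs k). intros y.
  eapply Rle_trans; [apply psip_Lipschitz|].
  rewrite <- Rmult_minus_distr_l, Rabs_mult, Rmult_assoc.
  apply Rmult_le_compat_l; [lra|]. apply Rmult_le_compat_l; [apply Rabs_pos|].
  generalize (cos_Lipschitz t y); lra.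
Qed.

Lemma ex_cap_loss k a b : ex_RInt (fun t => psip (ccot (k * cos t))) a b.
Proof. apply cont_ex_RInt, cont_psip. Qed.

Lemma cap_loss_Lipschitz k k' : Rabs (cap_loss k' - cap_loss k) <= PI * (2 * Rabs (k' - k)).
Proof.
  unfold cap_loss. rewrite <- RInt_minusR by apply ex_cap_loss.
  replace (PI * (2 * Rabs (k' - k))) with ((PI - 0) * (2 * Rabs (k' - k))) by ring.
  apply abs_RInt_le_const; [generalize PI_RGT_0; lra | |].
  - apply (ex_RInt_minus (V:=R_NormedModule)); apply ex_cap_loss.
  - intros t _. eapply Rle_trans; [apply psip_Lipschitz|].
    rewrite <- Rmult_minus_distr_r, Rabs_mult.
    generalize (Rabs_cos_le t) (Rabs_pos (k' - k)); intros. nra.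
Qed.

Lemma cap_loss_small k : 0 <= k <= m_lo -> cap_loss k = 0.
Proof.
  intros Hk. unfold cap_loss. rewrite (RInt_ext _ (fun _ => 0)).
  - rewrite RInt_constR. ring.
  - intros t _. apply psip_out. left. generalize (COS_bound t); nra.
Qed.

(* With [z = sqrt (8 k^2 - 1)], [hyp z = sqrt (1 + k^2)] and [Qf z] is the integral of
   [psi (ccot (k cos t))] up to the angle [atan z], where [ccot (k cos t) = 1 / 3]. *)
Definition hyp (z : R) : R := sqrt ((z * z + 9) / 8).

Definition Qf (z : R) : R :=
  / (2 * hyp z) * atan (z / hyp z) + lam0 * atan (z / 3) - (/ 2 + q0 / 6) * atan z.

Lemma hyp_sq z : hyp z * hyp z = (z * z + 9) / 8.
Proof. apply sqrt_sqrt. nra. Qed.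

Lemma hyp_pos z : 0 < hyp z.
Proof. apply sqrt_lt_R0. nra. Qed.

Lemma is_derive_hyp z : is_derive hyp z (z / (8 * hyp z)).
Proof.
  unfold hyp. auto_derive; [nra|]. change (sqrt _) with (hyp z). field. generalize (hyp_pos z); lra.
Qed.

Lemma sin_cos_atan t : sin (atan t) * cos (atan t) = t / (1 + t * t).
Proof.
  rewrite sin_atan, cos_atan. unfold Rsqr.
  assert (H : 0 < 1 + t * t) by nra.
  assert (Hs := sqrt_sqrt _ (Rlt_le _ _ H)). assert (Hp := sqrt_lt_R0 _ H).
  rewrite <- Hs at 3. field. lra.
Qed.

(** Once [lam0] is expressed through [q0], the derivative factors. For z > 0 its sign is that of 3
    q0 sin T cos T - T, where T = atan (z / hyp z). *)
Lemma is_derive_Qf z : is_derive Qf z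
  (z / (2 * hyp z * (z * z + 9)) *
   (3 * q0 * (sin (atan (z / hyp z)) * cos (atan (z / hyp z))) - atan (z / hyp z))).
Proof.
  assert (Hh := hyp_pos z). assert (Hs := hyp_sq z).
  assert (D1 : is_derive (fun z => z / hyp z) z (9 / (8 * hyp z * (hyp z * hyp z)))).
  { replace (9 / _) with ((1 * hyp z - z * (z / (8 * hyp z))) / (hyp z) ^ 2).
    - apply (is_derive_div (fun z => z) hyp); [apply is_derive_idR | apply is_derive_hyp | lra].
    - replace ((1 * hyp z - z * (z / (8 * hyp z))) / hyp z ^ 2) with
        ((8 * (hyp z * hyp z) - z * z) / (8 * hyp z * (hyp z * hyp z))) by (field; lra).
      rewrite Hs at 1. f_equal. field. }
  assert (D2 : is_derive (fun z => atan (z / hyp z)) z (/ (hyp z * (z * z + 1)))).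
  { replace (/ (hyp z * _)) with (9 / (8 * hyp z * (hyp z * hyp z)) * / (1 + Rsqr (z / hyp z))).
    - apply (is_derive_comp atan (fun z => z / hyp z)); [apply is_derive_atan | assumption].
    - unfold Rsqr. replace (1 + z / hyp z * (z / hyp z)) with ((hyp z * hyp z + z * z) / (hyp z * hyp z))
        by (field; lra).
      replace (9 / _ * _) with (9 / (8 * hyp z * (hyp z * hyp z + z * z))) by (field; split; nra).
      rewrite Hs. field. split; nra. }
  assert (D3 : is_derive (fun z => / (2 * hyp z)) z (- (z / (8 * hyp z)) / (2 * (hyp z * hyp z)))).
  { replace (- (z / (8 * hyp z)) / (2 * (hyp z * hyp z))) with
      (- (2 * (z / (8 * hyp z))) / (2 * hyp z) ^ 2) by (field; lra).
    apply (is_derive_inv (fun z => 2 * hyp z)); [|lra].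
    apply (is_derive_scal hyp), is_derive_hyp. }
  assert (D4 : is_derive (fun z => atan (z / 3)) z (3 / (z * z + 9))).
  { replace (3 / _) with (/ 3 * / (1 + Rsqr (z / 3))) by (unfold Rsqr; field; repeat split; nra).
    apply (is_derive_comp atan (fun z => z / 3)); [apply is_derive_atan|]. auto_derive; [trivial|field]. }
  assert (D5 := is_derive_atan z).
  set (T := atan (z / hyp z)) in *.
  replace (_ * _) with
    ((- (z / (8 * hyp z)) / (2 * (hyp z * hyp z)) * T + / (2 * hyp z) * / (hyp z * (z * z + 1)))
     + lam0 * (3 / (z * z + 9)) - (/ 2 + q0 / 6) * / (1 + Rsqr z)).
  - apply (is_derive_minus (fun z => / (2 * hyp z) * atan (z / hyp z) + lam0 * atan (z / 3))
      (fun z => (/ 2 + q0 / 6) * atan z)).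
    + apply (is_derive_plus (fun z => / (2 * hyp z) * atan (z / hyp z)) (fun z => lam0 * atan (z / 3))).
      * apply (is_derive_mult (fun z => / (2 * hyp z)) (fun z => atan (z / hyp z)));
          [assumption | assumption | intros; apply Rmult_comm].
      * now apply (is_derive_scal (fun z => atan (z / 3))).
    + now apply (is_derive_scal atan).
  - unfold T at 2 3. rewrite sin_cos_atan.
    replace (1 + z / hyp z * (z / hyp z)) with ((hyp z * hyp z + z * z) / (hyp z * hyp z)) by (field; lra).
    replace (z / hyp z / ((hyp z * hyp z + z * z) / (hyp z * hyp z))) with
      (z * (hyp z) / (hyp z * hyp z + z * z)) by (field; split; nra).
    unfold lam0, Rsqr.
    replace (- (z / (8 * hyp z)) / (2 * (hyp z * hyp z)) * T) with
      (- z * T / (16 * hyp z * (hyp z * hyp z))) by (field; lra).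
    replace (/ (2 * hyp z) * / (hyp z * (z * z + 1))) with
      (/ (2 * (hyp z * hyp z) * (z * z + 1))) by (field; split; nra).
    rewrite Hs. field. repeat split; nra.
Qed.

Lemma sinc_decreasing x y : 0 < x -> x < y -> y < PI -> x * sin y < y * sin x.
Proof.
  intros Hx Hxy Hy.
  assert (H1 : forall t, 0 < t -> t < PI -> t * cos t < sin t).
  { intros t Ht Ht'. enough (sin 0 - 0 * cos 0 < sin t - t * cos t) by (rewrite sin_0 in *; lra).
    apply (strict_incr_of_derive (fun t => sin t - t * cos t) (fun t => t * sin t)); [assumption| |].
    - intros; auto_derive; [trivial|ring].
    - intros s Hs. apply Rmult_lt_0_compat; [lra|]. apply sin_gt_0; lra. }
  assert (H2 : - (sin x / x) < - (sin y / y)).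
  { apply (strict_incr_of_derive (fun t => - (sin t / t)) (fun t => (sin t - t * cos t) / (t * t)));
      [assumption| |].
    - intros t Ht; auto_derive; [lra|field; lra].
    - intros t Ht. apply Rdiv_lt_0_compat; [|nra]. generalize (H1 t); lra. }
  replace (x * sin y) with (x * y * (sin y / y)) by (field; lra).
  replace (y * sin x) with (x * y * (sin x / x)) by (field; lra).
  apply Rmult_lt_compat_l; [nra | lra].
Qed.

(** The quotient sin a cos a / a is sin (2 a) / (2 a). *)
Lemma sin_cos_ratio_incr a b : 0 < a -> a < b -> b < PI / 2 ->
  a * (sin b * cos b) < b * (sin a * cos a).
Proof.
  intros Ha Hab Hb. generalize (sinc_decreasing (2 * a) (2 * b)). rewrite !sin_2a. lra.
Qed.

Lemma ratio_hyp_lt x y : 0 <= x -> x < y -> x / hyp x < y / hyp y.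
Proof.
  intros Hx Hxy. assert (Hhx := hyp_pos x). assert (Hhy := hyp_pos y).
  assert (Sx := hyp_sq x). assert (Sy := hyp_sq y).
  apply Rmult_lt_reg_r with (hyp x * hyp y); [now apply Rmult_lt_0_compat|].
  replace (x / hyp x * (hyp x * hyp y)) with (x * hyp y) by (field; lra).
  replace (y / hyp y * (hyp x * hyp y)) with (y * hyp x) by (field; lra).
  apply Rsqr_incrst_0; unfold Rsqr; try (apply Rmult_le_pos; lra).
  replace (x * hyp y * (x * hyp y)) with (x * x * (hyp y * hyp y)) by ring.
  replace (y * hyp x * (y * hyp x)) with (y * y * (hyp x * hyp x)) by ring.
  rewrite Sx, Sy. nra.
Qed.

Lemma hyp_sqrt3 : sqrt 3 / hyp (sqrt 3) = sqrt 2.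
Proof.
  assert (H3 : sqrt 3 * sqrt 3 = 3) by (apply sqrt_sqrt; lra).
  unfold hyp. rewrite H3. replace ((3 + 9) / 8) with (3 / 2) by field.
  rewrite sqrt_div_alt by lra. generalize sqrt2_pos; intros.
  assert (0 < sqrt 3) by (apply sqrt_lt_R0; lra). field. split; lra.
Qed.

(** Criticality of [Qf] at sqrt 3; solving this equation for [q0] is where its definition comes
    from. *)
Lemma atan_sqrt2_eq : atan (sqrt 2) = 3 * q0 * (sin (atan (sqrt 2)) * cos (atan (sqrt 2))).
Proof.
  rewrite sin_cos_atan, sqrt2_sq. unfold q0. generalize sqrt2_pos; intros. field. lra.
Qed.

(** As z grows, T = atan (z / hyp z) increases and sin T cos T / T decreases. The derivative
    therefore changes sign once, from plus to minus, at T = atan (sqrt 2), that is, at z = sqrt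
    3. *)
Lemma Qf_lt z : 0 <= z -> z <> sqrt 3 -> Qf z < Qf (sqrt 3).
Proof.
  intros Hz Hne. generalize sqrt2_pos; intros H2.
  assert (Ha : forall x, 0 < x -> 0 < atan (x / hyp x) < PI / 2).
  { intros x Hx. split; [|apply atan_bound].
    rewrite <- atan_0. apply atan_increasing, Rdiv_lt_0_compat; [assumption | apply hyp_pos]. }
  assert (Hb : 0 < sqrt 3) by (apply sqrt_lt_R0; lra).
  assert (Hs : 0 < sin (atan (sqrt 2)) * cos (atan (sqrt 2))).
  { rewrite sin_cos_atan. apply Rdiv_lt_0_compat; nra. }
  destruct (Rlt_dec z (sqrt 3)) as [H|H].
  - apply (strict_incr_of_derive Qf _ z (sqrt 3) H (fun x _ => is_derive_Qf x)).
    intros x Hx. apply Rmult_lt_0_compat.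
    { apply Rdiv_lt_0_compat; [lra|]. generalize (hyp_pos x); nra. }
    generalize (atan_increasing _ _ (ratio_hyp_lt x (sqrt 3) ltac:(lra) ltac:(lra))).
    rewrite hyp_sqrt3. intros Hlt.
    generalize (sin_cos_ratio_incr (atan (x / hyp x)) (atan (sqrt 2))). intros G.
    specialize (G ltac:(apply Ha; lra) Hlt ltac:(apply atan_bound)).
    rewrite atan_sqrt2_eq in G at 3.
    set (S := sin (atan (sqrt 2)) * cos (atan (sqrt 2))) in *.
    set (S' := sin (atan (x / hyp x)) * cos (atan (x / hyp x))) in *.
    enough (atan (x / hyp x) < 3 * q0 * S') by lra.
    apply Rmult_lt_reg_r with S; lra.
  - assert (H' : sqrt 3 < z) by lra.
    enough (- Qf (sqrt 3) < - Qf z) by lra.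
    apply (strict_incr_of_derive (fun x => - Qf x) _ (sqrt 3) z H'
      (fun x _ => is_derive_opp Qf x _ (is_derive_Qf x))).
    intros x Hx. change (opp ?a) with (- a). rewrite Ropp_mult_distr_r. apply Rmult_lt_0_compat.
    { apply Rdiv_lt_0_compat; [lra|]. generalize (hyp_pos x); nra. }
    generalize (atan_increasing _ _ (ratio_hyp_lt (sqrt 3) x ltac:(lra) ltac:(lra))).
    rewrite hyp_sqrt3. intros Hlt.
    generalize (sin_cos_ratio_incr (atan (sqrt 2)) (atan (x / hyp x))). intros G.
    assert (Ht : 0 < atan (sqrt 2)) by (rewrite <- atan_0; now apply atan_increasing).
    specialize (G Ht Hlt ltac:(apply atan_bound)).
    rewrite atan_sqrt2_eq in G at 1.
    set (S := sin (atan (sqrt 2)) * cos (atan (sqrt 2))) in *.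
    set (S' := sin (atan (x / hyp x)) * cos (atan (x / hyp x))) in *.
    enough (3 * q0 * S' < atan (x / hyp x)) by lra.
    apply Rmult_lt_reg_r with S; lra.
Qed.

Lemma Qf_0 : Qf 0 = 0.
Proof.
  unfold Qf. replace (0 / hyp 0) with 0 by (unfold Rdiv; ring).
  replace (0 / 3) with 0 by field. rewrite atan_0. ring.
Qed.

(** With c = [ccot] (k cos t) and w^2 = 1 + k^2 cos^2 t one has c^2 = 1 - 1 / w^2. Hence [psi] c is
    1 / (2 w^2) + lam0 c - (1/2 + q0/6), and the three terms are integrated separately. *)
Lemma psi_antiderivative k t : 0 < cos t ->
  is_derive (fun t => / (2 * sqrt (1 + k * k)) * atan (tan t / sqrt (1 + k * k))
     + lam0 * atan (k * sin t / sqrt (1 + k * cos t * (k * cos t))) - (/ 2 + q0 / 6) * t) t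
    (psi (ccot (k * cos t))).
Proof.
  intros Hc. set (s := sqrt (1 + k * k)).
  assert (Hs : s * s = 1 + k * k) by (apply sqrt_sqrt; nra).
  assert (Hs0 : 0 < s) by (apply sqrt_lt_R0; nra).
  set (w := sqrt (1 + k * cos t * (k * cos t))).
  assert (Hw : w * w = 1 + k * cos t * (k * cos t)) by (apply sqrt_sqrt; nra).
  assert (Hw0 : 0 < w) by (apply sqrt_lt_R0; nra).
  assert (Hsc : sin t * sin t + cos t * cos t = 1) by (generalize (sin2_cos2 t); unfold Rsqr; lra).
  assert (D1 : is_derive (fun t => atan (tan t / s)) t (s / (w * w))).
  { replace (s / (w * w)) with (/ (s * (cos t * cos t)) * / (1 + Rsqr (tan t / s))).
    - apply (is_derive_comp atan (fun t => tan t / s)); [apply is_derive_atan|].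
      replace (/ (s * (cos t * cos t))) with (/ s * ((cos t * cos t + sin t * sin t) / (cos t * cos t)))
        by (rewrite Rplus_comm, Hsc; field; lra).
      apply (is_derive_ext (fun t => / s * (sin t / cos t))); [intros; unfold tan, Rdiv; ringR|].
      auto_derive; [lra|]. field. lra.
    - unfold Rsqr, tan. rewrite Hw.
      replace (1 + sin t / cos t / s * (sin t / cos t / s)) with
        ((s * s * (cos t * cos t) + sin t * sin t) / (s * s * (cos t * cos t))) by (field; lra).
      replace (s * s * (cos t * cos t) + sin t * sin t) with (1 + k * cos t * (k * cos t)) by (rewrite Hs; lra).
      field. repeat split; nra. }
  assert (D2 : is_derive (fun t => atan (k * sin t / sqrt (1 + k * cos t * (k * cos t)))) t (k * cos t / w)).
  { replace (k * cos t / w) with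
      ((k * cos t * w + k * sin t * (k * k * cos t * sin t / w)) / (w * w) * / (1 + Rsqr (k * sin t / w))).
    - apply (is_derive_comp atan (fun t => k * sin t / sqrt (1 + k * cos t * (k * cos t))));
        [apply is_derive_atan|].
      auto_derive; fold w; [split; [nra | split; [apply Rgt_not_eq|]]; auto |]. field. lra.
    - unfold Rsqr. replace (1 + k * sin t / w * (k * sin t / w)) with ((w * w + k * k * (sin t * sin t)) / (w * w))
        by (field; lra).
      replace (w * w + k * k * (sin t * sin t)) with (s * s) by (rewrite Hw, Hs; nra).
      replace (k * cos t * w + k * sin t * (k * k * cos t * sin t / w)) with
        (k * cos t * (w * w + k * k * (sin t * sin t)) / w) by (field; lra).
      replace (w * w + k * k * (sin t * sin t)) with (s * s) by (rewrite Hw, Hs; nra).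
      field. lra. }
  replace (psi (ccot (k * cos t))) with
    (/ (2 * s) * (s / (w * w)) + lam0 * (k * cos t / w) - (/ 2 + q0 / 6) * 1).
  - apply (is_derive_minus (fun t => / (2 * s) * atan (tan t / s)
     + lam0 * atan (k * sin t / sqrt (1 + k * cos t * (k * cos t)))) (fun t => (/ 2 + q0 / 6) * t)).
    + apply (is_derive_plus (fun t => / (2 * s) * atan (tan t / s))
        (fun t => lam0 * atan (k * sin t / sqrt (1 + k * cos t * (k * cos t))))).
      * now apply (is_derive_scal (fun t => atan (tan t / s))).
      * now apply (is_derive_scal (fun t => atan (k * sin t / sqrt (1 + k * cos t * (k * cos t))))).
    + apply (is_derive_scal (fun t => t)), is_derive_idR.
  - rewrite ccot_eq. fold w. unfold psi, lam0.
    replace (/ 2 * (k * cos t / w - / 3) * (q0 - k * cos t / w)) with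
      (/ 2 * ((q0 + / 3) * (k * cos t / w) - q0 / 3) - / 2 * ((k * cos t * (k * cos t)) / (w * w))) by (field; lra).
    replace (k * cos t * (k * cos t)) with (w * w - 1) by lra. field. lra.
Qed.

Lemma cap_loss_tail k s : 0 <= s <= PI -> k * cos s <= m_lo -> 0 <= k ->
  cap_loss k = RInt (fun t => psip (ccot (k * cos t))) 0 s.
Proof.
  intros Hs Hk Hk0. unfold cap_loss.
  rewrite <- (RInt_ChaslesR _ 0 s PI) by apply ex_cap_loss.
  rewrite (RInt_ext _ (fun _ => 0) s PI).
  - rewrite RInt_constR. ring.
  - intros t. rewrite Rmin_left, Rmax_right by lra. intros Ht. apply psip_out. left.
    assert (cos t <= cos s) by (apply cos_decr_1; lra). nra.
Qed.

(** As k <= [m_hi], the slope k cos t never passes the upper root: the positive part is [psi] itself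
    until k cos t falls to [m_lo], and zero afterwards. *)
Lemma cap_loss_mid k : m_lo <= k <= m_hi -> cap_loss k = Qf (sqrt (8 * (k * k) - 1)).
Proof.
  intros [Hk1 Hk2]. assert (H2 := sqrt2_pos). assert (Hs2 := sqrt2_sq). assert (Hlo := m_lo_pos).
  assert (Hlo2 : 8 * (m_lo * m_lo) = 1).
  { unfold m_lo. transitivity (8 / (4 * (sqrt 2 * sqrt 2))); [field; lra | rewrite Hs2; field]. }
  set (z := sqrt (8 * (k * k) - 1)).
  assert (Hz : z * z = 8 * (k * k) - 1) by (apply sqrt_sqrt; nra).
  assert (Hz0 : 0 <= z) by apply sqrt_pos.
  set (s := atan z).
  assert (Hs : 0 <= s < PI / 2).
  { split; [|apply atan_bound]. destruct Hz0 as [H|H].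
    - left. rewrite <- atan_0. now apply atan_increasing.
    - right. unfold s. now rewrite <- H, atan_0. }
  assert (Hcs : k * cos s = m_lo).
  { unfold s. rewrite cos_atan. unfold Rsqr. rewrite Hz.
    replace (1 + (8 * (k * k) - 1)) with ((k / m_lo) * (k / m_lo)).
    - rewrite sqrt_square; [field; lra|]. apply Rlt_le, Rdiv_lt_0_compat; lra.
    - replace (1 + _) with (8 * (k * k)) by ring.
      symmetry. apply Rmult_eq_reg_r with (m_lo * m_lo); [|nra].
      transitivity (k * k * (8 * (m_lo * m_lo))); [ring | rewrite Hlo2; field; lra]. }
  assert (Hsin : k * sin s = z * m_lo).
  { assert (E : tan s = z) by apply tan_atan. rewrite <- E, <- Hcs. unfold tan.
    assert (0 < cos s) by (apply cos_gt_0; lra). field. lra. }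
  rewrite (cap_loss_tail k s) by (generalize PI_RGT_0; lra).
  rewrite (RInt_ext _ (fun t => psi (ccot (k * cos t)))).
  2:{ intros t. rewrite Rmin_left, Rmax_right by lra. intros Ht. apply psip_mid.
      assert (cos s <= cos t) by (apply cos_decr_1; lra). generalize (COS_bound t). split; nra. }
  rewrite (RInt_derivR (fun t => / (2 * sqrt (1 + k * k)) * atan (tan t / sqrt (1 + k * k))
     + lam0 * atan (k * sin t / sqrt (1 + k * cos t * (k * cos t))) - (/ 2 + q0 / 6) * t)).
  - rewrite tan_0, sin_0. replace (tan s) with z by (symmetry; apply tan_atan).
    rewrite Hcs, Hsin. replace (0 / sqrt (1 + k * k)) with 0 by (unfold Rdiv; ring).
    rewrite Rmult_0_r. replace (0 / sqrt _) with 0 by (unfold Rdiv; ring). rewrite atan_0.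
    replace (z * m_lo / sqrt (1 + m_lo * m_lo)) with (z / 3).
    + replace (sqrt (1 + k * k)) with (hyp z) by (unfold hyp; f_equal; lra).
      unfold Qf. fold s. ringR.
    + generalize (ccot_eq m_lo); rewrite ccot_m_lo; intros E.
      unfold Rdiv at 2. rewrite Rmult_assoc. unfold Rdiv in *. now rewrite <- E.
  - intros t. rewrite Rmin_left, Rmax_right by lra. intros Ht.
    apply psi_antiderivative. apply cos_gt_0; lra.
  - intros t _. apply (cont_comp (fun t => ccot (k * cos t)) psi).
    + apply (cont_comp (fun t => k * cos t) ccot); [cont | apply cont_ccot].
    + unfold psi. cont.
Qed.

Lemma acos_le a b : -1 <= a -> a <= b -> b <= 1 -> acos b <= acos a.
Proof.
  intros Ha Hab Hb. apply Rnot_lt_le. intros H.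
  generalize (acos_bound a) (acos_bound b); intros.
  assert (cos (acos b) < cos (acos a)) by (apply cos_decreasing_1; lra).
  rewrite !cos_acos in * by lra. lra.
Qed.

Lemma is_derive_acos x : -1 < x < 1 -> is_derive acos x (- / sqrt (1 - x * x)).
Proof.
  intros H. apply is_derive_Reals.
  replace (- / sqrt (1 - x * x)) with (derive_pt acos x (derivable_pt_acos x H)).
  - apply (proj2_sig (derivable_pt_acos x H)).
  - rewrite derive_pt_acos. unfold Rsqr, Rdiv. ring.
Qed.

Lemma m_lo_lt_hi : m_lo < m_hi.
Proof. generalize m_hi_gt m_lo_lt; lra. Qed.

(* The substitution [k' cos s = k cos t] has derivative [ds/dt >= 1]. *)
Lemma cap_loss_decr k k' : m_hi < k' -> k' < k -> cap_loss k <= cap_loss k'.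
Proof.
  intros Hk' Hk. assert (Hlo := m_lo_pos). assert (Hhi := m_lo_lt_hi). generalize PI_RGT_0; intros HPI.
  assert (Bd : forall a, 0 < a -> a < k -> -1 <= a / k <= 1).
  { intros a Ha Hak. split.
    - apply Rle_trans with 0; [lra|]. apply Rlt_le, Rdiv_lt_0_compat; lra.
    - apply Rmult_le_reg_r with k; [lra|]. unfold Rdiv. rewrite Rmult_assoc, Rinv_l; lra. }
  (* The integrand for k is supported in [a, b], where k cos t runs from [m_hi] down to [m_lo]. *)
  set (a := acos (m_hi / k)). set (b := acos (m_lo / k)).
  assert (Ca : k * cos a = m_hi) by (unfold a; rewrite cos_acos by (apply Bd; lra); field; lra).
  assert (Cb : k * cos b = m_lo) by (unfold b; rewrite cos_acos by (apply Bd; lra); field; lra).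
  assert (Hab : a <= b).
  { apply acos_le; try (apply Bd; lra). unfold Rdiv. apply Rmult_le_compat_r; [|lra].
    left; apply Rinv_0_lt_compat; lra. }
  assert (Ba : 0 <= a <= PI) by apply acos_bound. assert (Bb : 0 <= b <= PI) by apply acos_bound.
  set (r := k / k'). assert (Hr : 1 < r).
  { unfold r. apply Rmult_lt_reg_r with k'; [lra|]. unfold Rdiv. rewrite Rmult_assoc, Rinv_l; lra. }
  assert (Hrk : forall x, k' * (r * x) = k * x) by (intros; unfold r; field; lra).
  set (g := fun t => acos (r * cos t)).
  set (dg := fun t => r * sin t / sqrt (1 - (r * cos t) * (r * cos t))).
  assert (Hin : forall t, a <= t <= b -> m_lo <= k * cos t <= m_hi /\ 0 < r * cos t < 1).
  { intros t Ht. assert (cos b <= cos t) by (apply cos_decr_1; lra).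
    assert (cos t <= cos a) by (apply cos_decr_1; lra).
    assert (m_lo <= k * cos t <= m_hi) by (split; nra). split; [assumption|].
    assert (k' * (r * cos t) <= m_hi) by (rewrite Hrk; lra).
    assert (m_lo <= k' * (r * cos t)) by (rewrite Hrk; lra). split; nra. }
  assert (Hpos : forall t, a <= t <= b -> 0 < 1 - (r * cos t) * (r * cos t)).
  { intros t Ht. destruct (Hin t Ht) as [_ H]. nra. }
  (* The strict inequality [m_hi] < k' keeps r cos t below 1, away from the point where acos is not
     differentiable. *)
  assert (Hdg : forall t, a <= t <= b -> is_derive g t (dg t) /\ continuous dg t).
  { intros t Ht. specialize (Hpos t Ht). destruct (Hin t Ht) as [_ Hc]. split.
    - unfold dg. replace (r * sin t / sqrt (1 - r * cos t * (r * cos t))) with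
        (- (r * sin t) * - / sqrt (1 - r * cos t * (r * cos t))) by (unfold Rdiv; ring).
      apply (is_derive_comp acos (fun t => r * cos t)); [apply is_derive_acos; lra|].
      auto_derive; [trivial|ring].
    - apply (ex_derive_continuous dg). unfold dg. auto_derive.
      split; [lra|]. split; [|trivial]. apply Rgt_not_eq, sqrt_lt_R0. lra. }
  set (F := fun s => psip (ccot (k' * cos s))).
  assert (HF : forall s, continuous F s) by (intros; apply cont_psip).
  assert (E := RInt_comp (V:=R_CompleteNormedModule) F g dg a b).
  rewrite Rmin_left, Rmax_right in E by lra. specialize (E (fun x _ => HF _) Hdg).
  assert (Hga : 0 <= g a) by apply acos_bound. assert (Hgb : g b <= PI) by apply acos_bound.
  assert (Hgab : g a <= g b).
  { destruct (Hin a ltac:(lra)) as [_ ?]. destruct (Hin b ltac:(lra)) as [_ ?].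
    apply acos_le; try lra. apply Rmult_le_compat_l; [lra|]. apply cos_decr_1; lra. }
  rewrite (cap_loss_tail k b) by lra.
  rewrite <- (RInt_ChaslesR _ 0 a b) by apply ex_cap_loss.
  rewrite (RInt_ext _ (fun _ => 0) 0 a).
  2:{ intros t. rewrite Rmin_left, Rmax_right by lra. intros Ht. apply psip_out. right.
      rewrite <- Ca. apply Rmult_le_compat_l; [lra|]. apply cos_decr_1; lra. }
  rewrite RInt_constR, Rmult_0_r, Rplus_0_l.
  apply Rle_trans with (RInt F (g a) (g b)).
  - rewrite <- E. apply RInt_le; [assumption | apply ex_cap_loss | |].
    + apply (@ex_RInt_continuous R_CompleteNormedModule). rewrite Rmin_left, Rmax_right by lra.
      intros t Ht. apply (cont_mult dg (fun t => F (g t))); [now apply Hdg|].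
      apply (cont_comp g F); [|apply HF]. apply (ex_derive_continuous g). exists (dg t). now apply Hdg.
    + intros t Ht. change (scal (dg t) (F (g t))) with (dg t * F (g t)).
      destruct (Hin t ltac:(lra)) as [_ Hc]. specialize (Hpos t ltac:(lra)).
      unfold F, g. rewrite cos_acos, Hrk by lra.
      rewrite <- (Rmult_1_l (psip _)) at 1. apply Rmult_le_compat_r; [apply psip_pos|].
      assert (Hst : 0 < sin t) by (apply sin_gt_0; lra).
      unfold dg. set (w := sqrt (1 - r * cos t * (r * cos t))).
      assert (Hw : 0 < w) by now apply sqrt_lt_R0.
      assert (Hww : w * w = 1 - r * cos t * (r * cos t)) by (apply sqrt_sqrt; lra).
      assert (Hsc : sin t * sin t + cos t * cos t = 1) by (generalize (sin2_cos2 t); unfold Rsqr; lra).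
      apply Rmult_le_reg_r with w; [assumption|].
      replace (r * sin t / w * w) with (r * sin t) by (field; lra). rewrite Rmult_1_l.
      apply Rsqr_incr_0; unfold Rsqr; [|lra|apply Rmult_le_pos; lra].
      replace (r * sin t * (r * sin t)) with (r * r * (sin t * sin t)) by ring.
      replace (sin t * sin t) with (1 - cos t * cos t) by lra. rewrite Hww. nra.
  - unfold cap_loss. fold F.
    rewrite <- (RInt_ChaslesR F 0 (g a) PI), <- (RInt_ChaslesR F (g a) (g b) PI) by apply ex_cap_loss.
    assert (0 <= RInt F 0 (g a)) by (apply RInt_ge_0; [lra | apply ex_cap_loss | intros; apply psip_pos]).
    assert (0 <= RInt F (g b) PI) by (apply RInt_ge_0; [lra | apply ex_cap_loss | intros; apply psip_pos]).
    lra.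
Qed.

(** The comparison by substitution stops short of [m_hi]. It is applied at [m_hi] + d, and the
    Lipschitz bound lets d tend to 0. *)
Lemma cap_loss_large k : m_hi <= k -> cap_loss k <= cap_loss m_hi.
Proof.
  intros [Hk|<-]; [|apply Rle_refl]. apply le_epsilon. intros e He. generalize PI_RGT_0; intros HPI.
  set (d := Rmin ((k - m_hi) / 2) (e / (2 * PI))).
  assert (Hd : 0 < d) by (apply Rmin_glb_lt; [lra | apply Rdiv_lt_0_compat; lra]).
  assert (Hd1 : d <= (k - m_hi) / 2) by apply Rmin_l.
  assert (Hd2 : d <= e / (2 * PI)) by apply Rmin_r.
  apply Rle_trans with (cap_loss (m_hi + d)); [apply cap_loss_decr; lra|].
  generalize (cap_loss_Lipschitz m_hi (m_hi + d)). replace (m_hi + d - m_hi) with d by ring.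
  rewrite (Rabs_pos_eq d) by lra. intros H. apply Rabs_le_between in H.
  assert (PI * (2 * d) <= e).
  { replace e with (PI * (2 * (e / (2 * PI)))) by (field; lra). apply Rmult_le_compat_l; lra. }
  lra.
Qed.

Lemma cap_loss_opt : cap_loss (/ sqrt 2) = Qf (sqrt 3).
Proof.
  assert (H2 := sqrt2_pos). assert (Hs2 := sqrt2_sq).
  rewrite cap_loss_mid by (generalize m_lo_lt m_hi_gt; lra). f_equal. f_equal.
  rewrite <- Rinv_mult, Hs2. field.
Qed.

Lemma Qf_sqrt3_pos : 0 < Qf (sqrt 3).
Proof. rewrite <- Qf_0. apply Qf_lt; [lra|]. apply Rlt_not_eq, sqrt_lt_R0; lra. Qed.

(** Up to [m_lo] the integral is 0. Beyond [m_hi] it is at most its value at [m_hi], which already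
    lies strictly beyond the optimum 1 / sqrt 2. In between, [Qf_lt] decides. *)
Lemma cap_loss_lt k : 0 <= k -> k <> / sqrt 2 -> cap_loss k < cap_loss (/ sqrt 2).
Proof.
  intros Hk Hne. assert (H2 := sqrt2_pos). assert (Hs2 := sqrt2_sq). rewrite cap_loss_opt.
  assert (Hmid : forall k, m_lo <= k <= m_hi -> k <> / sqrt 2 -> cap_loss k < Qf (sqrt 3)).
  { intros x Hx Hxne. rewrite cap_loss_mid by assumption. apply Qf_lt; [apply sqrt_pos|].
    intros E. apply Hxne. assert (Hlo := m_lo_pos).
    assert (Hlo2 : 8 * (m_lo * m_lo) = 1).
    { unfold m_lo. transitivity (8 / (4 * (sqrt 2 * sqrt 2))); [field; lra | rewrite Hs2; field]. }
    apply sqrt_inj in E; [|nra|lra].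
    apply Rsqr_inj; [lra | left; now apply Rinv_0_lt_compat |]. unfold Rsqr.
    rewrite <- Rinv_mult, Hs2. lra. }
  destruct (Rle_dec k m_lo) as [H|H]; [rewrite cap_loss_small by lra; apply Qf_sqrt3_pos|].
  destruct (Rle_dec k m_hi) as [H'|H']; [apply Hmid; lra|].
  eapply Rle_lt_trans; [apply cap_loss_large; lra|].
  apply Hmid; generalize m_lo_lt_hi m_hi_gt; lra.
Qed.

Lemma cap_loss_le k : 0 <= k -> cap_loss k <= cap_loss (/ sqrt 2).
Proof.
  intros Hk. destruct (Req_dec k (/ sqrt 2)) as [->|H]; [apply Rle_refl | left; now apply cap_loss_lt].
Qed.

(** The amplitude of the sinusoid [slope x]. *)
Definition slope_norm (x : R3) : R := let '(x1, x2, x3) := x in sqrt (x1 * x1 + x2 * x2) / (1 - x3).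

Lemma circle_cap_loss x : height x < 1 ->
  RInt (fun phi => psip (ccot (slope x phi))) 0 (2 * PI) = 2 * cap_loss (slope_norm x).
Proof.
  destruct x as [[x1 x2] x3]. unfold height, slope_norm, slope. intros Hx.
  destruct (polar_coords x1 x2) as [r [t [Hr [H1 [H2 Hrr]]]]].
  rewrite <- Hrr, sqrt_square by assumption. set (k := r / (1 - x3)).
  set (F := fun t => psip (ccot (k * cos t))).
  assert (HF : forall s, continuous F s) by (intros; apply cont_psip).
  transitivity (RInt (fun phi => F (phi + - t)) 0 (2 * PI)).
  { apply RInt_ext; intros phi _. unfold F, k. do 2 f_equal. rewrite cos_plus, cos_neg, sin_neg, H1, H2.
    unfold Rdiv. ringR. }
  rewrite (RInt_periodic F) by (auto; intros; unfold F; now rewrite cos_plus, cos_2PI, sin_2PI,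
    Rmult_0_r, Rmult_1_r, Rminus_0_r).
  rewrite <- (RInt_ChaslesR F 0 PI (2 * PI)) by apply ex_cap_loss.
  replace (RInt F PI (2 * PI)) with (RInt F 0 PI); [unfold cap_loss; fold F; ringR|].
  (* The reflection y -> 2 pi - y, under which the cosine is even, folds [pi, 2 pi] onto [0, pi]. *)
  generalize (RInt_comp_lin (V:=R_CompleteNormedModule) F (-1) (2 * PI) PI 0 (ex_cap_loss _ _ _)).
  replace (-1 * PI + 2 * PI) with PI by ring. replace (-1 * 0 + 2 * PI) with (2 * PI) by ring.
  intros <-.
  assert (HG : forall s, continuous (fun y => scal (-1) (F (-1 * y + 2 * PI))) s).
  { intros s. apply (cont_mult (fun _ => -1) (fun y => F (-1 * y + 2 * PI))); [apply cont_const|].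
    apply (cont_comp (fun y => -1 * y + 2 * PI) F); [cont | apply HF]. }
  rewrite <- (opp_RInt_swap (V:=R_CompleteNormedModule) _ 0 PI) by now apply cont_ex_RInt.
  assert (E : RInt (fun y => scal (-1) (F (-1 * y + 2 * PI))) 0 PI = -1 * RInt F 0 PI).
  { rewrite <- RInt_scalR by apply ex_cap_loss. apply RInt_ext.
    intros s _. change (scal ?a ?b) with (a * b). unfold F. do 4 f_equal.
    replace (-1 * s + 2 * PI) with (- s + 2 * PI) by ring.
    now rewrite cos_plus, cos_2PI, sin_2PI, cos_neg, Rmult_0_r, Rmult_1_r, Rminus_0_r. }
  etransitivity; [|exact (f_equal Ropp (eq_sym E))].
  assert (N : forall v : R, v = - (-1 * v)) by (intros; ring). exact (N _).
Qed.

Lemma cont_psip_slope x phi : continuous (fun phi => psip (ccot (slope x phi))) phi.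
Proof.
  apply (cont_comp (slope x) (fun m => psip (ccot m))); [apply cont_slope|].
  apply Lipschitz_continuous with 2. intros; apply psip_Lipschitz.
Qed.

Lemma sum_psip_int x y z : height x < 1 -> height y < 1 -> height z < 1 ->
  RInt (fun phi => base0 + (psip (ccot (slope x phi)) + psip (ccot (slope y phi)) + psip (ccot (slope z phi))))
    0 (2 * PI) =
  2 * PI * base0 + 2 * (cap_loss (slope_norm x) + cap_loss (slope_norm y) + cap_loss (slope_norm z)).
Proof.
  intros Hx Hy Hz.
  set (f := fun phi => psip (ccot (slope x phi))). set (g := fun phi => psip (ccot (slope y phi))).
  set (h := fun phi => psip (ccot (slope z phi))).
  assert (Hf : forall t, continuous f t) by (intros; apply cont_psip_slope).
  assert (Hg : forall t, continuous g t) by (intros; apply cont_psip_slope).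
  assert (Hh : forall t, continuous h t) by (intros; apply cont_psip_slope).
  assert (Hfg : forall t, continuous (fun t => f t + g t) t) by (intros; now apply cont_plus).
  assert (Hfgh : forall t, continuous (fun t => f t + g t + h t) t)
    by (intros; now apply (cont_plus (fun t => f t + g t))).
  rewrite (RInt_plusR (fun _ => base0) (fun t => f t + g t + h t))
    by (apply cont_ex_RInt; auto; intros; apply cont_const).
  rewrite (RInt_plusR (fun t => f t + g t) h), (RInt_plusR f g) by (apply cont_ex_RInt; auto).
  unfold f, g, h. rewrite !circle_cap_loss, RInt_constR by assumption. ringR.
Qed.

(** The maximal slope is one of the three. Its excess is at most its own positive part, and the
    other two positive parts are only added. *)
Lemma cell_int_le x y z : height x < 1 -> height y < 1 -> height z < 1 ->
  cell_int lam0 x y z <=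
  2 * PI * base0 + 2 * (cap_loss (slope_norm x) + cap_loss (slope_norm y) + cap_loss (slope_norm z)).
Proof.
  intros Hx Hy Hz. rewrite <- sum_psip_int by assumption.
  apply RInt_le; [generalize PI_RGT_0; lra | | |].
  - apply cont_ex_RInt; intros; apply cont_capint_slope.
  - apply cont_ex_RInt. intros t. apply (cont_plus (fun _ => base0)); [apply cont_const|].
    apply (cont_plus (fun t => _ + _)); [apply (cont_plus (fun t => _))|]; apply cont_psip_slope.
  - intros phi _. rewrite capint_psi. apply Rplus_le_compat_l.
    generalize (psip_pos (ccot (slope x phi))) (psip_pos (ccot (slope y phi))) (psip_pos (ccot (slope z phi))).
    assert (H : forall c, psi c <= psip c) by (intros; apply Rmax_r).
    generalize (H (ccot (slope x phi))) (H (ccot (slope y phi))) (H (ccot (slope z phi))).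
    unfold slope3, Rmax. repeat destruct (Rle_dec _ _); lra.
Qed.

(* In the regular configuration the maximal slope lies in [m_lo, m_hi] and the others below [m_lo]. *)
Lemma cell_int_regular x y z : height x < 1 -> height y < 1 -> height z < 1 ->
  (forall phi, slope x phi + slope y phi + slope z phi = 0) ->
  (forall phi, slope x phi * slope x phi + slope y phi * slope y phi + slope z phi * slope z phi = 3 / 4) ->
  cell_int lam0 x y z =
  2 * PI * base0 + 2 * (cap_loss (slope_norm x) + cap_loss (slope_norm y) + cap_loss (slope_norm z)).
Proof.
  intros Hx Hy Hz Hsum Hsq. rewrite <- sum_psip_int by assumption.
  apply RInt_ext. intros phi _. rewrite capint_psi. apply (f_equal (Rplus base0)).
  specialize (Hsum phi). specialize (Hsq phi).
  assert (H2 := sqrt2_pos). assert (Hs2 := sqrt2_sq). assert (Hlo := m_lo_pos). assert (Hhi := m_hi_gt).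
  assert (Hlo2 : 8 * (m_lo * m_lo) = 1).
  { unfold m_lo. transitivity (8 / (4 * (sqrt 2 * sqrt 2))); [field; lra | rewrite Hs2; field]. }
  assert (Hi : / sqrt 2 * / sqrt 2 = / 2) by (rewrite <- Rinv_mult, Hs2; reflexivity).
  assert (Hi0 : 0 < / sqrt 2) by now apply Rinv_0_lt_compat.
  unfold slope3. set (a := slope x phi) in *. set (b := slope y phi) in *. set (c := slope z phi) in *.
  assert (K : forall a b c, a + b + c = 0 -> a * a + b * b + c * c = 3 / 4 -> b <= a -> c <= a ->
     psi (ccot a) = psip (ccot a) /\ psip (ccot b) = 0 /\ psip (ccot c) = 0).
  { clear a b c Hsum Hsq. intros a b c Hsum Hsq Hb Hc.
    assert (Qb : a * a + a * b + b * b = 3 / 8) by (assert (c = - a - b) by lra; subst c; lra).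
    assert (Qc : a * a + a * c + c * c = 3 / 8) by (assert (b = - a - c) by lra; subst b; lra).
    assert (Ha0 : 0 <= a) by lra.
    (* Here b + 2 a = a - c, and the product equals 3 a^2 - 3/8, which gives the lower bound on a.
       The upper bound comes from 3/8 = (b + a/2)^2 + 3 a^2 / 4. *)
    assert (Hge : 0 <= (a - b) * (b + 2 * a)) by (apply Rmult_le_pos; lra).
    assert (Ha : m_lo <= a <= / sqrt 2).
    { split; apply Rsqr_incr_0; unfold Rsqr; try lra.
      generalize (Rle_0_sqr (b + a / 2)); unfold Rsqr; lra. }
    (* If d exceeded [m_lo], then so would a, and each of the three terms would exceed [m_lo]^2 =
       1/8. *)
    assert (K' : forall d, d <= a -> a * a + a * d + d * d = 3 / 8 -> d <= m_lo).
    { intros d Hd Hq. apply Rnot_lt_le; intros H.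
      assert (m_lo * m_lo < d * d) by nra. assert (m_lo * m_lo < a * a) by nra.
      assert (m_lo * m_lo < a * d) by nra. lra. }
    split; [symmetry; apply psip_mid; lra|].
    split; apply psip_out; left; now apply K'. }
  unfold Rmax. destruct (Rle_dec b c), (Rle_dec a _);
  match goal with
  | |- psi (ccot a) = _ => destruct (K a b c) as [E1 [E2 E3]]; lra
  | |- psi (ccot b) = _ => destruct (K b a c) as [E1 [E2 E3]]; lra
  | |- psi (ccot c) = _ => destruct (K c a b) as [E1 [E2 E3]]; lra
  end.
Qed.

(** * Simplices *)

(** The value at the regular tetrahedron; 24 counts four cells, three neighbours each and two
    half-turns. *)
Definition sint_opt : R := 4 * PI * lam0 + 8 * PI * base0 + 24 * cap_loss (/ sqrt 2).

Lemma lam0_bound : -1 <= lam0 <= 1.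
Proof. unfold lam0. generalize q0_gt q0_lt_1; lra. Qed.

(** For a unit vector of height h the squared amplitude is (1 + h) / (1 - h), which equals 1/2
    exactly at h = -1/3. *)
Lemma slope_norm_unit x : dot x x = 1 -> height x < 1 ->
  0 <= slope_norm x /\ (slope_norm x = / sqrt 2 <-> height x = - / 3).
Proof.
  destruct x as [[x1 x2] x3]; unfold slope_norm, height, dot; intros Hx H3.
  assert (H2 := sqrt2_pos). assert (Hs2 := sqrt2_sq).
  assert (Hnn : 0 <= x1 * x1 + x2 * x2) by nra.
  set (r := sqrt (x1 * x1 + x2 * x2)).
  assert (Hr : r * r = x1 * x1 + x2 * x2) by now apply sqrt_sqrt.
  assert (Hr0 : 0 <= r) by apply sqrt_pos.
  assert (Hi : 0 < / (1 - x3)) by (apply Rinv_0_lt_compat; lra).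
  split; [apply Rmult_le_pos; lra|]. split; intros H.
  - assert (E : r * sqrt 2 = 1 - x3).
    { apply Rmult_eq_reg_r with (/ (1 - x3) * / sqrt 2).
      - transitivity (r / (1 - x3)); [field; lra|]. rewrite H. field. lra.
      - apply Rgt_not_eq, Rmult_lt_0_compat; [assumption | now apply Rinv_0_lt_compat]. }
    assert (E2 : r * r * (sqrt 2 * sqrt 2) = (1 - x3) * (1 - x3)) by (rewrite <- E; ring).
    rewrite Hs2, Hr in E2.
    assert ((1 - x3) * (3 * x3 + 1) = 0) by nra.
    destruct (Rmult_integral _ _ H0); lra.
  - apply Rsqr_inj; [apply Rmult_le_pos; lra | left; now apply Rinv_0_lt_compat|].
    unfold Rsqr. replace (r / (1 - x3) * (r / (1 - x3))) with (r * r / ((1 - x3) * (1 - x3))) by (field; lra).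
    rewrite <- Rinv_mult, Hs2, Hr. replace (x1 * x1 + x2 * x2) with (1 - x3 * x3) by lra.
    rewrite H. field.
Qed.

Lemma cell_bound e x y z L : rotation L -> L e = (0, 0, 1) ->
  dot x x = 1 -> dot y y = 1 -> dot z z = 1 -> dot e x < 1 -> dot e y < 1 -> dot e z < 1 ->
  cell_int lam0 (L x) (L y) (L z) <= 2 * PI * base0 + 6 * cap_loss (/ sqrt 2) /\
  (cell_int lam0 (L x) (L y) (L z) = 2 * PI * base0 + 6 * cap_loss (/ sqrt 2) ->
    dot e x = - / 3 /\ dot e y = - / 3 /\ dot e z = - / 3).
Proof.
  intros HL He Ux Uy Uz Dx Dy Dz.
  rewrite <- (height_rotation L) in Dx, Dy, Dz by assumption.
  rewrite <- (proj1 HL) in Ux, Uy, Uz.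
  destruct (slope_norm_unit _ Ux Dx) as [Nx Ex]. destruct (slope_norm_unit _ Uy Dy) as [Ny Ey].
  destruct (slope_norm_unit _ Uz Dz) as [Nz Ez].
  rewrite <- !(height_rotation L e) by assumption.
  assert (H := cell_int_le _ _ _ Dx Dy Dz).
  assert (Cx := cap_loss_le _ Nx). assert (Cy := cap_loss_le _ Ny). assert (Cz := cap_loss_le _ Nz).
  split; [lra|]. intros E.
  assert (K : forall k, 0 <= k -> cap_loss k = cap_loss (/ sqrt 2) -> k = / sqrt 2).
  { intros k Hk Ek. destruct (Req_dec k (/ sqrt 2)) as [->|Hne]; [reflexivity|].
    generalize (cap_loss_lt k Hk Hne). lra. }
  repeat split; [apply Ex | apply Ey | apply Ez]; apply K; auto; lra.
Qed.

Lemma inscribed_le x0 x1 x2 x3 :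
  dot x0 x0 = 1 -> dot x1 x1 = 1 -> dot x2 x2 = 1 -> dot x3 x3 = 1 ->
  dot x0 x1 < 1 -> dot x0 x2 < 1 -> dot x0 x3 < 1 -> dot x1 x2 < 1 -> dot x1 x3 < 1 -> dot x2 x3 < 1 ->
  sint (hmax x0 x1 x2 x3) <= sint_opt /\
  (sint (hmax x0 x1 x2 x3) = sint_opt ->
   dot x0 x1 = - / 3 /\ dot x0 x2 = - / 3 /\ dot x0 x3 = - / 3 /\
   dot x1 x2 = - / 3 /\ dot x1 x3 = - / 3 /\ dot x2 x3 = - / 3).
Proof.
  intros U0 U1 U2 U3 D01 D02 D03 D12 D13 D23.
  destruct (rotation_to_pole x0 U0) as [L0 [R0 P0]]. destruct (rotation_to_pole x1 U1) as [L1 [R1 P1]].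
  destruct (rotation_to_pole x2 U2) as [L2 [R2 P2]]. destruct (rotation_to_pole x3 U3) as [L3 [R3 P3]].
  rewrite (cell_formula lam0 x0 x1 x2 x3 lam0_bound U0 U1 U2 U3 D01 D02 D03 D12 D13 D23
    L0 L1 L2 L3 R0 R1 R2 R3 P0 P1 P2 P3).
  destruct (cell_bound x0 x1 x2 x3 L0) as [B0 E0]; auto.
  destruct (cell_bound x1 x0 x2 x3 L1) as [B1 E1]; auto; try (now rewrite dot_comm).
  destruct (cell_bound x2 x0 x1 x3 L2) as [B2 E2]; auto; try (now rewrite dot_comm).
  destruct (cell_bound x3 x0 x1 x2 L3) as [B3 _]; auto; try (now rewrite dot_comm).
  (* The four cell bounds add up to the optimum, so equality of the sum forces equality in every
     cell. *)
  unfold sint_opt. split; [lra|]. intros E.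
  destruct E0 as [? [? ?]]; [lra|]. destruct E1 as [? [? ?]]; [lra|]. destruct E2 as [? [? ?]]; [lra|].
  tauto.
Qed.

(** The horizontal parts of x, y, z form an equilateral triangle centred at 0: they sum to zero and
    are a tight frame of the plane with constant 4/3. Dividing by the square of 1 - h = 4/3 turns
    this constant into 3/4. *)
Lemma slopes_regular x y z : dot x x = 1 -> dot y y = 1 -> dot z z = 1 ->
  dot x y = - / 3 -> dot x z = - / 3 -> dot y z = - / 3 ->
  height x = - / 3 -> height y = - / 3 -> height z = - / 3 -> forall phi,
  slope x phi + slope y phi + slope z phi = 0 /\
  slope x phi * slope x phi + slope y phi * slope y phi + slope z phi * slope z phi = 3 / 4.
Proof.
  destruct x as [[a1 a2] a3], y as [[b1 b2] b3], z as [[c1 c2] c3]; unfold dot, height, slope.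
  intros Ha Hb Hc Hab Hac Hbc -> -> -> phi.
  replace (- / 3 * - / 3) with (1 / 9) in * by field. replace (1 - - / 3) with (4 / 3) by field.
  (* The squared norm of the sum of the horizontal parts, computed from the Gram matrix. *)
  assert (S : (a1 + b1 + c1) * (a1 + b1 + c1) + (a2 + b2 + c2) * (a2 + b2 + c2) = 0).
  { transitivity ((a1 * a1 + a2 * a2 + 1 / 9) + (b1 * b1 + b2 * b2 + 1 / 9) + (c1 * c1 + c2 * c2 + 1 / 9) +
      2 * ((a1 * b1 + a2 * b2 + 1 / 9) + (a1 * c1 + a2 * c2 + 1 / 9) + (b1 * c1 + b2 * c2 + 1 / 9)) - 1);
      [field | rewrite Ha, Hb, Hc, Hab, Hac, Hbc; field]. }
  assert (N : forall u v : R, u * u + v * v = 0 -> u = 0 /\ v = 0) by (intros; split; nra).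
  destruct (N _ _ S) as [S1 S2].
  assert (Ec1 : c1 = - a1 - b1) by lra. assert (Ec2 : c2 = - a2 - b2) by lra. subst c1 c2.
  assert (Qa : a1 * a1 + a2 * a2 = 8 / 9) by lra. assert (Qb : b1 * b1 + b2 * b2 = 8 / 9) by lra.
  assert (Qab : a1 * b1 + a2 * b2 = - 4 / 9) by lra.
  set (d := a1 * b2 - a2 * b1).
  assert (Hd : d <> 0).
  { assert (d * d = 48 / 81); [|nra]. unfold d.
    replace ((a1 * b2 - a2 * b1) * (a1 * b2 - a2 * b1)) with
      ((a1 * a1 + a2 * a2) * (b1 * b1 + b2 * b2) - (a1 * b1 + a2 * b2) * (a1 * b1 + a2 * b2)) by ring.
    rewrite Qa, Qb, Qab. field. }
  (* The entries of the frame operator are 2P, 2R and T. By the Gram relations it multiplies the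
     horizontal vectors a and b by 4/3; they form a basis since d is nonzero, and Cramer's rule
     yields the entries. *)
  set (P := a1 * a1 + b1 * b1 + a1 * b1). set (R := a2 * a2 + b2 * b2 + a2 * b2).
  set (T := 2 * (a1 * a2 + b1 * b2) + a1 * b2 + a2 * b1).
  assert (EP : d * (2 * P - 4 / 3) = 0).
  { transitivity (b2 * (a1 * (2 * (a1 * a1 + a2 * a2) + (a1 * b1 + a2 * b2))
        + b1 * (2 * (a1 * b1 + a2 * b2) + (a1 * a1 + a2 * a2)))
      - a2 * (a1 * (2 * (a1 * b1 + a2 * b2) + (b1 * b1 + b2 * b2))
        + b1 * (2 * (b1 * b1 + b2 * b2) + (a1 * b1 + a2 * b2))) - 4 / 3 * (a1 * b2 - a2 * b1)).
    - unfold d, P. ring.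
    - rewrite Qa, Qb, Qab. field. }
  assert (ET : d * T = 0).
  { transitivity (a1 * (a1 * (2 * (a1 * b1 + a2 * b2) + (b1 * b1 + b2 * b2))
        + b1 * (2 * (b1 * b1 + b2 * b2) + (a1 * b1 + a2 * b2)))
      - b1 * (a1 * (2 * (a1 * a1 + a2 * a2) + (a1 * b1 + a2 * b2))
        + b1 * (2 * (a1 * b1 + a2 * b2) + (a1 * a1 + a2 * a2)))).
    - unfold d, T. ring.
    - rewrite Qa, Qb, Qab. field. }
  assert (HP : P = 2 / 3) by (destruct (Rmult_integral _ _ EP); [contradiction|lra]).
  assert (HT : T = 0) by (destruct (Rmult_integral _ _ ET); [contradiction|assumption]).
  assert (HR : R = 2 / 3) by (unfold P, R in *; lra).
  assert (Hsc := sin2_cos2 phi). unfold Rsqr in Hsc.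
  split; [field|].
  transitivity (9 / 8 * (P * (cos phi * cos phi) + R * (sin phi * sin phi) + T * (cos phi * sin phi))).
  - unfold P, R, T. field.
  - rewrite HP, HR, HT. replace (cos phi * cos phi) with (1 - sin phi * sin phi) by lra. field.
Qed.

Lemma cell_regular e x y z L : rotation L -> L e = (0, 0, 1) ->
  dot x x = 1 -> dot y y = 1 -> dot z z = 1 ->
  dot e x = - / 3 -> dot e y = - / 3 -> dot e z = - / 3 ->
  dot x y = - / 3 -> dot x z = - / 3 -> dot y z = - / 3 ->
  cell_int lam0 (L x) (L y) (L z) = 2 * PI * base0 + 6 * cap_loss (/ sqrt 2).
Proof.
  intros HL He Ux Uy Uz Ex Ey Ez Exy Exz Eyz.
  rewrite <- (height_rotation L) in Ex, Ey, Ez by assumption.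
  rewrite <- (proj1 HL) in Ux, Uy, Uz, Exy, Exz, Eyz.
  assert (S := slopes_regular _ _ _ Ux Uy Uz Exy Exz Eyz Ex Ey Ez).
  rewrite cell_int_regular; try lra; try (intros; apply S).
  rewrite (proj2 (proj2 (slope_norm_unit _ Ux ltac:(lra))) Ex).
  rewrite (proj2 (proj2 (slope_norm_unit _ Uy ltac:(lra))) Ey).
  rewrite (proj2 (proj2 (slope_norm_unit _ Uz ltac:(lra))) Ez). ring.
Qed.

Lemma sint_regular x0 x1 x2 x3 :
  dot x0 x0 = 1 -> dot x1 x1 = 1 -> dot x2 x2 = 1 -> dot x3 x3 = 1 ->
  dot x0 x1 = - / 3 -> dot x0 x2 = - / 3 -> dot x0 x3 = - / 3 ->
  dot x1 x2 = - / 3 -> dot x1 x3 = - / 3 -> dot x2 x3 = - / 3 ->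
  sint (hmax x0 x1 x2 x3) = sint_opt.
Proof.
  intros U0 U1 U2 U3 E01 E02 E03 E12 E13 E23.
  destruct (rotation_to_pole x0 U0) as [L0 [R0 P0]]. destruct (rotation_to_pole x1 U1) as [L1 [R1 P1]].
  destruct (rotation_to_pole x2 U2) as [L2 [R2 P2]]. destruct (rotation_to_pole x3 U3) as [L3 [R3 P3]].
  rewrite (cell_formula lam0 x0 x1 x2 x3 lam0_bound U0 U1 U2 U3) with (L0 := L0) (L1 := L1) (L2 := L2) (L3 := L3)
    by (assumption || lra).
  rewrite (cell_regular x0 x1 x2 x3 L0) by auto.
  rewrite (cell_regular x1 x0 x2 x3 L1) by (auto; now rewrite dot_comm).
  rewrite (cell_regular x2 x0 x1 x3 L2) by (auto; now rewrite dot_comm).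
  rewrite (cell_regular x3 x0 x1 x2 L3) by (auto; now rewrite dot_comm).
  unfold sint_opt. ring.
Qed.

(** * Pushing the vertices to the sphere *)

Lemma hmax_cycle x0 x1 x2 x3 u : hmax x1 x2 x3 x0 u = hmax x0 x1 x2 x3 u.
Proof. unfold hmax, Rmax. repeat destruct (Rle_dec _ _); lra. Qed.

Lemma hmax_swap x0 x1 x2 x3 u : hmax x0 x2 x1 x3 u = hmax x0 x1 x2 x3 u.
Proof. unfold hmax, Rmax. repeat destruct (Rle_dec _ _); lra. Qed.

Definition comb (a0 a1 a2 a3 : R) (p0 p1 p2 p3 : R3) : R3 :=
  vadd (vadd (vscale a0 p0) (vscale a1 p1)) (vadd (vscale a2 p2) (vscale a3 p3)).

Ltac vec := unfold comb, vsub, vadd, vscale, vzero; apply vec_ext; ring.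

Lemma aff_indep4_cycle p0 p1 p2 p3 : aff_indep4 p0 p1 p2 p3 -> aff_indep4 p1 p2 p3 p0.
Proof.
  intros H a0 a1 a2 a3 Hs Hv. destruct (H a3 a0 a1 a2) as [? [? [? ?]]]; [lra | | tauto].
  rewrite <- Hv. destruct p0 as [[? ?] ?], p1 as [[? ?] ?], p2 as [[? ?] ?], p3 as [[? ?] ?]. vec.
Qed.

Lemma aff_indep4_swap p0 p1 p2 p3 : aff_indep4 p0 p1 p2 p3 -> aff_indep4 p0 p2 p1 p3.
Proof.
  intros H a0 a1 a2 a3 Hs Hv. destruct (H a0 a2 a1 a3) as [? [? [? ?]]]; [lra | | tauto].
  rewrite <- Hv. destruct p0 as [[? ?] ?], p1 as [[? ?] ?], p2 as [[? ?] ?], p3 as [[? ?] ?]. vec.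
Qed.

Lemma dot_eq_0 x : dot x x <= 0 -> x = vzero.
Proof. destruct x as [[a b] c]; unfold dot, vzero; intros H. apply vec_ext; nra. Qed.

Lemma aff_indep4_neq p0 p1 p2 p3 : aff_indep4 p0 p1 p2 p3 -> vsub p0 p1 <> vzero.
Proof.
  intros H E. destruct (H 1 (-1) 0 0) as [E1 _]; [lra | | lra].
  rewrite <- E. destruct p0 as [[? ?] ?], p1 as [[? ?] ?], p2 as [[? ?] ?], p3 as [[? ?] ?]. vec.
Qed.

Lemma aff_indep4_dot_lt p0 p1 p2 p3 : aff_indep4 p0 p1 p2 p3 -> dot p0 p0 = 1 -> dot p1 p1 = 1 ->
  dot p0 p1 < 1.
Proof.
  intros H U0 U1. apply Rnot_le_lt. intros Hd. apply (aff_indep4_neq _ _ _ _ H), dot_eq_0.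
  rewrite <- dot_vsub, (dot_comm p0), (dot_comm p1), <- !dot_vsub, (dot_comm p1 p0). lra.
Qed.

Definition push (t : R) (p0 p1 : R3) : R3 := vadd p0 (vscale t (vsub p0 p1)).

Lemma dot_push t p0 p1 u : dot (push t p0 p1) u = dot p0 u + t * (dot p0 u - dot p1 u).
Proof.
  destruct p0 as [[? ?] ?], p1 as [[? ?] ?], u as [[? ?] ?].
  unfold push, vsub, vadd, vscale, dot. ring.
Qed.

Lemma aff_indep4_push t p0 p1 p2 p3 : 0 <= t -> aff_indep4 p0 p1 p2 p3 -> aff_indep4 (push t p0 p1) p1 p2 p3.
Proof.
  intros Ht H a0 a1 a2 a3 Hs Hv. destruct (H (a0 * (1 + t)) (a1 - a0 * t) a2 a3) as [E0 [E1 [? ?]]]; [lra| |].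
  - rewrite <- Hv. unfold push.
    destruct p0 as [[? ?] ?], p1 as [[? ?] ?], p2 as [[? ?] ?], p3 as [[? ?] ?]. vec.
  - destruct (Rmult_integral _ _ E0) as [Z|Z]; [|lra]. subst a0. split; [reflexivity|]. split; lra.
Qed.

(** The old vertex lies on the segment from [p1] to the new one, so the tetrahedron only grows and
    its support function cannot decrease. *)
Lemma push_to_sphere p0 p1 p2 p3 : aff_indep4 p0 p1 p2 p3 -> unit_ball p0 ->
  exists t, 0 <= t /\ dot (push t p0 p1) (push t p0 p1) = 1 /\ aff_indep4 (push t p0 p1) p1 p2 p3 /\
    forall u, hmax p0 p1 p2 p3 u <= hmax (push t p0 p1) p1 p2 p3 u.
Proof.
  intros H U. unfold unit_ball in U. set (d := vsub p0 p1).
  assert (Ha : 0 < dot d d).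
  { apply Rnot_le_lt. intros Hd. apply (aff_indep4_neq _ _ _ _ H). now apply dot_eq_0. }
  set (a := dot d d) in *. set (b := dot p0 d). set (c := dot p0 p0) in *.
  assert (Hdisc : 0 <= b * b + a * (1 - c)) by nra.
  set (w := sqrt (b * b + a * (1 - c))).
  assert (Hw : w * w = b * b + a * (1 - c)) by now apply sqrt_sqrt.
  assert (Hw0 : 0 <= w) by apply sqrt_pos.
  assert (Hbw : b <= w) by (apply Rnot_lt_le; intros Hl; nra).
  (* The nonnegative root of a t^2 + 2 b t + c = 1, the condition that p0 + t d has norm 1. *)
  set (t := (w - b) / a).
  assert (Ht : 0 <= t) by (apply Rmult_le_pos; [lra | left; now apply Rinv_0_lt_compat]).
  exists t. split; [assumption|]. split; [|split].
  - transitivity (a * (t * t) + 2 * b * t + c).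
    + unfold a, b, c, push, d. destruct p0 as [[? ?] ?], p1 as [[? ?] ?].
      unfold vsub, vadd, vscale, dot. ring.
    + unfold t. replace (a * ((w - b) / a * ((w - b) / a)) + 2 * b * ((w - b) / a) + c)
        with ((w * w - b * b) / a + c) by (field; lra). rewrite Hw. field. lra.
  - now apply aff_indep4_push.
  - intros u. unfold hmax. rewrite dot_push.
    set (x := dot p0 u). set (y := dot p1 u). set (z := Rmax (dot p2 u) (dot p3 u)).
    apply Rmax_lub; [|apply Rmax_r]. eapply Rle_trans; [|apply Rmax_l].
    destruct (Rle_dec x y).
    + apply Rmax_lub; [eapply Rle_trans; [eassumption|]|]; apply Rmax_r.
    + apply Rmax_lub; [|apply Rmax_r]. eapply Rle_trans; [|apply Rmax_l].
      assert (0 <= t * (x - y)) by (apply Rmult_le_pos; lra). lra.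
Qed.

(** The vertex [p0] stays in place, so that it can afterwards be pushed in different directions over
    the same opposite face. *)
Lemma push_others p0 p1 p2 p3 : aff_indep4 p0 p1 p2 p3 -> unit_ball p1 -> unit_ball p2 -> unit_ball p3 ->
  exists q1 q2 q3, dot q1 q1 = 1 /\ dot q2 q2 = 1 /\ dot q3 q3 = 1 /\ aff_indep4 p0 q1 q2 q3 /\
    forall u, hmax p0 p1 p2 p3 u <= hmax p0 q1 q2 q3 u.
Proof.
  intros H U1 U2 U3.
  apply aff_indep4_cycle in H. destruct (push_to_sphere _ _ _ _ H U1) as [t1 [_ [V1 [H1 M1]]]].
  set (q1 := push t1 p1 p2) in *.
  apply aff_indep4_cycle in H1. destruct (push_to_sphere _ _ _ _ H1 U2) as [t2 [_ [V2 [H2 M2]]]].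
  set (q2 := push t2 p2 p3) in *.
  apply aff_indep4_cycle in H2. destruct (push_to_sphere _ _ _ _ H2 U3) as [t3 [_ [V3 [H3 M3]]]].
  set (q3 := push t3 p3 p0) in *.
  apply aff_indep4_cycle in H3.
  exists q1, q2, q3. repeat (split; [assumption|]). intros u.
  specialize (M1 u). specialize (M2 u). specialize (M3 u).
  rewrite hmax_cycle in M1. rewrite (hmax_cycle q1 p2 p3 p0), (hmax_cycle q1 q2 p3 p0) in M2.
  rewrite (hmax_cycle q2 p3 p0 q1), (hmax_cycle q1 q2 p3 p0), (hmax_cycle q2 q3 p0 q1),
    (hmax_cycle q1 q2 q3 p0), (hmax_cycle p0 q1 q2 q3) in M3. lra.
Qed.

Lemma inscribed_simplex_le p0 p1 p2 p3 : aff_indep4 p0 p1 p2 p3 ->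
  dot p0 p0 = 1 -> dot p1 p1 = 1 -> dot p2 p2 = 1 -> dot p3 p3 = 1 ->
  sint (hmax p0 p1 p2 p3) <= sint_opt /\
  (sint (hmax p0 p1 p2 p3) = sint_opt ->
   dot p0 p1 = - / 3 /\ dot p0 p2 = - / 3 /\ dot p0 p3 = - / 3 /\
   dot p1 p2 = - / 3 /\ dot p1 p3 = - / 3 /\ dot p2 p3 = - / 3).
Proof.
  intros H U0 U1 U2 U3.
  assert (Hc := aff_indep4_cycle _ _ _ _ H). assert (Hcc := aff_indep4_cycle _ _ _ _ Hc).
  assert (Hccc := aff_indep4_cycle _ _ _ _ Hcc).
  apply inscribed_le; auto.
  - now apply (aff_indep4_dot_lt _ _ _ _ H).
  - now apply (aff_indep4_dot_lt _ _ _ _ (aff_indep4_swap _ _ _ _ H)).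
  - rewrite dot_comm. now apply (aff_indep4_dot_lt _ _ _ _ Hccc).
  - now apply (aff_indep4_dot_lt _ _ _ _ Hc).
  - now apply (aff_indep4_dot_lt _ _ _ _ (aff_indep4_swap _ _ _ _ Hc)).
  - now apply (aff_indep4_dot_lt _ _ _ _ Hcc).
Qed.

Lemma simplex_le p0 p1 p2 p3 : aff_indep4 p0 p1 p2 p3 ->
  unit_ball p0 -> unit_ball p1 -> unit_ball p2 -> unit_ball p3 ->
  sint (hmax p0 p1 p2 p3) <= sint_opt.
Proof.
  intros H U0 U1 U2 U3.
  destruct (push_others _ _ _ _ H U1 U2 U3) as [q1 [q2 [q3 [V1 [V2 [V3 [Hq M]]]]]]].
  destruct (push_to_sphere _ _ _ _ Hq U0) as [t [_ [V0 [Ht M']]]].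
  apply Rle_trans with (sint (hmax (push t p0 q1) q1 q2 q3)); [|now apply inscribed_simplex_le].
  apply sint_le; try apply nice_hmax. intros u _. now apply Rle_trans with (hmax p0 q1 q2 q3 u).
Qed.

(** The Gram matrix gives |p0 + p1 + p2 + p3|^2 = 4 - 12/3 = 0. *)
Lemma regular_sum p0 p1 p2 p3 :
  dot p0 p0 = 1 -> dot p1 p1 = 1 -> dot p2 p2 = 1 -> dot p3 p3 = 1 ->
  dot p0 p1 = - / 3 /\ dot p0 p2 = - / 3 /\ dot p0 p3 = - / 3 /\
  dot p1 p2 = - / 3 /\ dot p1 p3 = - / 3 /\ dot p2 p3 = - / 3 ->
  p0 = comb 0 (-1) (-1) (-1) p0 p1 p2 p3.
Proof.
  intros U0 U1 U2 U3 [E01 [E02 [E03 [E12 [E13 E23]]]]].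
  assert (Z : comb 1 1 1 1 p0 p1 p2 p3 = vzero).
  { apply dot_eq_0. right.
    transitivity (dot p0 p0 + dot p1 p1 + dot p2 p2 + dot p3 p3 +
      2 * (dot p0 p1 + dot p0 p2 + dot p0 p3 + dot p1 p2 + dot p1 p3 + dot p2 p3)); [|lra].
    destruct p0 as [[? ?] ?], p1 as [[? ?] ?], p2 as [[? ?] ?], p3 as [[? ?] ?].
    unfold comb, vadd, vscale, dot. ring. }
  destruct p0 as [[? ?] ?], p1 as [[? ?] ?], p2 as [[? ?] ?], p3 as [[? ?] ?].
  unfold comb, vadd, vscale, vzero in *. injection Z; intros. apply vec_ext; lra.
Qed.

(* If [p0] were interior, moving it to the sphere away from [q1] and away from [q2] would
   both produce a regular tetrahedron over [q1 q2 q3], hence the same apex. *)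
Lemma optimal_on_sphere p0 p1 p2 p3 : aff_indep4 p0 p1 p2 p3 ->
  unit_ball p0 -> unit_ball p1 -> unit_ball p2 -> unit_ball p3 ->
  sint (hmax p0 p1 p2 p3) = sint_opt -> dot p0 p0 = 1.
Proof.
  intros H U0 U1 U2 U3 E.
  destruct (push_others _ _ _ _ H U1 U2 U3) as [q1 [q2 [q3 [V1 [V2 [V3 [Hq M]]]]]]].
  destruct (push_to_sphere _ _ _ _ Hq U0) as [t [Ht [Vt [At Mt]]]].
  destruct (push_to_sphere _ _ _ _ (aff_indep4_swap _ _ _ _ Hq) U0) as [s [Hs [Vs [As Ms]]]].
  destruct (inscribed_simplex_le _ _ _ _ At Vt V1 V2 V3) as [Lt Et].
  destruct (inscribed_simplex_le _ _ _ _ As Vs V2 V1 V3) as [Ls Es].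
  assert (Gt : sint (hmax p0 p1 p2 p3) <= sint (hmax (push t p0 q1) q1 q2 q3)).
  { apply sint_le; try apply nice_hmax. intros u _. now apply Rle_trans with (hmax p0 q1 q2 q3 u). }
  assert (Gs : sint (hmax p0 p1 p2 p3) <= sint (hmax (push s p0 q2) q2 q1 q3)).
  { apply sint_le; try apply nice_hmax. intros u _. apply Rle_trans with (hmax p0 q1 q2 q3 u); [auto|].
    rewrite <- hmax_swap. apply Ms. }
  assert (St := regular_sum _ _ _ _ Vt V1 V2 V3 (Et ltac:(lra))).
  assert (Ss := regular_sum _ _ _ _ Vs V2 V1 V3 (Es ltac:(lra))).
  assert (EE : push t p0 q1 = push s p0 q2).
  { rewrite St, Ss. destruct (push t p0 q1) as [[? ?] ?], (push s p0 q2) as [[? ?] ?].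
    destruct q1 as [[? ?] ?], q2 as [[? ?] ?], q3 as [[? ?] ?]. vec. }
  (* Equal apexes mean t (p0 - q1) = s (p0 - q2), an affine relation among independent points; hence
     t = 0 and [p0] was on the sphere already. *)
  assert (Z : comb (t - s) (- t) s 0 p0 q1 q2 q3 = vzero).
  { revert EE. unfold push. destruct p0 as [[? ?] ?], q1 as [[? ?] ?], q2 as [[? ?] ?], q3 as [[? ?] ?].
    unfold comb, vsub, vadd, vscale, vzero. intros EE. injection EE; intros. apply vec_ext; lra. }
  destruct (Hq (t - s) (- t) s 0 ltac:(lra) Z) as [_ [Z1 _]]. assert (t = 0) by lra. subst t.
  rewrite <- Vt at 1. unfold push. destruct p0 as [[? ?] ?], q1 as [[? ?] ?].
  unfold vsub, vadd, vscale, dot. ring.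
Qed.

(** * Mean width through the support function of the vertices *)

Lemma support_conv4 K p0 p1 p2 p3 u : (forall x, K x <-> conv4 p0 p1 p2 p3 x) ->
  support K u = hmax p0 p1 p2 p3 u.
Proof.
  intros HK. unfold support.
  rewrite (is_lub_Rbar_unique _ (Finite (hmax p0 p1 p2 p3 u))); [reflexivity|].
  assert (Hd : forall a0 a1 a2 a3, dot u (comb a0 a1 a2 a3 p0 p1 p2 p3) =
    a0 * dot p0 u + a1 * dot p1 u + a2 * dot p2 u + a3 * dot p3 u).
  { intros. destruct p0 as [[? ?] ?], p1 as [[? ?] ?], p2 as [[? ?] ?], p3 as [[? ?] ?], u as [[? ?] ?].
    unfold comb, vadd, vscale, dot. ring. }
  split.
  - intros r [x [Hx ->]]. apply HK in Hx. destruct Hx as [a0 [a1 [a2 [a3 [H0 [H1 [H2 [H3 [Hs ->]]]]]]]]].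
    fold (comb a0 a1 a2 a3 p0 p1 p2 p3). rewrite Hd. simpl. unfold hmax.
    set (x0 := dot p0 u). set (x1 := dot p1 u). set (x2 := dot p2 u). set (x3 := dot p3 u).
    set (m := Rmax (Rmax x0 x1) (Rmax x2 x3)).
    assert (x0 <= m /\ x1 <= m /\ x2 <= m /\ x3 <= m).
    { unfold m. generalize (Rmax_l (Rmax x0 x1) (Rmax x2 x3)) (Rmax_r (Rmax x0 x1) (Rmax x2 x3))
        (Rmax_l x0 x1) (Rmax_r x0 x1) (Rmax_l x2 x3) (Rmax_r x2 x3). lra. }
    replace m with ((a0 + a1 + a2 + a3) * m) by (rewrite Hs; ring).
    rewrite !Rmult_plus_distr_r. repeat apply Rplus_le_compat; apply Rmult_le_compat_l; tauto.
  - intros b Hb.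
    assert (Hv : forall a0 a1 a2 a3, 0 <= a0 -> 0 <= a1 -> 0 <= a2 -> 0 <= a3 -> a0 + a1 + a2 + a3 = 1 ->
      Rbar_le (Finite (a0 * dot p0 u + a1 * dot p1 u + a2 * dot p2 u + a3 * dot p3 u)) b).
    { intros. apply Hb. exists (comb a0 a1 a2 a3 p0 p1 p2 p3). rewrite Hd. split; [|reflexivity].
      apply HK. exists a0, a1, a2, a3. auto 7. }
    generalize (Hv 1 0 0 0) (Hv 0 1 0 0) (Hv 0 0 1 0) (Hv 0 0 0 1).
    rewrite !Rmult_0_l, !Rmult_1_l, !Rplus_0_l, !Rplus_0_r. intros B0 B1 B2 B3.
    unfold hmax, Rmax. repeat destruct (Rle_dec _ _); auto with real.
Qed.

Lemma mean_width_conv4 K p0 p1 p2 p3 : (forall x, K x <-> conv4 p0 p1 p2 p3 x) ->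
  mean_width K = / (2 * PI) * sint (hmax p0 p1 p2 p3).
Proof.
  intros HK. unfold mean_width. rewrite sphere_avg_sint.
  rewrite (sint_ext (support K) (hmax p0 p1 p2 p3)) by (intros; now apply support_conv4).
  field. apply PI_neq0.
Qed.

(** * The regular tetrahedron and the isometry onto a maximizer *)

Definition reg0 : R3 := (/ sqrt 3, / sqrt 3, / sqrt 3).
Definition reg1 : R3 := (/ sqrt 3, - / sqrt 3, - / sqrt 3).
Definition reg2 : R3 := (- / sqrt 3, / sqrt 3, - / sqrt 3).
Definition reg3 : R3 := (- / sqrt 3, - / sqrt 3, / sqrt 3).

Lemma inv_sqrt3_sq : / sqrt 3 * / sqrt 3 = / 3.
Proof. rewrite <- Rinv_mult, sqrt_sqrt; lra. Qed.

Lemma reg_gram :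
  (dot reg0 reg0 = 1 /\ dot reg1 reg1 = 1 /\ dot reg2 reg2 = 1 /\ dot reg3 reg3 = 1) /\
  (dot reg0 reg1 = - / 3 /\ dot reg0 reg2 = - / 3 /\ dot reg0 reg3 = - / 3 /\
   dot reg1 reg2 = - / 3 /\ dot reg1 reg3 = - / 3 /\ dot reg2 reg3 = - / 3).
Proof.
  assert (H := inv_sqrt3_sq). unfold dot, reg0, reg1, reg2, reg3. repeat split; lra.
Qed.

Lemma reg_aff_indep : aff_indep4 reg0 reg1 reg2 reg3.
Proof.
  intros a0 a1 a2 a3 Hs Hv. unfold reg0, reg1, reg2, reg3, vadd, vscale, vzero in Hv.
  assert (Hi : / sqrt 3 <> 0) by (apply Rinv_neq_0_compat, Rgt_not_eq, sqrt_lt_R0; lra).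
  set (s := / sqrt 3) in *. injection Hv; intros H3 H2 H1.
  (* Together with the three coordinate equations this is a Hadamard system of signs, whose signed
     sums isolate each coefficient. *)
  assert (Hs' : s * (a0 + a1 + a2 + a3) = 0) by (rewrite Hs; ring).
  assert (s * a0 = 0) by lra. assert (s * a1 = 0) by lra. assert (s * a2 = 0) by lra.
  assert (s * a3 = 0) by lra.
  repeat split; match goal with H : s * ?a = 0 |- ?a = 0 => destruct (Rmult_integral _ _ H); tauto end.
Qed.

Lemma mean_width_reg_tet : mean_width reg_tet = / (2 * PI) * sint_opt.
Proof.
  rewrite (mean_width_conv4 reg_tet reg0 reg1 reg2 reg3) by reflexivity.
  destruct reg_gram as [[? [? [? ?]]] [? [? [? [? [? ?]]]]]]. now rewrite sint_regular.
Qed.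

Lemma dot_comb a0 a1 a2 a3 p0 p1 p2 p3 :
  dot p0 p0 = 1 -> dot p1 p1 = 1 -> dot p2 p2 = 1 -> dot p3 p3 = 1 ->
  dot p0 p1 = - / 3 /\ dot p0 p2 = - / 3 /\ dot p0 p3 = - / 3 /\
  dot p1 p2 = - / 3 /\ dot p1 p3 = - / 3 /\ dot p2 p3 = - / 3 ->
  dot (comb a0 a1 a2 a3 p0 p1 p2 p3) (comb a0 a1 a2 a3 p0 p1 p2 p3) =
  a0 * a0 + a1 * a1 + a2 * a2 + a3 * a3 -
    2 / 3 * (a0 * a1 + a0 * a2 + a0 * a3 + a1 * a2 + a1 * a3 + a2 * a3).
Proof.
  intros U0 U1 U2 U3 [E01 [E02 [E03 [E12 [E13 E23]]]]].
  transitivity (a0 * a0 * dot p0 p0 + a1 * a1 * dot p1 p1 + a2 * a2 * dot p2 p2 + a3 * a3 * dot p3 p3 +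
    2 * (a0 * a1 * dot p0 p1 + a0 * a2 * dot p0 p2 + a0 * a3 * dot p0 p3 + a1 * a2 * dot p1 p2
      + a1 * a3 * dot p1 p3 + a2 * a3 * dot p2 p3)).
  - destruct p0 as [[? ?] ?], p1 as [[? ?] ?], p2 as [[? ?] ?], p3 as [[? ?] ?].
    unfold comb, vadd, vscale, dot. ring.
  - rewrite U0, U1, U2, U3, E01, E02, E03, E12, E13, E23. field.
Qed.

Lemma reg_tet_ball x : reg_tet x -> unit_ball x.
Proof.
  intros [a0 [a1 [a2 [a3 [H0 [H1 [H2 [H3 [Hs ->]]]]]]]]].
  change (dot (comb a0 a1 a2 a3 reg0 reg1 reg2 reg3) (comb a0 a1 a2 a3 reg0 reg1 reg2 reg3) <= 1).
  destruct reg_gram as [[? [? [? ?]]] ?]. rewrite dot_comb by assumption.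
  (* After this the two sides differ by 8/3 times the sum of the products a_i a_j over i < j. *)
  replace 1 with ((a0 + a1 + a2 + a3) * (a0 + a1 + a2 + a3)) by (rewrite Hs; ring).
  assert (0 <= a0 * a1) by now apply Rmult_le_pos. assert (0 <= a0 * a2) by now apply Rmult_le_pos.
  assert (0 <= a0 * a3) by now apply Rmult_le_pos. assert (0 <= a1 * a2) by now apply Rmult_le_pos.
  assert (0 <= a1 * a3) by now apply Rmult_le_pos. assert (0 <= a2 * a3) by now apply Rmult_le_pos.
  lra.
Qed.

(* The linear map sending [reg_i] to [p_i]: the [reg_i] form a tight frame with constant 4/3. *)
Definition reg_map (p0 p1 p2 p3 u : R3) : R3 :=
  comb (3 / 4 * dot u reg0) (3 / 4 * dot u reg1) (3 / 4 * dot u reg2) (3 / 4 * dot u reg3) p0 p1 p2 p3.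

(** The frame coefficients of the combination are a_i minus the common quantity (a0 + a1 + a2 + a3)
    / 4, and this common part disappears because the p_i sum to zero. *)
Lemma reg_map_comb a0 a1 a2 a3 p0 p1 p2 p3 :
  comb 1 1 1 1 p0 p1 p2 p3 = vzero ->
  reg_map p0 p1 p2 p3 (comb a0 a1 a2 a3 reg0 reg1 reg2 reg3) = comb a0 a1 a2 a3 p0 p1 p2 p3.
Proof.
  intros Z.
  assert (Hd : forall v, dot (comb a0 a1 a2 a3 reg0 reg1 reg2 reg3) v =
    a0 * dot reg0 v + a1 * dot reg1 v + a2 * dot reg2 v + a3 * dot reg3 v).
  { intros [[? ?] ?]. unfold comb, reg0, reg1, reg2, reg3, vadd, vscale, dot. ring. }
  unfold reg_map. rewrite !Hd.
  rewrite (dot_comm reg1 reg0), (dot_comm reg2 reg0), (dot_comm reg3 reg0), (dot_comm reg2 reg1),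
    (dot_comm reg3 reg1), (dot_comm reg3 reg2).
  destruct reg_gram as [[-> [-> [-> ->]]] [-> [-> [-> [-> [-> ->]]]]]].
  destruct p0 as [[x0 y0] z0], p1 as [[x1 y1] z1], p2 as [[x2 y2] z2], p3 as [[x3 y3] z3].
  unfold comb, vadd, vscale, vzero in *. injection Z; intros Ez Ey Ex.
  assert (x3 = - x0 - x1 - x2) by lra. assert (y3 = - y0 - y1 - y2) by lra.
  assert (z3 = - z0 - z1 - z2) by lra. subst. apply vec_ext; field.
Qed.

(** The map is linear, and the p_i have the same Gram matrix as the [reg_i], so it is enough to
    compute the norm of the image of a difference. *)
Lemma reg_map_isometry p0 p1 p2 p3 :
  dot p0 p0 = 1 -> dot p1 p1 = 1 -> dot p2 p2 = 1 -> dot p3 p3 = 1 ->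
  dot p0 p1 = - / 3 /\ dot p0 p2 = - / 3 /\ dot p0 p3 = - / 3 /\
  dot p1 p2 = - / 3 /\ dot p1 p3 = - / 3 /\ dot p2 p3 = - / 3 ->
  isometry3 (reg_map p0 p1 p2 p3).
Proof.
  intros U0 U1 U2 U3 G x y. unfold dist3. f_equal.
  replace (vsub (reg_map p0 p1 p2 p3 x) (reg_map p0 p1 p2 p3 y)) with (reg_map p0 p1 p2 p3 (vsub x y)).
  - set (d := vsub x y). unfold reg_map. rewrite dot_comb by assumption.
    generalize inv_sqrt3_sq. destruct d as [[a b] c]. unfold reg0, reg1, reg2, reg3, dot.
    set (s := / sqrt 3). intros Hs.
    transitivity (3 * (s * s) * (a * a + b * b + c * c)); [field | rewrite Hs; field].
  - destruct x as [[? ?] ?], y as [[? ?] ?]. unfold reg_map, reg0, reg1, reg2, reg3, dot.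
    destruct p0 as [[? ?] ?], p1 as [[? ?] ?], p2 as [[? ?] ?], p3 as [[? ?] ?]. vec.
Qed.

Lemma conv4_vertices p0 p1 p2 p3 :
  conv4 p0 p1 p2 p3 p0 /\ conv4 p0 p1 p2 p3 p1 /\ conv4 p0 p1 p2 p3 p2 /\ conv4 p0 p1 p2 p3 p3.
Proof.
  repeat split; [exists 1, 0, 0, 0 | exists 0, 1, 0, 0 | exists 0, 0, 1, 0 | exists 0, 0, 0, 1];
    (repeat split; try lra);
    destruct p0 as [[? ?] ?], p1 as [[? ?] ?], p2 as [[? ?] ?], p3 as [[? ?] ?]; vec.
Qed.

Theorem theorem2p7 :
  is_simplex reg_tet /\ (forall x, reg_tet x -> unit_ball x) /\
  (forall K : R3 -> Prop, is_simplex K -> (forall x, K x -> unit_ball x) ->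
     mean_width K <= mean_width reg_tet /\
     (mean_width K = mean_width reg_tet ->
        exists f : R3 -> R3, isometry3 f /\ (forall y, K y <-> image3 f reg_tet y))).
Proof.
  split; [exists reg0, reg1, reg2, reg3; split; [apply reg_aff_indep | reflexivity]|].
  split; [exact reg_tet_ball|].
  intros K [p0 [p1 [p2 [p3 [H HK]]]]] HB.
  destruct (conv4_vertices p0 p1 p2 p3) as [C0 [C1 [C2 C3]]].
  assert (B0 : unit_ball p0) by now apply HB, HK. assert (B1 : unit_ball p1) by now apply HB, HK.
  assert (B2 : unit_ball p2) by now apply HB, HK. assert (B3 : unit_ball p3) by now apply HB, HK.
  rewrite (mean_width_conv4 K p0 p1 p2 p3 HK), mean_width_reg_tet.
  assert (HPI : 0 < / (2 * PI)) by (apply Rinv_0_lt_compat; generalize PI_RGT_0; lra).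
  split; [apply Rmult_le_compat_l; [lra | now apply simplex_le]|].
  intros E. apply Rmult_eq_reg_l in E; [|lra].
  (* [optimal_on_sphere] speaks of the first vertex only; cyclic shifts bring each vertex to that
     place. *)
  assert (Hc := aff_indep4_cycle _ _ _ _ H). assert (Hcc := aff_indep4_cycle _ _ _ _ Hc).
  assert (Hccc := aff_indep4_cycle _ _ _ _ Hcc).
  assert (U0 := optimal_on_sphere _ _ _ _ H B0 B1 B2 B3 E).
  assert (Ec : sint (hmax p1 p2 p3 p0) = sint_opt)
    by (rewrite <- E; apply sint_ext; intros; apply hmax_cycle).
  assert (Ecc : sint (hmax p2 p3 p0 p1) = sint_opt)
    by (rewrite <- Ec; apply sint_ext; intros; apply hmax_cycle).
  assert (Eccc : sint (hmax p3 p0 p1 p2) = sint_opt)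
    by (rewrite <- Ecc; apply sint_ext; intros; apply hmax_cycle).
  assert (U1 := optimal_on_sphere _ _ _ _ Hc B1 B2 B3 B0 Ec).
  assert (U2 := optimal_on_sphere _ _ _ _ Hcc B2 B3 B0 B1 Ecc).
  assert (U3 := optimal_on_sphere _ _ _ _ Hccc B3 B0 B1 B2 Eccc).
  assert (G := proj2 (inscribed_simplex_le _ _ _ _ H U0 U1 U2 U3) E).
  assert (Z : comb 1 1 1 1 p0 p1 p2 p3 = vzero).
  { assert (S := regular_sum _ _ _ _ U0 U1 U2 U3 G). revert S.
    destruct p0 as [[? ?] ?], p1 as [[? ?] ?], p2 as [[? ?] ?], p3 as [[? ?] ?].
    unfold comb, vadd, vscale, vzero. intros S. injection S; intros. apply vec_ext; lra. }
  exists (reg_map p0 p1 p2 p3). split; [now apply reg_map_isometry|].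
  intros y. rewrite HK. split.
  - intros [a0 [a1 [a2 [a3 [A0 [A1 [A2 [A3 [As ->]]]]]]]]].
    exists (comb a0 a1 a2 a3 reg0 reg1 reg2 reg3). split; [exists a0, a1, a2, a3; auto 7|].
    now rewrite reg_map_comb.
  - intros [x [[a0 [a1 [a2 [a3 [A0 [A1 [A2 [A3 [As ->]]]]]]]]] ->]].
    exists a0, a1, a2, a3. repeat (split; [assumption|]). now apply reg_map_comb.
Qed.
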